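(* For all $\tau\in\mathbb{H}$, $$\frac{u^4}{v^2}+\frac{w^4}{u^2}+\frac{v^4}{w^2}=2\,\eta(\tau)^2\,j_7^*(\tau)^{1/3},$$ $$\frac{v^2}{u^4}+\frac{u^2}{w^4}+\frac{w^2}{v^4}=\frac{\eta^2(\tau)}{\eta^4(7\tau)}\,j_7^*(\tau)^{2/3},$$ where $j_7^*(\tau)^{1/3}$ is the cube root of $j_7^*$ meromorphic on $\mathbb{H}$ whose $q$-expansion begins $q^{-1/3}(1+O(q))$, and $j_7^*(\tau)^{2/3}=(j_7^*(\tau)^{1/3})^2$.
   Context: Let $\tau\in\mathbb{H}$, $q=e^{2\pi i\tau}$, $q^{\alpha}=e^{2\pi i\alpha\tau}$. Define $u=q^{1/56}\prod_{k\ge0}(1-q^{7k+3})(1-q^{7k+4})(1-q^{7k+7})$, $v=q^{9/56}\prod_{k\ge0}(1-q^{7k+2})(1-q^{7k+5})(1-q^{7k+7})$, $w=q^{25/56}\prod_{k\ge0}(1-q^{7k+1})(1-q^{7k+6})(1-q^{7k+7})$, $\eta(\tau)=q^{1/24}\prod_{n\ge1}(1-q^n)$, and $j_7^*(\tau)=\left(\frac{\eta(\tau)}{\eta(7\tau)}\right)^4+13+49\left(\frac{\eta(7\tau)}{\eta(\tau)}\right)^4$. *)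

(* Defs.v *)
From Stdlib Require Import Reals ClassicalEpsilon.
From Coquelicot Require Import Coquelicot.
Open Scope R_scope.

Definition Cexp (z : C) : C :=
  (exp (fst z) * cos (snd z), exp (fst z) * sin (snd z)).

Definition in_H (tau : C) : Prop := 0 < Im tau.

Definition Ci : C := (0, 1).

Definition qpow (alpha : R) (tau : C) : C :=
  Cexp (Cmult (RtoC (2 * PI * alpha)) (Cmult Ci tau)).

Definition q (tau : C) : C := qpow 1 tau.

Fixpoint partial_prod (f : nat -> C) (n : nat) : C :=
  match n with O => RtoC 1 | S m => Cmult (partial_prod f m) (f m) end.

(* value of the infinite product prod_{k>=0} f k, i.e. the limit of the
   partial products (chosen by epsilon; all products below converge) *)
Definition inf_prod (f : nat -> C) : C :=
  epsilon (inhabits (RtoC 0))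
    (fun p => filterlim (partial_prod f) eventually (locally p)).

Definition one_minus_q (tau : C) (n : nat) : C :=
  Cminus (RtoC 1) (qpow (INR n) tau).

Definition u (tau : C) : C :=
  Cmult (qpow (1/56) tau)
    (inf_prod (fun k => Cmult (Cmult (one_minus_q tau (7*k+3))
                                     (one_minus_q tau (7*k+4)))
                              (one_minus_q tau (7*k+7)))).

Definition v (tau : C) : C :=
  Cmult (qpow (9/56) tau)
    (inf_prod (fun k => Cmult (Cmult (one_minus_q tau (7*k+2))
                                     (one_minus_q tau (7*k+5)))
                              (one_minus_q tau (7*k+7)))).

Definition w (tau : C) : C :=
  Cmult (qpow (25/56) tau)
    (inf_prod (fun k => Cmult (Cmult (one_minus_q tau (7*k+1))
                                     (one_minus_q tau (7*k+6)))
                              (one_minus_q tau (7*k+7)))).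

Definition eta (tau : C) : C :=
  Cmult (qpow (1/24) tau) (inf_prod (fun k => one_minus_q tau (S k))).

Definition j7star (tau : C) : C :=
  let r := Cdiv (eta tau) (eta (Cmult (RtoC 7) tau)) in
  Cplus (Cplus (Cpow r 4) (RtoC 13))
        (Cmult (RtoC 49) (Cpow (Cinv r) 4)).

(* c is the holomorphic (equivalently meromorphic, since j7star is
   holomorphic on H) cube root of j7star on H whose q-expansion begins
   q^{-1/3}(1 + O(q)):  c(tau) q^{1/3} = 1 + O(q) as Im tau -> +oo. *)
Definition is_j7star_cube_root (c : C -> C) : Prop :=
  (forall tau, in_H tau -> ex_derive (K:=C_AbsRing) (V:=C_NormedModule) c tau) /\
  (forall tau, in_H tau -> Cpow (c tau) 3 = j7star tau) /\
  (exists K M : R, forall tau, M < Im tau ->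
      Cmod (Cminus (Cmult (c tau) (qpow (1/3) tau)) (RtoC 1)) <= K * Cmod (q tau)).

(* Main.v *)
(** Put [p = q^7], [theta(x) = prod_k (1 - x p^k)(1 - p^(k+1)/x)] and let [U], [V], [W] be its values
    at [q^3], [q^2], [q], so that [u], [v], [w] are these numbers up to a power of [q] and a
    common factor, and [h = (eta(tau)/eta(7 tau))^4 = (UVW)^4 / q].

    By the Jacobi triple product, [theta(xy) theta(x/y) / x] is a 2x2 determinant in functions of
    [x] and [y]. Hence [theta(xy) theta(x/y) / (theta(x) theta(y))^2] behaves like a difference
    [wp(x) - wp(y)]. Among the points [q, q^2, q^3] of order 7 this additivity is Klein's quartic
    [UV^3 = X + Y], with [X = U^3 W] and [Y = q W^3 V]. The cubic whose roots are the three
    half-periods takes at these three points values given by the duplication formula, and its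
    discriminant is a product of theta values equal to [p / 16]; comparing the two yields
    [h X Y (X + Y) = X^3 - 5 X^2 Y - 8 X Y^2 - Y^3]. This makes
    [q^(-1/3) (X^2 + XY + Y^2) / (UVW)^4] a cube root of [j_7^* = h + 13 + 49/h], and both
    identities become rational identities in [U], [V], [W].

    Any other cube root with the prescribed expansion agrees with this one high up in the half
    plane. The agreement propagates downwards because two continuous cube roots agree on an open
    and closed set: a zero of the explicit one is isolated (or it vanishes nearby), and a
    punctured disc is connected. *)
Require Import Defs.
From Stdlib Require Import Reals Lra Lia List ZArith Permutation ClassicalEpsilon FinFun.
From Coquelicot Require Import Coquelicot.
Open Scope C_scope.

(** * The discriminant relation *)

(** Such identities are usually read off from the poles of modular functions on X_0(7). Here no
    divisor is computed: every theta identity rests on a rearrangement of absolutely convergent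
    series or products, and the rest is rational algebra.

    The cubic of the half-periods is monic, so three values determine it. Placing the points of
    order 7 at -1, 0 and d = Y / X gives the universal elliptic curve with a point of order 7, and
    [1 - 5 * d - 8 * d ^ 2 - d ^ 3] is the cubic factor of Tate's discriminant d^7 (d - 1)^7 (d^3 -
    8 d^2 + 5 d + 1) after d -> -d.

    The statement speaks of every function with the prescribed properties, so exhibiting one is not
    enough. The obstacle is the zeros of j_7^*: all cube roots coincide there, and a continuous root
    might change branch in passing through. Holomorphy of the explicit root therefore serves twice,
    for existence and to isolate its zeros. *)

Lemma Cinv_nz (z : C) : z <> 0 -> / z <> 0.
Proof.
intros Hz H. apply C1_nz. rewrite <- (Cinv_r z Hz), H. ring.
Qed.

Ltac nz := unfold Cdiv; repeat match goal with
  | |- Cmult _ _ <> _ => apply Cmult_neq_0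
  | |- Cpow _ _ <> _ => apply Cpow_nz
  | |- Cinv _ <> _ => apply Cinv_nz
  end; auto.

(** A monic cubic is fixed by its values at three distinct points, here -1, 0 and d. The values give
    linear equations for the elementary symmetric functions of the roots, in which the discriminant
    is a polynomial. *)
Lemma scaled_cubic_discriminant (d e1 e2 e3 : C) :
  d <> 0 -> 1 + d <> 0 ->
  (- (1) - e1) * (- (1) - e2) * (- (1) - e3) = - ((1 + d) ^ 3 / (4 * d)) ->
  (0 - e1) * (0 - e2) * (0 - e3) = - (d / (4 * (1 + d))) ->
  (d - e1) * (d - e2) * (d - e3) = - (d ^ 3 * (1 + d) / 4) ->
  16 * ((e1 - e2) * (e2 - e3) * (e1 - e3)) ^ 2
  = d * (1 + d) * (1 - 5 * d - 8 * d ^ 2 - d ^ 3).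
Proof.
intros Hd Hd1 H1 H0 Hdd.
assert (E4 : (4 : C) <> 0) by (intros H; apply RtoC_inj in H; lra).
set (s1 := e1 + e2 + e3). set (s2 := e1 * e2 + e2 * e3 + e1 * e3). set (s3 := e1 * e2 * e3).
assert (G3 : s3 = d / (4 * (1 + d))).
{ replace s3 with (- ((0 - e1) * (0 - e2) * (0 - e3))) by (unfold s3; ring). rewrite H0. ring. }
assert (G1 : 1 + s1 + s2 + s3 = (1 + d) ^ 3 / (4 * d)).
{ replace (1 + s1 + s2 + s3) with (- ((- (1) - e1) * (- (1) - e2) * (- (1) - e3)))
    by (unfold s1, s2, s3; ring). rewrite H1. ring. }
assert (G2 : d ^ 3 - s1 * d ^ 2 + s2 * d - s3 = - (d ^ 3 * (1 + d) / 4)).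
{ rewrite <- Hdd. unfold s1, s2, s3; ring. }
assert (K2 : s2 = (1 + d) ^ 3 / (4 * d) - 1 - s1 - d / (4 * (1 + d))).
{ rewrite <- G1, <- G3. ring. }
(* Eliminating [s2] and [s3] leaves one linear equation for [s1]. Its coefficient d (1 + d) is
   nonzero exactly because the three points are distinct. *)
assert (K1 : s1 = (d ^ 3 + d ^ 3 * (1 + d) / 4 - d / (4 * (1 + d))
     + d * ((1 + d) ^ 3 / (4 * d) - 1 - d / (4 * (1 + d)))) / (d * (1 + d))).
{ assert (s1 * (d * (1 + d)) = d ^ 3 + d ^ 3 * (1 + d) / 4 - d / (4 * (1 + d))
     + d * ((1 + d) ^ 3 / (4 * d) - 1 - d / (4 * (1 + d)))).
  { rewrite <- G3, <- G1.
    replace (d ^ 3 * (1 + d) / 4) with (- (d ^ 3 - s1 * d ^ 2 + s2 * d - s3)) by (rewrite G2; ring).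
    ring. }
  rewrite <- H. field. auto. }
replace (((e1 - e2) * (e2 - e3) * (e1 - e3)) ^ 2) with
  (s1 ^ 2 * s2 ^ 2 - 4 * s2 ^ 3 - 4 * s1 ^ 3 * s3 - 27 * s3 ^ 2 + 18 * s1 * s2 * s3)
  by (unfold s1, s2, s3; ring).
rewrite K2, G3, K1. field. auto.
Qed.

(** The [f] stand for normalised wp values at q, q^2, q^3, the [e] for those at the half-periods.
    Doubling permutes these three points up to sign, so the cubic takes at each of them a value
    monomial in q, U, V, W. *)
Lemma level7_relation (q U V W f1 f2 f3 e1 e2 e3 : C) :
  q <> 0 -> U <> 0 -> V <> 0 -> W <> 0 ->
  f2 - f1 = q * U / (V ^ 2 * W) ->
  f3 - f2 = q ^ 2 * W / (U ^ 2 * V) ->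
  f3 - f1 = q * V / (U * W ^ 2) ->
  (f1 - e1) * (f1 - e2) * (f1 - e3) = - (q ^ 2 * V ^ 2 / (4 * W ^ 8)) ->
  (f2 - e1) * (f2 - e2) * (f2 - e3) = - (q ^ 4 * U ^ 2 / (4 * V ^ 8)) ->
  (f3 - e1) * (f3 - e2) * (f3 - e3) = - (q ^ 6 * W ^ 2 / (4 * U ^ 8)) ->
  16 * ((e1 - e2) * (e2 - e3) * (e1 - e3)) ^ 2 = q ^ 7 ->
  let X := U ^ 3 * W in let Y := q * W ^ 3 * V in
  U * V ^ 3 = X + Y /\
  (U * V * W) ^ 4 * (X * Y * (X + Y)) = q * (X ^ 3 - 5 * X ^ 2 * Y - 8 * X * Y ^ 2 - Y ^ 3).
Proof.
intros Hq HU HV HW D12 D23 D13 F1 F2 F3 Disc X Y.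
assert (E4 : (4 : C) <> 0) by (intros H; apply RtoC_inj in H; lra).
assert (Klein : U * V ^ 3 = X + Y).
{ assert (H : f3 - f1 = (f3 - f2) + (f2 - f1)) by ring.
  rewrite D12, D23, D13 in H. unfold X, Y.
  replace (U * V ^ 3) with (q * V / (U * W ^ 2) * (U ^ 2 * V ^ 2 * W ^ 2 / q)) by (field; auto).
  rewrite H. field; auto. }
split; [exact Klein|].
assert (HX : X <> 0) by (unfold X; nz).
assert (HY : Y <> 0) by (unfold Y; nz).
assert (HXY : X + Y <> 0) by (rewrite <- Klein; nz).
set (d := Y / X).
assert (Hd : d <> 0) by (unfold d; nz).
assert (Hd1 : 1 + d = U * V ^ 3 / X) by (rewrite Klein; unfold d; field; auto).
assert (Hd1' : 1 + d <> 0).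
{ rewrite Hd1, Klein; nz. }
(* The affine map that sends f2 to 0 and f1 to -1 sends f3 to d. It divides differences by l, hence
   the discriminant by l^6. *)
set (l := q * U / (V ^ 2 * W)).
assert (Hl : l <> 0) by (unfold l; nz).
assert (Sc : forall f k, f - f2 = l * k -> forall F,
  (f - e1) * (f - e2) * (f - e3) = l ^ 3 * F ->
  (k - (e1 - f2) / l) * (k - (e2 - f2) / l) * (k - (e3 - f2) / l) = F).
{ intros f k Hk F HF.
  replace F with (l ^ 3 * F / l ^ 3) by (field; auto). rewrite <- HF.
  replace f with (f2 + l * k) by (rewrite <- Hk; ring). field; auto. }
assert (S : 16 * (((e1 - f2) / l - (e2 - f2) / l) * ((e2 - f2) / l - (e3 - f2) / l)
   * ((e1 - f2) / l - (e3 - f2) / l)) ^ 2 = d * (1 + d) * (1 - 5 * d - 8 * d ^ 2 - d ^ 3)).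
{ apply scaled_cubic_discriminant; auto.
  - apply (Sc f1).
    + rewrite <- (Copp_minus_distr f2 f1), D12. fold l. ring.
    + rewrite F1, Hd1; unfold d, l, X, Y; field; auto.
  - apply (Sc f2).
    + ring.
    + rewrite F2, Hd1; unfold d, l, X, Y; field; auto.
  - apply (Sc f3).
    + rewrite D23; unfold d, l, X, Y; field; auto.
    + rewrite F3, Hd1; unfold d, l, X, Y; field; auto. }
assert (R : q ^ 7 = l ^ 6 * (d * (1 + d) * (1 - 5 * d - 8 * d ^ 2 - d ^ 3))).
{ rewrite <- S, <- Disc. field; auto. }
rewrite Hd1 in R.
assert (HP : 1 - 5 * d - 8 * d ^ 2 - d ^ 3 = q ^ 7 / (l ^ 6 * d * (U * V ^ 3 / X))).
{ rewrite R. field. repeat split; auto. }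
rewrite <- Klein.
transitivity (q * X ^ 3 * (1 - 5 * d - 8 * d ^ 2 - d ^ 3)).
{ rewrite HP. unfold d, l, X, Y; field; auto. }
unfold d; field; auto.
Qed.

(** * Limits and unconditional sums *)

Lemma Cmod_le_Re_Im (z : C) : (Cmod z <= Rabs (Re z) + Rabs (Im z))%R.
Proof.
destruct z as [a b]. simpl.
replace ((a, b) : C) with (RtoC a + Defs.Ci * RtoC b) by
  (unfold Defs.Ci, RtoC, Cplus, Cmult; simpl; f_equal; ring).
eapply Rle_trans; [apply Cmod_triangle|].
rewrite Cmod_mult, !Cmod_R. replace (Cmod Defs.Ci) with 1%R; [lra|].
unfold Cmod, Defs.Ci; simpl. replace (_ + _)%R with 1%R by ring. now rewrite sqrt_1.
Qed.

Lemma im_le_Cmod (z : C) : (Rabs (Im z) <= Cmod z)%R.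
Proof. eapply Rle_trans; [|apply Rmax_Cmod]. apply Rmax_r. Qed.

Lemma Cmod_sub_sym (x y : C) : Cmod (x - y) = Cmod (y - x).
Proof. rewrite <- Cmod_opp. f_equal. ring. Qed.

Lemma Cmod_sub_triangle (x y z : C) : (Cmod (x - z) <= Cmod (x - y) + Cmod (y - z))%R.
Proof. replace (x - z) with ((x - y) + (y - z)) by ring. apply Cmod_triangle. Qed.

Lemma Cmod_sub_ge (x y : C) : (Cmod x - Cmod y <= Cmod (x - y))%R.
Proof.
assert (H := Cmod_triangle (x - y) y). replace (x - y + y) with x in H by ring. lra.
Qed.

(** Stated for an arbitrary filter because four kinds of limit occur: along sequences, along finite
    index sets, along pairs of finite index sets, and at a point of the plane. *)
Definition clim {T : Type} (F : (T -> Prop) -> Prop) (f : T -> C) (l : C) : Prop :=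
  forall eps : R, (0 < eps)%R -> F (fun t => (Cmod (f t - l) < eps)%R).

Section Limits.
Context {T : Type} (F : (T -> Prop) -> Prop) {HF : ProperFilter F}.

Lemma clim_const (c : C) : clim F (fun _ => c) c.
Proof.
intros eps He. apply filter_forall. intros _.
replace (c - c) with (RtoC 0) by ring. now rewrite Cmod_0.
Qed.

Lemma clim_ext (f g : T -> C) (l : C) : F (fun t => f t = g t) -> clim F f l -> clim F g l.
Proof.
intros H Hf eps He. generalize (filter_and (F := F) _ _ H (Hf eps He)).
apply filter_imp. intros t [H1 H2]. now rewrite <- H1.
Qed.

Lemma clim_unique (f : T -> C) (l l' : C) : clim F f l -> clim F f l' -> l = l'.
Proof.
intros H H'.
destruct (Req_dec (Cmod (l - l')) 0) as [E|E].
- apply Cmod_eq_0 in E. replace l with ((l - l') + l') by ring. rewrite E. ring.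
- assert (P := Cmod_ge_0 (l - l')).
  set (e := (Cmod (l - l') / 2)%R). assert (He : (0 < e)%R) by (unfold e; lra).
  destruct (filter_ex (F := F) _ (filter_and (F := F) _ _ (H e He) (H' e He))) as [t [H1 H2]].
  assert (Q := Cmod_sub_triangle l (f t) l'). rewrite (Cmod_sub_sym l (f t)) in Q.
  unfold e in *; lra.
Qed.

Lemma clim_plus (f g : T -> C) (l m : C) :
  clim F f l -> clim F g m -> clim F (fun t => f t + g t) (l + m).
Proof.
intros H H' e He.
generalize (filter_and (F := F) _ _ (H (e/2)%R ltac:(lra)) (H' (e/2)%R ltac:(lra))).
apply filter_imp. intros t [H1 H2].
replace (f t + g t - (l + m)) with ((f t - l) + (g t - m)) by ring.
assert (Q := Cmod_triangle (f t - l) (g t - m)). lra.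
Qed.

Lemma clim_mult (f g : T -> C) (l m : C) :
  clim F f l -> clim F g m -> clim F (fun t => f t * g t) (l * m).
Proof.
intros H H' e He.
set (K := (Cmod l + Cmod m + 1)%R).
assert (P1 := Cmod_ge_0 l). assert (P2 := Cmod_ge_0 m).
assert (HK : (0 < K)%R) by (unfold K; lra).
set (d := Rmin 1 (e / (2 * K))).
assert (Hd : (0 < d)%R).
{ unfold d. apply Rmin_pos; [lra|]. apply Rdiv_lt_0_compat; lra. }
generalize (filter_and (F := F) _ _ (H d Hd) (H' d Hd)).
apply filter_imp. intros t [H1 H2].
replace (f t * g t - l * m) with ((f t - l) * (g t - m) + ((f t - l) * m + l * (g t - m))) by ring.
assert (Q1 := Cmod_triangle ((f t - l) * (g t - m)) ((f t - l) * m + l * (g t - m))).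
assert (Q2 := Cmod_triangle ((f t - l) * m) (l * (g t - m))).
rewrite !Cmod_mult in Q1. rewrite !Cmod_mult in Q2.
assert (D1 : (d <= 1)%R) by apply Rmin_l.
assert (D2 : (d * K <= e / 2)%R).
{ assert (d <= e / (2 * K))%R by apply Rmin_r.
  apply Rmult_le_compat_r with (r := K) in H0; [|lra].
  replace (e / (2 * K) * K)%R with (e / 2)%R in H0 by (field; lra). lra. }
assert (R1 := Cmod_ge_0 (f t - l)). assert (R2 := Cmod_ge_0 (g t - m)).
unfold K in D2. nra.
Qed.

Lemma clim_opp (f : T -> C) (l : C) : clim F f l -> clim F (fun t => - f t) (- l).
Proof.
intros H e He. generalize (H e He). apply filter_imp. intros t Ht.
replace (- f t - - l) with (- (f t - l)) by ring. now rewrite Cmod_opp.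
Qed.

Lemma clim_minus (f g : T -> C) (l m : C) :
  clim F f l -> clim F g m -> clim F (fun t => f t - g t) (l - m).
Proof. intros H H'. apply (clim_plus f (fun t => - g t)); [exact H | now apply clim_opp]. Qed.

Lemma clim_inv (f : T -> C) (l : C) : l <> 0 -> clim F f l -> clim F (fun t => / f t) (/ l).
Proof.
intros Hl H e He.
assert (P := proj1 (Cmod_gt_0 l) Hl).
set (d := Rmin (Cmod l / 2) (e * (Cmod l * Cmod l / 2))).
assert (Hd : (0 < d)%R) by (unfold d; apply Rmin_pos; [lra|]; apply Rmult_lt_0_compat; nra).
generalize (H d Hd). apply filter_imp. intros t Ht.
assert (D1 : (d <= Cmod l / 2)%R) by apply Rmin_l.
assert (D2 : (d <= e * (Cmod l * Cmod l / 2))%R) by apply Rmin_r.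
assert (Q := Cmod_sub_ge l (f t)). rewrite Cmod_sub_sym in Q.
assert (Hf : (0 < Cmod (f t))%R) by lra.
assert (Hf' : f t <> 0) by now apply Cmod_gt_0.
replace (/ f t - / l) with (- (f t - l) / (f t * l)) by (field; auto).
rewrite Cmod_div, Cmod_opp, Cmod_mult by nz.
apply Rlt_div_l; [nra|].
assert (Cmod l * Cmod l / 2 <= Cmod (f t) * Cmod l)%R by nra.
nra.
Qed.

Lemma clim_le (f : T -> C) (l : C) (M : R) :
  clim F f l -> F (fun t => (Cmod (f t) <= M)%R) -> (Cmod l <= M)%R.
Proof.
intros H HM. apply Rle_plus_epsilon. intros e He.
destruct (filter_ex (F := F) _ (filter_and (F := F) _ _ (H e He) HM)) as [t [H1 H2]].
assert (Q := Cmod_sub_ge l (f t)). rewrite Cmod_sub_sym in Q. lra.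
Qed.

Lemma clim_cauchy (f : T -> C) :
  (forall eps : R, (0 < eps)%R -> exists P, F P /\
     forall x y, P x -> P y -> (Cmod (f x - f y) < eps)%R) ->
  exists l, clim F f l.
Proof.
intros H.
assert (HR : forall g : C -> R, (forall x y : C, Rabs (g x - g y) <= Cmod (x - y))%R ->
  exists y : R, filterlim (fun t => g (f t)) F (locally y)).
{ intros g Hg. apply (filterlim_locally_cauchy (U := R_CompleteSpace)).
  intros eps. destruct (H eps (cond_pos eps)) as [P [HP HP']].
  exists P. split; [exact HP|]. intros x y Hx Hy.
  change (Rabs (g (f y) - g (f x)) < eps)%R.
  eapply Rle_lt_trans; [apply Hg|]. now apply HP'. }
destruct (HR Re) as [a Ha].
{ intros x y. replace (Re x - Re y)%R with (Re (x - y)) by reflexivity. apply re_le_Cmod. }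
destruct (HR Im) as [b Hb].
{ intros x y. replace (Im x - Im y)%R with (Im (x - y)) by reflexivity. apply im_le_Cmod. }
exists (a, b). intros e He.
assert (He2 : (0 < e / 2)%R) by lra.
generalize (filter_and (F := F) _ _ (Ha _ (locally_ball a (mkposreal _ He2)))
  (Hb _ (locally_ball b (mkposreal _ He2)))).
apply filter_imp. intros t [H1 H2].
change (Rabs (Re (f t) - a) < e / 2)%R in H1. change (Rabs (Im (f t) - b) < e / 2)%R in H2.
eapply Rle_lt_trans; [apply Cmod_le_Re_Im|].
change (Rabs (Re (f t) - a) + Rabs (Im (f t) - b) < e)%R. lra.
Qed.
End Limits.

(** * Sums over finite subsets of an arbitrary index type *)

Definition dec {A : Type} (x y : A) : {x = y} + {x <> y} := excluded_middle_informative (x = y).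

Definition lsum {I : Type} (f : I -> C) (l : list I) : C :=
  fold_right (fun i s => f i + s) 0 l.

Definition rsum {I : Type} (f : I -> R) (l : list I) : R :=
  fold_right (fun i s => (f i + s)%R) 0%R l.

(** Duplicate-free lists stand for finite subsets. Limits along this filter do not depend on an
    enumeration, so a sum can be carried along any bijection of index types. *)
Definition finsets (I : Type) (P : list I -> Prop) : Prop :=
  exists L0, forall L, NoDup L -> incl L0 L -> P L.

Global Instance finsets_filter (I : Type) : ProperFilter (finsets I).
Proof.
split.
- intros P [L0 H]. exists (nodup dec L0). apply H; [apply NoDup_nodup|].
  intros x Hx. now apply nodup_In.
- split.
  + exists nil. trivial.
  + intros P Q [L1 H1] [L2 H2]. exists (L1 ++ L2). intros L HL Hi.
    apply incl_app_inv in Hi. split; [apply H1 | apply H2]; tauto.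
  + intros P Q H [L0 H0]. exists L0. auto.
Qed.

Definition has_sum {I : Type} (f : I -> C) (s : C) : Prop := clim (finsets I) (lsum f) s.

Definition summable {I : Type} (g : I -> R) : Prop :=
  (forall i, 0 <= g i)%R /\ exists M, forall L, NoDup L -> (rsum g L <= M)%R.

Lemma lsum_app {I} (f : I -> C) l l' : lsum f (l ++ l') = lsum f l + lsum f l'.
Proof. induction l; simpl; [|rewrite IHl]; ring. Qed.

Lemma lsum_map {I J} (f : I -> C) (g : J -> I) l : lsum f (map g l) = lsum (fun j => f (g j)) l.
Proof. induction l; simpl; [|rewrite IHl]; ring. Qed.

Lemma lsum_ext {I} (f g : I -> C) l : (forall i, f i = g i) -> lsum f l = lsum g l.
Proof. intros H; induction l; simpl; [|rewrite IHl, H]; ring. Qed.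

Lemma lsum_perm {I} (f : I -> C) l l' : Permutation l l' -> lsum f l = lsum f l'.
Proof. induction 1; simpl; try rewrite IHPermutation; try ring. congruence. Qed.

Lemma lsum_plus {I} (f g : I -> C) l : lsum (fun i => f i + g i) l = lsum f l + lsum g l.
Proof. induction l; simpl; [|rewrite IHl]; ring. Qed.

Lemma lsum_scal {I} (c : C) (f : I -> C) l : lsum (fun i => c * f i) l = c * lsum f l.
Proof. induction l; simpl; [|rewrite IHl]; ring. Qed.

Lemma lsum_list_prod {I J} (f : I -> C) (g : J -> C) A B :
  lsum (fun x => f (fst x) * g (snd x)) (list_prod A B) = lsum f A * lsum g B.
Proof.
induction A; simpl; [ring|]. rewrite lsum_app, IHA, lsum_map. simpl.
rewrite lsum_scal. ring.
Qed.

Lemma rsum_app {I} (f : I -> R) l l' : rsum f (l ++ l') = (rsum f l + rsum f l')%R.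
Proof. induction l; simpl; [|rewrite IHl]; ring. Qed.

Lemma rsum_map {I J} (f : I -> R) (g : J -> I) l : rsum f (map g l) = rsum (fun j => f (g j)) l.
Proof. induction l; simpl; [|rewrite IHl]; ring. Qed.

Lemma rsum_perm {I} (f : I -> R) l l' : Permutation l l' -> rsum f l = rsum f l'.
Proof. induction 1; simpl; try rewrite IHPermutation; try ring. congruence. Qed.

Lemma rsum_ge0 {I} (f : I -> R) l : (forall i, 0 <= f i)%R -> (0 <= rsum f l)%R.
Proof. intros H; induction l; simpl; [lra|]. specialize (H a); lra. Qed.

Lemma rsum_le {I} (f g : I -> R) l : (forall i, f i <= g i)%R -> (rsum f l <= rsum g l)%R.
Proof. intros H; induction l; simpl; [lra|]. specialize (H a); lra. Qed.

Lemma rsum_scal {I} (c : R) (f : I -> R) l : rsum (fun i => (c * f i)%R) l = (c * rsum f l)%R.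
Proof. induction l; simpl; [|rewrite IHl]; ring. Qed.

Lemma rsum_list_prod {I J} (f : I -> R) (g : J -> R) A B :
  rsum (fun x => (f (fst x) * g (snd x))%R) (list_prod A B) = (rsum f A * rsum g B)%R.
Proof.
induction A; simpl; [ring|]. rewrite rsum_app, IHA, rsum_map. simpl.
rewrite rsum_scal. ring.
Qed.

Lemma Cmod_lsum {I} (f : I -> C) l : (Cmod (lsum f l) <= rsum (fun i => Cmod (f i)) l)%R.
Proof.
induction l; simpl; [rewrite Cmod_0; lra|].
assert (H := Cmod_triangle (f a) (lsum f l)). lra.
Qed.

Lemma NoDup_split {I} (L0 L : list I) : NoDup L0 -> incl L0 L ->
  exists L', Permutation L (L0 ++ L').
Proof.
revert L; induction L0 as [|a L0 IH]; intros L N H; [now exists L|].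
inversion_clear N as [|? ? Ha N'].
destruct (in_split a L (H a (or_introl eq_refl))) as [l1 [l2 ->]].
destruct (IH (l1 ++ l2) N') as [L' HL'].
- intros x Hx. assert (Hx' := H x (or_intror Hx)).
  apply in_app_iff in Hx'. apply in_app_iff. simpl in Hx'.
  destruct Hx' as [|[->|]]; tauto.
- exists L'. simpl. rewrite <- HL'. symmetry. apply Permutation_middle.
Qed.

Lemma rsum_incl {I} (g : I -> R) (L0 L : list I) :
  (forall i, 0 <= g i)%R -> NoDup L0 -> incl L0 L -> (rsum g L0 <= rsum g L)%R.
Proof.
intros Hg N H. destruct (NoDup_split L0 L N H) as [L' HL'].
rewrite (rsum_perm g _ _ HL'), rsum_app. assert (K := rsum_ge0 g L' Hg). lra.
Qed.

(** Take a finite set whose sum comes within eps of the supremum of all finite sums: anything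
    disjoint from it adds less than eps. *)
Lemma summable_tail {I} (g : I -> R) : summable g -> forall eps, (0 < eps)%R ->
  exists L0, NoDup L0 /\ forall L', NoDup (L0 ++ L') -> (rsum g L' < eps)%R.
Proof.
intros [Hg [M HM]] eps He.
destruct (completeness (fun x => exists L, NoDup L /\ x = rsum g L)) as [s [Hs1 Hs2]].
- exists M. intros x [L [HL ->]]. now apply HM.
- exists 0%R, nil. split; [constructor | reflexivity].
- destruct (classic (exists L, NoDup L /\ (s - eps < rsum g L)%R)) as [[L0 [N H]]|H].
  + exists L0. split; [exact N|]. intros L' N'.
    assert (rsum g (L0 ++ L') <= s)%R by (apply Hs1; now exists (L0 ++ L')).
    rewrite rsum_app in H0. lra.
  + exfalso. assert (s <= s - eps)%R; [|lra]. apply Hs2. intros x [L [HL ->]].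
    apply Rnot_lt_le. intro. apply H. now exists L.
Qed.

Lemma lsum_tail {I} (f : I -> C) (g : I -> R) (L0 L : list I) (eps : R) :
  (forall i, Cmod (f i) <= g i)%R -> NoDup L0 ->
  (forall L', NoDup (L0 ++ L') -> (rsum g L' < eps)%R) ->
  NoDup L -> incl L0 L -> (Cmod (lsum f L - lsum f L0) < eps)%R.
Proof.
intros Hf N0 H N Hi.
destruct (NoDup_split L0 L N0 Hi) as [L' HL'].
rewrite (lsum_perm f _ _ HL'), lsum_app.
replace (lsum f L0 + lsum f L' - lsum f L0) with (lsum f L') by ring.
eapply Rle_lt_trans; [apply Cmod_lsum|].
eapply Rle_lt_trans; [apply (rsum_le _ g); exact Hf|].
apply H. now apply (Permutation_NoDup HL').
Qed.

Lemma summable_has_sum {I} (f : I -> C) : summable (fun i => Cmod (f i)) -> exists s, has_sum f s.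
Proof.
intros H. apply clim_cauchy; [apply finsets_filter|]. intros eps He.
destruct (summable_tail _ H (eps / 2) ltac:(lra)) as [L0 [N HL0]].
exists (fun L => NoDup L /\ incl L0 L). split; [exists L0; tauto|].
intros L L' [N1 I1] [N2 I2].
assert (K1 := lsum_tail f _ L0 L (eps/2) (fun i => Rle_refl _) N HL0 N1 I1).
assert (K2 := lsum_tail f _ L0 L' (eps/2) (fun i => Rle_refl _) N HL0 N2 I2).
assert (K := Cmod_sub_triangle (lsum f L) (lsum f L0) (lsum f L')).
rewrite (Cmod_sub_sym (lsum f L0)) in K. lra.
Qed.

Lemma has_sum_unique {I} (f : I -> C) s s' : has_sum f s -> has_sum f s' -> s = s'.
Proof. apply clim_unique. apply finsets_filter. Qed.

Lemma has_sum_ext {I} (f g : I -> C) s : (forall i, f i = g i) -> has_sum f s -> has_sum g s.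
Proof.
intros H. apply clim_ext; [apply finsets_filter|]. apply filter_forall.
intros L. now apply lsum_ext.
Qed.

Lemma has_sum_plus {I} (f g : I -> C) s t :
  has_sum f s -> has_sum g t -> has_sum (fun i => f i + g i) (s + t).
Proof.
intros Hf Hg. apply (clim_ext _ (fun L => lsum f L + lsum g L)).
- apply filter_forall. intros L. now rewrite lsum_plus.
- apply clim_plus; auto. apply finsets_filter.
Qed.

Lemma has_sum_scal {I} (c : C) (f : I -> C) s : has_sum f s -> has_sum (fun i => c * f i) (c * s).
Proof.
intros Hf. apply (clim_ext _ (fun L => c * lsum f L)).
- apply filter_forall. intros L. now rewrite lsum_scal.
- apply (clim_mult _ (fun _ => c)); auto; try apply clim_const; apply finsets_filter.
Qed.

Lemma has_sum_reindex {I J} (g : J -> I) (h : I -> J) (f : I -> C) s :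
  (forall i, g (h i) = i) -> (forall j, h (g j) = j) ->
  has_sum f s -> has_sum (fun j => f (g j)) s.
Proof.
intros Hgh Hhg H eps He. destruct (H eps He) as [L0 H0].
exists (map h L0). intros L N Hi. rewrite <- lsum_map. apply H0.
- apply Injective_map_NoDup; [|exact N]. intros x y E. rewrite <- (Hhg x), E. apply Hhg.
- intros x Hx. rewrite <- (Hgh x). apply in_map, Hi. now apply in_map.
Qed.

Lemma has_sum_single {I} (f : I -> C) (i0 : I) :
  (forall i, i <> i0 -> f i = 0) -> has_sum f (f i0).
Proof.
intros H eps He. exists (i0 :: nil). intros L N Hi.
destruct (NoDup_split (i0 :: nil) L) as [L' HL']; [repeat constructor; tauto|exact Hi|].
rewrite (lsum_perm f _ _ HL'). simpl.
assert (Z : lsum f L' = 0).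
{ apply (Permutation_NoDup HL') in N. simpl in N. inversion_clear N as [|? ? Ha _].
  clear - H Ha. induction L' as [|a L' IH]; [reflexivity|]. simpl in *.
  rewrite H, IH by tauto. ring. }
rewrite Z. replace (f i0 + 0 - f i0) with (RtoC 0) by ring. now rewrite Cmod_0.
Qed.

Definition lefts {I J} (L : list (I + J)) : list I :=
  flat_map (fun x => match x with inl i => i :: nil | inr _ => nil end) L.
Definition rights {I J} (L : list (I + J)) : list J :=
  flat_map (fun x => match x with inl _ => nil | inr j => j :: nil end) L.

Lemma in_lefts {I J} (L : list (I + J)) i : In i (lefts L) <-> In (inl i) L.
Proof.
unfold lefts. rewrite in_flat_map. split.
- intros [[x|x] [H E]]; simpl in E; [destruct E as [E|[]]; now subst | tauto].
- intros H. exists (inl i). simpl; tauto.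
Qed.

Lemma in_rights {I J} (L : list (I + J)) j : In j (rights L) <-> In (inr j) L.
Proof.
unfold rights. rewrite in_flat_map. split.
- intros [[x|x] [H E]]; simpl in E; [tauto | destruct E as [E|[]]; now subst].
- intros H. exists (inr j). simpl; tauto.
Qed.

Lemma has_sum_sum {I J} (f : I + J -> C) s t :
  has_sum (fun i => f (inl i)) s -> has_sum (fun j => f (inr j)) t -> has_sum f (s + t).
Proof.
intros Hf Hg eps He.
destruct (Hf (eps / 2)%R ltac:(lra)) as [A HA].
destruct (Hg (eps / 2)%R ltac:(lra)) as [B HB].
exists (map inl A ++ map inr B). intros L N Hi.
assert (E : lsum f L = lsum (fun i => f (inl i)) (lefts L) + lsum (fun j => f (inr j)) (rights L)).
{ clear. induction L as [|[a|a] L IH]; simpl; [ring| |]; rewrite IH; ring. }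
assert (N1 : NoDup (lefts L) /\ NoDup (rights L)).
{ clear - N. induction L as [|[a|a] L IH]; simpl; [repeat constructor| |];
    inversion_clear N as [|? ? Ha N']; destruct (IH N'); split; auto; constructor; auto.
  - now rewrite in_lefts.
  - now rewrite in_rights. }
rewrite E.
assert (K1 := HA (lefts L) (proj1 N1)). assert (K2 := HB (rights L) (proj2 N1)).
assert (J1 : incl A (lefts L)).
{ intros x Hx. apply in_lefts, Hi, in_or_app. left. now apply in_map. }
assert (J2 : incl B (rights L)).
{ intros x Hx. apply in_rights, Hi, in_or_app. right. now apply in_map. }
specialize (K1 J1). specialize (K2 J2).
match goal with |- (Cmod (?a + ?b - (s + t)) < _)%R =>
  replace (a + b - (s + t)) with ((a - s) + (b - t)) by ring;
  assert (K := Cmod_triangle (a - s) (b - t)) end. lra.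
Qed.

Lemma NoDup_list_prod {I J} (A : list I) (B : list J) :
  NoDup A -> NoDup B -> NoDup (list_prod A B).
Proof.
intros HA HB. induction HA as [|a A Ha N IH]; simpl; [constructor|].
apply NoDup_app; auto.
- apply Injective_map_NoDup; auto. intros x y E. congruence.
- intros x Hx Hx'. apply in_map_iff in Hx. destruct Hx as [y [<- _]].
  apply in_prod_iff in Hx'. tauto.
Qed.

Lemma summable_prod {I J} (f : I -> R) (g : J -> R) : summable f -> summable g ->
  summable (fun x => (f (fst x) * g (snd x))%R).
Proof.
intros [Hf [M HM]] [Hg [N HN]]. split.
{ intros i. now apply Rmult_le_pos. }
exists (M * N)%R. intros L HL.
set (A := nodup dec (map fst L)). set (B := nodup dec (map snd L)).
eapply Rle_trans; [apply (rsum_incl _ L (list_prod A B))|].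
- intros i. now apply Rmult_le_pos.
- exact HL.
- intros [x y] H. apply in_prod_iff. split; apply nodup_In.
  + apply (in_map fst _ _ H).
  + apply (in_map snd _ _ H).
- rewrite rsum_list_prod.
  apply Rmult_le_compat; try now apply rsum_ge0.
  + apply HM, NoDup_nodup.
  + apply HN, NoDup_nodup.
Qed.

Lemma has_sum_prod {I J} (f : I -> C) (g : J -> C) s t :
  summable (fun i => Cmod (f i)) -> summable (fun j => Cmod (g j)) ->
  has_sum f s -> has_sum g t -> has_sum (fun x => f (fst x) * g (snd x)) (s * t).
Proof.
intros Sf Sg Hf Hg.
destruct (summable_has_sum (fun x : I * J => f (fst x) * g (snd x))) as [S HS].
{ destruct (summable_prod _ _ Sf Sg) as [H [M HM]]. split; [intros; apply Cmod_ge_0|].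
  exists M. intros L HL. eapply Rle_trans; [|apply (HM L HL)].
  apply rsum_le. intros i. rewrite Cmod_mult. lra. }
replace (s * t) with S; [exact HS|].
(* The sum over I * J exists by absolute convergence, and only its value is in question. It is
   computed along rectangles A * B, which the product filter [G] makes arbitrarily large in both
   directions. *)
pose (G := fun P : list I * list J -> Prop => exists A0 B0, forall A B, NoDup A -> NoDup B ->
  incl A0 A -> incl B0 B -> P (A, B)).
assert (PG : ProperFilter G).
{ split.
  - intros P [A [B H]]. exists (nodup dec A, nodup dec B).
    apply H; try apply NoDup_nodup; intros x Hx; now apply nodup_In.
  - split.
    + exists nil, nil. trivial.
    + intros P Q [A [B H]] [A' [B' H']]. exists (A ++ A'), (B ++ B').
      intros L M N1 N2 I1 I2. apply incl_app_inv in I1. apply incl_app_inv in I2.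
      split; [apply H | apply H']; tauto.
    + intros P Q H [A [B K]]. exists A, B. auto. }
apply (clim_unique G (fun AB => lsum f (fst AB) * lsum g (snd AB))).
- intros eps He. destruct (HS eps He) as [L0 H].
  exists (map fst L0), (map snd L0). intros A B N1 N2 I1 I2. simpl.
  rewrite <- lsum_list_prod. apply H; [now apply NoDup_list_prod|].
  intros [x y] K. apply in_prod_iff.
  split; [apply I1, (in_map fst _ _ K) | apply I2, (in_map snd _ _ K)].
- apply clim_mult; [exact PG| |].
  + intros eps He. destruct (Hf eps He) as [A0 H]. exists A0, nil. intros; now apply H.
  + intros eps He. destruct (Hg eps He) as [B0 H]. exists nil, B0. intros; now apply H.
Qed.

(** Dominated convergence for series: outside one finite set the terms are small uniformly in n
    because of [g], and on that set the convergence is termwise. The error splits into three parts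
    of eps / 3; each of the two tails spends half of its share on comparing the full sum with a
    finite one. *)
Lemma tannery {I} (f : nat -> I -> C) (S : nat -> C) (f' : I -> C) (s : C) (g : I -> R) :
  summable g -> (forall n i, Cmod (f n i) <= g i)%R ->
  (forall n, has_sum (f n) (S n)) ->
  (forall i, clim eventually (fun n => f n i) (f' i)) -> has_sum f' s ->
  clim eventually S s.
Proof.
intros Sg Hfg HS Hlim Hs eps He.
assert (Hfg' : forall i, (Cmod (f' i) <= g i)%R).
{ intros i. apply (clim_le eventually (fun n => f n i)); [apply Hlim|].
  apply filter_forall. intros n. apply Hfg. }
destruct (summable_tail g Sg (eps / 6) ltac:(lra)) as [L0 [N0 H0]].
assert (K : forall F t, (forall i, (Cmod (F i) <= g i)%R) -> has_sum F t ->
  (Cmod (t - lsum F L0) <= eps / 3)%R).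
{ intros F t HF Ht. destruct (Ht (eps / 6)%R ltac:(lra)) as [L1 H1].
  set (L := nodup dec (L0 ++ L1)).
  assert (I0 : incl L0 L) by (intros x Hx; apply nodup_In, in_or_app; tauto).
  assert (I1 : incl L1 L) by (intros x Hx; apply nodup_In, in_or_app; tauto).
  assert (Q1 := lsum_tail F g L0 L (eps/6) HF N0 H0 (NoDup_nodup _ _) I0).
  assert (Q2 := H1 L (NoDup_nodup _ _) I1).
  assert (Q := Cmod_sub_triangle t (lsum F L) (lsum F L0)).
  rewrite (Cmod_sub_sym t (lsum F L)) in Q. lra. }
assert (E : clim eventually (fun n => lsum (f n) L0) (lsum f' L0)).
{ clear - Hlim. induction L0 as [|a L IH]; simpl.
  - apply clim_const. apply eventually_filter.
  - apply clim_plus; auto. apply eventually_filter. }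
generalize (E (eps / 3)%R ltac:(lra)). apply filter_imp. intros n Hn.
assert (K1 := K (f n) (S n) (Hfg n) (HS n)). assert (K2 := K f' s Hfg' Hs).
assert (Q1 := Cmod_sub_triangle (S n) (lsum (f n) L0) s).
assert (Q2 := Cmod_sub_triangle (lsum (f n) L0) (lsum f' L0) s).
rewrite (Cmod_sub_sym (lsum f' L0) s) in Q2. lra.
Qed.

(** * Infinite products *)

Lemma clim_filterlim (s : nat -> C) (l : C) :
  clim eventually s l <-> filterlim s eventually (locally l).
Proof.
split.
- intros H. apply filterlim_locally. intros eps.
  generalize (H eps (cond_pos eps)). apply filter_imp. intros n Hn.
  now apply C_NormedModule_mixin_compat1.
(* The uniform structure on C is that of a product, with squares as balls; sqrt 2 compares a square
   with a disc. *)
- intros H eps He. assert (Hs : (0 < sqrt 2)%R) by (apply sqrt_lt_R0; lra).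
  assert (He' : (0 < eps / sqrt 2)%R) by now apply Rdiv_lt_0_compat.
  generalize (proj1 (filterlim_locally s l) H (mkposreal _ He')). apply filter_imp.
  intros n Hn. apply C_NormedModule_mixin_compat2 in Hn. simpl in Hn.
  replace (sqrt 2 * (eps / sqrt 2))%R with eps in Hn by (field; lra). exact Hn.
Qed.

Lemma inf_prod_eq (f : nat -> C) (l : C) : clim eventually (partial_prod f) l -> inf_prod f = l.
Proof.
intros H. apply (clim_unique eventually (partial_prod f)); [|exact H].
apply clim_filterlim. unfold inf_prod. apply epsilon_spec. exists l. now apply clim_filterlim.
Qed.

Lemma clim_subseq (s : nat -> C) (g : nat -> nat) (l : C) :
  (forall m, eventually (fun n => (m <= g n)%nat)) ->
  clim eventually s l -> clim eventually (fun n => s (g n)) l.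
Proof.
intros Hg H eps He. destruct (H eps He) as [N HN].
generalize (Hg N). apply filter_imp. auto.
Qed.

Lemma clim_bounded (s : nat -> C) (l : C) :
  clim eventually s l -> exists M, (0 < M)%R /\ forall n, (Cmod (s n) <= M)%R.
Proof.
intros H. destruct (H 1%R ltac:(lra)) as [N HN].
assert (B : exists M, forall n, (n < N)%nat -> (Cmod (s n) <= M)%R).
{ clear HN. induction N as [|N [M IH]]; [exists 0%R; intros; lia|].
  exists (Rmax M (Cmod (s N))). intros n Hn.
  destruct (Nat.eq_dec n N) as [->|E]; [apply Rmax_r|].
  eapply Rle_trans; [apply IH; lia | apply Rmax_l]. }
destruct B as [M HM]. assert (P := Cmod_ge_0 l).
exists (Rmax M (Cmod l + 1)). split; [eapply Rlt_le_trans; [|apply Rmax_r]; lra|].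
intros n. destruct (Nat.lt_ge_cases n N) as [E|E].
- eapply Rle_trans; [now apply HM | apply Rmax_l].
- eapply Rle_trans; [|apply Rmax_r]. assert (Q := HN n E). assert (Q' := Cmod_sub_ge (s n) l). lra.
Qed.

Lemma partial_prod_ext (f g : nat -> C) n : (forall k, f k = g k) -> partial_prod f n = partial_prod g n.
Proof. intros H; induction n; simpl; [|rewrite IHn, H]; reflexivity. Qed.

Lemma partial_prod_mult (f g : nat -> C) n :
  partial_prod (fun k => f k * g k) n = partial_prod f n * partial_prod g n.
Proof. induction n; simpl; [|rewrite IHn]; ring. Qed.

Lemma partial_prod_nz (f : nat -> C) n : (forall k, f k <> 0) -> partial_prod f n <> 0.
Proof. intros H; induction n; simpl; [apply C1_nz | now apply Cmult_neq_0]. Qed.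

(** * q-Pochhammer symbols: convergence and non-vanishing *)

Definition qfactor (x p : C) (k : nat) : C := 1 - x * p ^ k.
Definition qpoch_n (x p : C) (n : nat) : C := partial_prod (qfactor x p) n.
Definition qpoch (x p : C) : C := inf_prod (qfactor x p).

Section Poch.
Variables x p : C.
Hypothesis Hp : (Cmod p < 1)%R.

Let r := Cmod p.
(** The sum of |x| r^k over k < n in closed form. Upper bound, Cauchy estimate and lower bound for
    [qpoch_n] are all expressed through it. *)
Let geo (n : nat) : R := (Cmod x * ((1 - r ^ n) / (1 - r)))%R.

Lemma geometric_bound_S n : geo (S n) = (geo n + Cmod x * r ^ n)%R.
Proof. unfold geo; simpl; field. unfold r; lra. Qed.

Lemma geometric_bound_le n : (geo n <= Cmod x / (1 - r))%R.
Proof.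
unfold geo. assert (Hr := Cmod_ge_0 p). fold r in Hr, Hp. assert (Hx := Cmod_ge_0 x).
replace (Cmod x / (1 - r))%R with (Cmod x * (1 / (1 - r)))%R by (field; lra).
apply Rmult_le_compat_l; [exact Hx|]. apply Rmult_le_compat_r.
- left. apply Rinv_0_lt_compat. lra.
- assert (K := pow_le r n Hr). lra.
Qed.

Lemma qpoch_n_bound n : (Cmod (qpoch_n x p n) <= exp (Cmod x / (1 - r)))%R.
Proof.
apply Rle_trans with (exp (geo n)).
- induction n.
  + unfold qpoch_n; simpl. rewrite Cmod_1. unfold geo. simpl.
    replace (Cmod x * ((1 - 1) / (1 - r)))%R with 0%R by (unfold Rdiv; ring). rewrite exp_0. lra.
  + unfold qpoch_n in *; simpl. rewrite Cmod_mult, geometric_bound_S, exp_plus.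
    apply Rmult_le_compat; try apply Cmod_ge_0; [exact IHn|].
    unfold qfactor. eapply Rle_trans; [apply Cmod_triangle|].
    rewrite Cmod_opp, Cmod_1, Cmod_mult, Cmod_pow. apply exp_ineq1_le.
- destruct (geometric_bound_le n) as [H| ->]; [left; now apply exp_increasing | lra].
Qed.

Lemma mul_pow_small (c : R) : (0 < c)%R -> exists N, forall n, (N <= n)%nat -> (Cmod x * r ^ n < c)%R.
Proof.
intros Hc. assert (Hr := Cmod_ge_0 p). fold r in Hr. assert (Hx := Cmod_ge_0 x).
destruct (pow_lt_1_zero r ltac:(rewrite Rabs_pos_eq; auto) (c / (Cmod x + 1))) as [N HN].
{ apply Rdiv_lt_0_compat; lra. }
exists N. intros n Hn. assert (K := HN n Hn).
rewrite Rabs_pos_eq in K by now apply pow_le.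
apply Rlt_div_r in K; [|lra]. assert (K' := pow_le r n Hr). nra.
Qed.

(** An increment of the partial products is a product bounded by [B] times one term of the geometric
    series, so the Cauchy property is inherited from [geo]. *)
Lemma qpoch_ex_lim : exists l, clim eventually (qpoch_n x p) l.
Proof.
assert (Hr := Cmod_ge_0 p). fold r in Hr. fold r in Hp.
set (B := exp (Cmod x / (1 - r))). assert (HB : (0 < B)%R) by apply exp_pos.
assert (K : forall n m, (Cmod (qpoch_n x p (n + m) - qpoch_n x p n) <= B * (geo (n + m) - geo n))%R).
{ intros n m. induction m.
  - rewrite Nat.add_0_r. replace (_ - _) with (RtoC 0) by ring. rewrite Cmod_0. lra.
  - rewrite Nat.add_succ_r, geometric_bound_S. eapply Rle_trans; [apply (Cmod_sub_triangle _ (qpoch_n x p (n + m)))|].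
    assert (E : (Cmod (qpoch_n x p (S (n + m)) - qpoch_n x p (n + m)) <= B * (Cmod x * r ^ (n + m)))%R).
    { replace (_ - _) with (qpoch_n x p (n + m) * (- (x * p ^ (n + m)))) by
        (unfold qpoch_n; simpl; unfold qfactor; ring).
      rewrite Cmod_mult, Cmod_opp, Cmod_mult, Cmod_pow.
      apply Rmult_le_compat_r; [apply Rmult_le_pos; [apply Cmod_ge_0 | now apply pow_le]|].
      apply qpoch_n_bound. }
    lra. }
apply clim_cauchy; [apply eventually_filter|]. intros eps He.
destruct (mul_pow_small (eps * (1 - r) / (2 * B))) as [N HN].
{ apply Rdiv_lt_0_compat; [|lra]. apply Rmult_lt_0_compat; lra. }
exists (fun n => (N <= n)%nat). split; [now exists N|].
assert (K' : forall n, (N <= n)%nat -> (Cmod (qpoch_n x p n - qpoch_n x p N) < eps / 2)%R).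
{ intros n Hn. replace n with (N + (n - N))%nat by lia.
  eapply Rle_lt_trans; [apply K|].
  assert (G : (geo (N + (n - N)) - geo N <= Cmod x * r ^ N / (1 - r))%R).
  { assert (Q := geometric_bound_le (N + (n - N))). unfold geo at 2.
    replace (Cmod x * ((1 - r ^ N) / (1 - r)))%R with (Cmod x / (1 - r) - Cmod x * r ^ N / (1 - r))%R
      by (field; lra). lra. }
  assert (Q := HN N (Nat.le_refl N)).
  apply Rlt_div_r in Q; [|lra].
  apply Rle_lt_trans with (B * (Cmod x * r ^ N / (1 - r)))%R; [now apply Rmult_le_compat_l; [lra|]|].
  replace (B * (Cmod x * r ^ N / (1 - r)))%R with (Cmod x * r ^ N * (2 * B) / (2 * (1 - r)))%R by (field; lra).
  apply Rlt_div_l; [lra|]. lra. }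
intros m n Hm Hn. assert (Q := Cmod_sub_triangle (qpoch_n x p m) (qpoch_n x p N) (qpoch_n x p n)).
rewrite (Cmod_sub_sym (qpoch_n x p N)) in Q.
assert (Q1 := K' m Hm). assert (Q2 := K' n Hn). lra.
Qed.

Lemma qpoch_lim : clim eventually (qpoch_n x p) (qpoch x p).
Proof.
destruct qpoch_ex_lim as [l Hl]. unfold qpoch. now rewrite (inf_prod_eq _ l Hl).
Qed.

(** Choose N so that the tail of the geometric series from N on is at most 1/2. By (1 - g)(1 - t) >=
    1 - g - t, the factors after N reduce the modulus at most by half, so the limit keeps at least
    half of the nonzero value reached at N. *)
Lemma qpoch_nz : (forall k, 1 - x * p ^ k <> 0) -> qpoch x p <> 0.
Proof.
intros Hf. assert (Hr := Cmod_ge_0 p). fold r in Hr. fold r in Hp.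
destruct (mul_pow_small ((1 - r) / 2)) as [N HN]; [lra|].
set (d := Cmod (qpoch_n x p N)).
assert (Hd : (0 < d)%R) by now apply Cmod_gt_0, partial_prod_nz.
assert (HG : forall n, (N <= n)%nat -> (geo n - geo N <= 1 / 2)%R).
{ intros n Hn. assert (Q := geometric_bound_le n). unfold geo at 2.
  replace (Cmod x * ((1 - r ^ N) / (1 - r)))%R with (Cmod x / (1 - r) - Cmod x * r ^ N / (1 - r))%R
      by (field; lra).
  assert (Cmod x * r ^ N / (1 - r) <= 1 / 2)%R; [|lra].
  apply Rle_div_l; [lra|]. assert (K := HN N (Nat.le_refl N)). lra. }
assert (K : forall m, (d * (1 - (geo (N + m) - geo N)) <= Cmod (qpoch_n x p (N + m)))%R).
{ induction m.
  - rewrite Nat.add_0_r. unfold d. lra.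
  - rewrite Nat.add_succ_r. unfold qpoch_n in *; simpl. rewrite Cmod_mult, geometric_bound_S.
    assert (Q := HG (N + m)%nat ltac:(lia)).
    assert (P0 : (0 <= Cmod x * r ^ (N + m))%R) by (apply Rmult_le_pos; [apply Cmod_ge_0 | now apply pow_le]).
    assert (P1 : (geo N <= geo (N + m))%R).
    { clear - Hp. assert (Hr : (0 <= r)%R) by apply Cmod_ge_0.
      induction m; [rewrite Nat.add_0_r; lra|]. rewrite Nat.add_succ_r, geometric_bound_S.
      assert (0 <= Cmod x * r ^ (N + m))%R by (apply Rmult_le_pos; [apply Cmod_ge_0 | now apply pow_le]).
      lra. }
    assert (Q' := HN (N + m)%nat ltac:(lia)).
    assert (F : (1 - Cmod x * r ^ (N + m) <= Cmod (qfactor x p (N + m)))%R).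
    { unfold qfactor. eapply Rle_trans; [|apply Cmod_sub_ge]. rewrite Cmod_1, Cmod_mult, Cmod_pow. unfold r; lra. }
    set (g := (geo (N + m) - geo N)%R) in *. set (t := (Cmod x * r ^ (N + m))%R) in *.
    apply Rle_trans with (d * (1 - g) * (1 - t))%R.
    + replace (d * (1 - (geo (N + m) + t - geo N)))%R with (d * (1 - g - t))%R by (unfold g; ring).
      rewrite Rmult_assoc. apply Rmult_le_compat_l; [lra|].
      assert (0 <= g * t)%R by (apply Rmult_le_pos; unfold g; lra). lra.
    + apply Rmult_le_compat; [apply Rmult_le_pos; lra | lra | exact IHm | exact F]. }
intros Z. destruct (qpoch_lim (d / 2)%R ltac:(lra)) as [M HM].
specialize (HM (N + M)%nat ltac:(lia)). rewrite Z in HM.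
replace (qpoch_n x p (N + M) - 0) with (qpoch_n x p (N + M)) in HM by ring.
assert (Q := K M). assert (Q' := HG (N + M)%nat ltac:(lia)).
assert (d * (1 / 2) <= d * (1 - (geo (N + M) - geo N)))%R by (apply Rmult_le_compat_l; lra). lra.
Qed.

End Poch.

Lemma qpoch_step (x p : C) : (Cmod p < 1)%R -> qpoch x p = (1 - x) * qpoch (x * p) p.
Proof.
intros Hp.
assert (E : forall n, qpoch_n x p (S n) = (1 - x) * qpoch_n (x * p) p n).
{ induction n.
  - unfold qpoch_n; simpl. unfold qfactor; simpl. ring.
  - change (qpoch_n x p (S (S n))) with (qpoch_n x p (S n) * qfactor x p (S n)).
    change (qpoch_n (x * p) p (S n)) with (qpoch_n (x * p) p n * qfactor (x * p) p n).
    rewrite IHn. unfold qfactor. simpl. ring. }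
apply (clim_unique eventually (fun n => qpoch_n x p (S n))).
- apply (clim_subseq _ S); [|now apply qpoch_lim]. intros m. exists m. intros; lia.
- apply (clim_ext _ (fun n => (1 - x) * qpoch_n (x * p) p n)).
  + apply filter_forall. intros n. now rewrite E.
  + apply clim_mult; [apply eventually_filter | apply clim_const, eventually_filter | now apply qpoch_lim].
Qed.

Lemma one_minus_nz (z : C) : (Cmod z < 1)%R -> 1 - z <> 0.
Proof.
intros H E. assert (K := Cmod_sub_ge 1 z). rewrite E, Cmod_0, Cmod_1 in K. lra.
Qed.

Lemma Cmod_mul_pow_lt1 (x p : C) k : (Cmod x < 1)%R -> (Cmod p < 1)%R -> (Cmod (x * p ^ k) < 1)%R.
Proof.
intros Hx Hp. rewrite Cmod_mult, Cmod_pow.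
assert (H : (Cmod p ^ k <= 1)%R).
{ rewrite <- (pow1 k). apply pow_incr. split; [apply Cmod_ge_0 | lra]. }
assert (H' : (0 <= Cmod p ^ k)%R) by apply pow_le, Cmod_ge_0.
assert (Q := Cmod_ge_0 x). nra.
Qed.

Lemma qpoch_nz_small (x p : C) : (Cmod x < 1)%R -> (Cmod p < 1)%R -> qpoch x p <> 0.
Proof.
intros Hx Hp. apply qpoch_nz; auto. intros k. now apply one_minus_nz, Cmod_mul_pow_lt1.
Qed.

(** * Integer powers *)

Definition zpow (x : C) (n : Z) : C :=
  match n with
  | Z0 => 1
  | Zpos k => x ^ Pos.to_nat k
  | Zneg k => / (x ^ Pos.to_nat k)
  end.

Lemma zpow_nat (x : C) (n : nat) : zpow x (Z.of_nat n) = x ^ n.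
Proof. destruct n; [reflexivity|]. simpl Z.of_nat. unfold zpow. now rewrite SuccNat2Pos.id_succ. Qed.

Lemma zpow_neg_nat (x : C) (n : nat) : zpow x (- Z.of_nat n) = / (x ^ n).
Proof.
destruct n; [simpl; field; apply C1_nz|].
simpl Z.of_nat. simpl Z.opp. unfold zpow. now rewrite SuccNat2Pos.id_succ.
Qed.

Lemma Z_nat_cases (n : Z) : (exists k, n = Z.of_nat k) \/ (exists k, n = (- Z.of_nat (S k))%Z).
Proof.
destruct (Z_le_gt_dec 0 n); [left; exists (Z.to_nat n) | right; exists (Z.to_nat (- n - 1))]; lia.
Qed.

Lemma zpow_nz (x : C) n : x <> 0 -> zpow x n <> 0.
Proof. intros H. destruct n; simpl; nz. apply C1_nz. Qed.

Lemma zpow_succ (x : C) n : x <> 0 -> zpow x (n + 1) = zpow x n * x.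
Proof.
intros Hx. destruct (Z_nat_cases n) as [[k ->]|[k ->]].
- replace (Z.of_nat k + 1)%Z with (Z.of_nat (S k)) by lia. rewrite !zpow_nat. simpl. ring.
- replace (- Z.of_nat (S k) + 1)%Z with (- Z.of_nat k)%Z by lia. rewrite !zpow_neg_nat. simpl.
  field. split; nz.
Qed.

Lemma zpow_add (x : C) m n : x <> 0 -> zpow x (m + n) = zpow x m * zpow x n.
Proof.
intros Hx. revert n. apply Z.bi_induction.
- intros a b ->. tauto.
- rewrite Z.add_0_r. simpl. ring.
- intros n. replace (m + Z.succ n)%Z with (m + n + 1)%Z by lia.
  replace (Z.succ n) with (n + 1)%Z by lia. rewrite !zpow_succ by auto. split.
  + intros ->. ring.
  + intros H. replace (zpow x (m + n)) with (zpow x (m + n) * x / x) by (field; auto).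
    rewrite H. field; auto.
Qed.

Lemma zpow_opp (x : C) n : x <> 0 -> zpow x (- n) = / zpow x n.
Proof.
intros Hx. assert (H := zpow_nz x n Hx).
replace (zpow x (- n)) with (zpow x n * zpow x (- n) / zpow x n) by (field; auto).
rewrite <- zpow_add, Z.add_opp_diag_r by auto. simpl. field; auto.
Qed.

Lemma zpow_mult_l (x y : C) n : x <> 0 -> y <> 0 -> zpow (x * y) n = zpow x n * zpow y n.
Proof.
intros Hx Hy. destruct n; simpl; [ring | apply Cpow_mult_l |].
rewrite Cpow_mult_l. field; split; nz.
Qed.

Lemma zpow_sq (x : C) n : x <> 0 -> zpow (x * x) n = zpow x (2 * n).
Proof. intros Hx. rewrite zpow_mult_l, <- zpow_add by auto. f_equal. lia. Qed.

Lemma zpow_inv (x : C) n : x <> 0 -> zpow (/ x) n = zpow x (- n).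
Proof.
intros Hx. rewrite zpow_opp by auto. assert (Q := zpow_nz x n Hx).
replace (zpow (/ x) n) with (zpow x n * zpow (/ x) n / zpow x n) by (field; auto).
rewrite <- zpow_mult_l, Cinv_r by nz.
replace (zpow 1 n) with (RtoC 1); [field; auto|].
destruct n; simpl; rewrite ?Cpow_1_l; try reflexivity. field.
Qed.

(** * The Jacobi triple product *)

(** The classical term y^j p^(j (j - 1) / 2) with p = s^2. Working with a square root [s] of the
    nome avoids halving exponents, and s and -s are also two of the half-periods needed later. *)
Definition theta_term (s y : C) (j : Z) : C := zpow y j * zpow s (j * j - j).

Lemma theta_term_succ (s y : C) j : s <> 0 -> y <> 0 ->
  theta_term s y (j + 1) = theta_term s y j * (y * zpow (s * s) j).
Proof.
intros Hs Hy. unfold theta_term. rewrite zpow_succ, zpow_sq by auto.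
replace ((j + 1) * (j + 1) - (j + 1))%Z with ((j * j - j) + 2 * j)%Z by ring.
rewrite zpow_add by auto. ring.
Qed.

(** From n0 on, the partial sum up to n plus 2 [a n] does not increase. *)
Lemma rsum_halving_bounded (a : nat -> R) (n0 : nat) : (forall n, 0 <= a n)%R ->
  (forall n, (n0 <= n)%nat -> (a (S n) <= a n / 2)%R) ->
  exists M, forall n, (rsum a (seq 0 n) <= M)%R.
Proof.
intros Ha H.
assert (E : forall n, rsum a (seq 0 (S n)) = (rsum a (seq 0 n) + a n)%R).
{ intros n. rewrite seq_S, rsum_app. simpl. ring. }
exists (rsum a (seq 0 n0) + 2 * a n0)%R.
assert (K : forall k, (rsum a (seq 0 (n0 + k)) + 2 * a (n0 + k)%nat <= rsum a (seq 0 n0) + 2 * a n0)%R).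
{ induction k; [rewrite Nat.add_0_r; lra|]. rewrite Nat.add_succ_r, E.
  assert (Q := H (n0 + k)%nat ltac:(lia)). lra. }
intros n. destruct (Nat.le_gt_cases n0 n) as [L|L].
- assert (Q := K (n - n0)%nat). replace (n0 + (n - n0))%nat with n in Q by lia.
  assert (Q' := Ha n). lra.
- apply Rle_trans with (rsum a (seq 0 n0)); [|assert (Q := Ha n0); lra].
  apply rsum_incl; auto; [apply seq_NoDup|].
  intros x Hx. apply in_seq in Hx. apply in_seq. lia.
Qed.

Lemma summable_Z (g : Z -> R) (M1 M2 : R) : (forall j, 0 <= g j)%R ->
  (forall n, (rsum (fun k => g (Z.of_nat k)) (seq 0 n) <= M1)%R) ->
  (forall n, (rsum (fun k => g (- Z.of_nat k)%Z) (seq 0 n) <= M2)%R) -> summable g.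
Proof.
intros Hg H1 H2. split; [exact Hg|]. exists (M1 + M2)%R. intros L HL.
assert (B : exists N, forall z, In z L -> (Z.abs z < Z.of_nat N)%Z).
{ clear. induction L as [|a L [N IH]]; [exists O; simpl; tauto|].
  exists (N + S (Z.to_nat (Z.abs a)))%nat. intros z [->|Hz]; [lia|]. specialize (IH z Hz). lia. }
destruct B as [N HN].
(* The index 0 lies in both halves of the larger list; [rsum_incl] demands distinct entries only of
   the smaller one. *)
eapply Rle_trans; [apply (rsum_incl _ L
  (map (fun k => Z.of_nat k) (seq 0 N) ++ map (fun k => (- Z.of_nat k)%Z) (seq 0 N))); auto|].
- intros z Hz. specialize (HN z Hz). apply in_or_app.
  destruct (Z_le_gt_dec 0 z); [left | right]; apply in_map_iff.
  + exists (Z.to_nat z). rewrite in_seq. lia.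
  + exists (Z.to_nat (- z)). rewrite in_seq. lia.
- rewrite rsum_app, !rsum_map. apply Rplus_le_compat; auto.
Qed.

Lemma summable_theta_term (s y : C) : s <> 0 -> y <> 0 -> (Cmod s < 1)%R ->
  summable (fun j => Cmod (theta_term s y j)).
Proof.
intros Hs Hy Hs1.
set (p := s * s).
assert (Hp0 : p <> 0) by (unfold p; nz).
assert (Hp : (Cmod p < 1)%R).
{ unfold p. rewrite Cmod_mult. assert (Q := Cmod_ge_0 s). nra. }
assert (Py := proj1 (Cmod_gt_0 y) Hy).
destruct (mul_pow_small y p Hp (1/2) ltac:(lra)) as [N1 HN1].
destruct (mul_pow_small (/ y) p Hp (1/2) ltac:(lra)) as [N2 HN2].
destruct (rsum_halving_bounded (fun k => Cmod (theta_term s y (Z.of_nat k))) N1) as [M1 HM1].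
{ intros; apply Cmod_ge_0. }
{ intros n Hn. replace (Z.of_nat (S n)) with (Z.of_nat n + 1)%Z by lia.
  rewrite theta_term_succ, Cmod_mult by auto. fold p. rewrite Cmod_mult, zpow_nat, Cmod_pow.
  specialize (HN1 n Hn). assert (Q := Cmod_ge_0 (theta_term s y (Z.of_nat n))). nra. }
destruct (rsum_halving_bounded (fun k => Cmod (theta_term s y (- Z.of_nat k))) N2) as [M2 HM2].
{ intros; apply Cmod_ge_0. }
{ intros n Hn.
  assert (E : theta_term s y (- Z.of_nat (S n)) = theta_term s y (- Z.of_nat n) * (/ y * p ^ n * p)).
  { replace (- Z.of_nat n)%Z with (- Z.of_nat (S n) + 1)%Z by lia.
    rewrite theta_term_succ by auto. fold p. rewrite zpow_neg_nat. simpl. field. repeat split; nz. }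
  rewrite E, !Cmod_mult, Cmod_pow.
  specialize (HN2 n Hn). assert (Q := Cmod_ge_0 (theta_term s y (- Z.of_nat n))).
  assert (Q' := Cmod_ge_0 p). assert (Q2 := Cmod_ge_0 (/ y)).
  assert (Q3 := pow_le _ n Q').
  assert (Cmod (/ y) * Cmod p ^ n * Cmod p <= 1 / 2)%R by nra. nra. }
apply (summable_Z _ M1 M2); auto. intros; apply Cmod_ge_0.
Qed.

Definition theta_sum (s y : C) : C := epsilon (inhabits (RtoC 0)) (has_sum (theta_term s y)).

Lemma has_sum_theta (s y : C) : s <> 0 -> y <> 0 -> (Cmod s < 1)%R ->
  has_sum (theta_term s y) (theta_sum s y).
Proof.
intros. unfold theta_sum. apply epsilon_spec. apply summable_has_sum. now apply summable_theta_term.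
Qed.

Definition inv_poch (p : C) (n : Z) : C := if Z_lt_dec n 0 then 0 else / qpoch_n p p (Z.to_nat n).

Lemma qpoch_n_diag_nz (p : C) n : (Cmod p < 1)%R -> qpoch_n p p n <> 0.
Proof.
intros Hp. apply partial_prod_nz. intros k. unfold qfactor.
now apply one_minus_nz, Cmod_mul_pow_lt1.
Qed.

(* For n = -1 both sides vanish, which is what makes the recursion hold on all of Z. *)
Lemma inv_poch_rec (p : C) n : p <> 0 -> (Cmod p < 1)%R ->
  inv_poch p n = (1 - p * zpow p n) * inv_poch p (n + 1).
Proof.
intros Hp0 Hp. unfold inv_poch.
destruct (Z_nat_cases n) as [[k ->]|[k ->]].
- destruct (Z_lt_dec _ 0); [lia|]. destruct (Z_lt_dec _ 0); [lia|].
  rewrite zpow_nat. replace (Z.to_nat (Z.of_nat k + 1)) with (S k) by lia. rewrite Nat2Z.id.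
  change (qpoch_n p p (S k)) with (qpoch_n p p k * (1 - p * p ^ k)).
  assert (H := qpoch_n_diag_nz p k Hp). assert (H' := one_minus_nz _ (Cmod_mul_pow_lt1 p p k Hp Hp)).
  field. auto.
- destruct (Z_lt_dec _ 0); [|lia]. destruct (Z_lt_dec _ 0); [ring|].
  assert (k = O) by lia. subst. simpl.
  replace (1 - p * / (p * 1)) with (RtoC 0) by (field; auto). ring.
Qed.

(** The Gaussian binomial coefficient of 2n over n + j in base p. It is 0 for |j| > n through the
    convention in [inv_poch], so finite expansions can be written as sums over Z. *)
Definition jtp_coef (p : C) (n : nat) (j : Z) : C :=
  qpoch_n p p (2 * n) * inv_poch p (Z.of_nat n + j) * inv_poch p (Z.of_nat n - j).

(** Passing from n to n + 1 multiplies the product by (1 - x p^n)(1 - p^(n+1) / x), whose terms in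
    1, x and 1/x account for the three summands. *)
Lemma jtp_coef_rec (p : C) n j : p <> 0 -> (Cmod p < 1)%R ->
  jtp_coef p (S n) j = (1 + p * p ^ n * p ^ n) * jtp_coef p n j
    + p * zpow p (Z.of_nat n - j) * jtp_coef p n (j - 1)
    + p * zpow p (Z.of_nat n + j) * jtp_coef p n (j + 1).
Proof.
intros Hp0 Hp. unfold jtp_coef.
set (N := Z.of_nat n).
replace (Z.of_nat (S n)) with (N + 1)%Z by lia.
replace (N + 1 + j)%Z with (N + j + 1)%Z by ring.
replace (N + 1 - j)%Z with (N - j + 1)%Z by ring.
replace (N + (j - 1))%Z with (N + j - 1)%Z by ring.
replace (N - (j - 1))%Z with (N - j + 1)%Z by ring.
replace (N + (j + 1))%Z with (N + j + 1)%Z by ring.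
replace (N - (j + 1))%Z with (N - j - 1)%Z by ring.
rewrite (inv_poch_rec p (N + j - 1)), (inv_poch_rec p (N - j - 1)) by auto.
replace (N + j - 1 + 1)%Z with (N + j)%Z by ring.
replace (N - j - 1 + 1)%Z with (N - j)%Z by ring.
rewrite (inv_poch_rec p (N + j)), (inv_poch_rec p (N - j)) by auto.
(* All reciprocals are now multiples of [G] and [H], and p^(2n) is the product of p^(N+j) and
   p^(N-j); in these quantities the recursion is a polynomial identity. *)
set (G := inv_poch p (N + j + 1)). set (H := inv_poch p (N - j + 1)).
assert (Ea : p * zpow p (N + j - 1) = zpow p (N + j)).
{ replace (N + j)%Z with (N + j - 1 + 1)%Z at 2 by ring. rewrite zpow_succ by auto. ring. }
assert (Eb : p * zpow p (N - j - 1) = zpow p (N - j)).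
{ replace (N - j)%Z with (N - j - 1 + 1)%Z at 2 by ring. rewrite zpow_succ by auto. ring. }
rewrite Ea, Eb.
assert (Eab : p ^ n * p ^ n = zpow p (N + j) * zpow p (N - j)).
{ rewrite <- zpow_add by auto. replace (N + j + (N - j))%Z with (N + N)%Z by ring.
  rewrite zpow_add by auto. unfold N. now rewrite zpow_nat. }
replace (2 * S n)%nat with (S (S (2 * n))) by lia.
change (qpoch_n p p (S (S (2 * n)))) with
  (qpoch_n p p (2 * n) * (1 - p * p ^ (2 * n)) * (1 - p * (p * p ^ (2 * n)))).
replace (p ^ (2 * n)) with (p ^ n * p ^ n) by (rewrite <- Cpow_add_r; f_equal; lia).
replace (p * p ^ n * p ^ n) with (p * (p ^ n * p ^ n)) by ring.
rewrite Eab. ring.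
Qed.

Lemma finite_jtp (s x : C) n : s <> 0 -> x <> 0 -> (Cmod (s * s) < 1)%R ->
  has_sum (fun j => jtp_coef (s * s) n j * theta_term s (- x) j)
    (qpoch_n x (s * s) n * qpoch_n (s * s / x) (s * s) n).
Proof.
intros Hs Hx Hp. set (p := s * s) in *.
assert (Hp0 : p <> 0) by (unfold p; nz).
assert (Hx' : - x <> 0).
{ intros E. apply Hx. replace x with (- - x) by ring. rewrite E. ring. }
induction n.
- replace (qpoch_n x p 0 * qpoch_n (p / x) p 0) with
    (jtp_coef p 0 0 * theta_term s (- x) 0).
  + apply (has_sum_single (fun j => jtp_coef p 0 j * theta_term s (- x) j) 0%Z).
    intros j Hj. unfold jtp_coef, inv_poch.
    destruct (Z_lt_dec _ 0); [ring|]. destruct (Z_lt_dec _ 0); [ring | lia].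
  + unfold jtp_coef, inv_poch, qpoch_n, theta_term; simpl. field.
- change (qpoch_n x p (S n)) with (qpoch_n x p n * (1 - x * p ^ n)).
  change (qpoch_n (p / x) p (S n)) with (qpoch_n (p / x) p n * (1 - p / x * p ^ n)).
  set (P := qpoch_n x p n * qpoch_n (p / x) p n) in *.
  replace (qpoch_n x p n * (1 - x * p ^ n) * (qpoch_n (p / x) p n * (1 - p / x * p ^ n)))
    with ((1 + p * p ^ n * p ^ n) * P + ((- x * p ^ n) * P + (- (p / x) * p ^ n) * P))
    by (unfold P; field; auto).
  (* The contributions of x and 1/x are the same series with the index shifted by -1 and by 1. *)
  assert (Sh : forall k : Z, has_sum (fun j => jtp_coef p n (j + k) * theta_term s (- x) (j + k)) P).
  { intros k. apply (has_sum_reindex (fun j => j + k)%Z (fun j => j - k)%Z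
      (fun j => jtp_coef p n j * theta_term s (- x) j)); auto; intros; ring. }
  eapply has_sum_ext; [|apply has_sum_plus; [|apply has_sum_plus]; apply has_sum_scal;
    [apply IHn | apply (Sh (-1)%Z) | apply (Sh 1%Z)]].
  intros j. cbv beta. rewrite jtp_coef_rec by auto. fold (j - 1)%Z.
  assert (T1 : theta_term s (- x) j = theta_term s (- x) (j - 1) * (- x * zpow p (j - 1))).
  { replace j with (j - 1 + 1)%Z at 1 by ring. rewrite theta_term_succ by auto. reflexivity. }
  rewrite (theta_term_succ s (- x) j) by auto. fold p.
  assert (E1 : zpow p (Z.of_nat n + j) = p ^ n * zpow p j).
  { rewrite zpow_add, zpow_nat by auto. ring. }
  assert (E2 : p * zpow p (Z.of_nat n - j) * zpow p (j - 1) = p ^ n).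
  { replace (p * zpow p (Z.of_nat n - j)) with (zpow p (Z.of_nat n - j + 1))
      by (rewrite zpow_succ by auto; ring).
    rewrite <- zpow_add by auto. replace (Z.of_nat n - j + 1 + (j - 1))%Z with (Z.of_nat n) by ring.
    apply zpow_nat. }
  rewrite E1.
  replace (- x * p ^ n * (jtp_coef p n (j + -1) * theta_term s (- x) (j + -1))) with
    (p * zpow p (Z.of_nat n - j) * jtp_coef p n (j - 1) * theta_term s (- x) j).
  + field; auto.
  + rewrite T1, <- E2. change (j + -1)%Z with (j - 1)%Z. ring.
Qed.

Definition theta (x p : C) : C := qpoch x p * qpoch (p / x) p.

(** Let n tend to infinity in [finite_jtp]: each coefficient tends to phi / phi^2. Domination comes
    from the bound [B] on (p;p)_m and [B'] on its inverse, since a coefficient contains one of the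
    former and two of the latter. *)
Theorem jacobi_triple_product (s x : C) : s <> 0 -> x <> 0 -> (Cmod s < 1)%R ->
  theta_sum s (- x) = theta x (s * s) * qpoch (s * s) (s * s).
Proof.
intros Hs Hx Hs1. set (p := s * s).
assert (Hp0 : p <> 0) by (unfold p; nz).
assert (Hp : (Cmod p < 1)%R).
{ unfold p. rewrite Cmod_mult. assert (Q := Cmod_ge_0 s). nra. }
assert (Hx' : - x <> 0).
{ intros E. apply Hx. replace x with (- - x) by ring. rewrite E. ring. }
set (phi := qpoch p p). assert (Hphi : phi <> 0) by now apply qpoch_nz_small.
assert (Lphi := qpoch_lim p p Hp). fold phi in Lphi.
assert (Linv : clim eventually (fun n => / qpoch_n p p n) (/ phi)).
{ apply clim_inv; auto. apply eventually_filter. }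
assert (H : theta x p = / phi * theta_sum s (- x)).
{ apply (clim_unique eventually (fun n => qpoch_n x p n * qpoch_n (p / x) p n)).
  { apply clim_mult; [apply eventually_filter | now apply qpoch_lim | now apply qpoch_lim]. }
  destruct (clim_bounded _ _ Lphi) as [B [HB0 HB]].
  destruct (clim_bounded _ _ Linv) as [B' [HB0' HB']].
  apply (tannery (fun n j => jtp_coef p n j * theta_term s (- x) j) _
    (fun j => / phi * theta_term s (- x) j) _
    (fun j => (B * B' * B' * Cmod (theta_term s (- x) j))%R)).
  - destruct (summable_theta_term s (- x) Hs Hx' Hs1) as [_ [M HM]]. split.
    + intros i. apply Rmult_le_pos; [|apply Cmod_ge_0]. repeat apply Rmult_le_pos; lra.
    + exists (B * B' * B' * M)%R. intros L HL. rewrite rsum_scal. apply Rmult_le_compat_l; auto.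
      repeat apply Rmult_le_pos; lra.
  - intros n j. rewrite Cmod_mult. apply Rmult_le_compat_r; [apply Cmod_ge_0|].
    unfold jtp_coef. rewrite !Cmod_mult.
    assert (K : forall z, (Cmod (inv_poch p z) <= B')%R).
    { intros z. unfold inv_poch. destruct (Z_lt_dec z 0); [rewrite Cmod_0; lra | apply HB']. }
    apply Rmult_le_compat; try apply Cmod_ge_0; auto.
    + apply Rmult_le_pos; apply Cmod_ge_0.
    + apply Rmult_le_compat; try apply Cmod_ge_0; auto.
  - intros n. apply finite_jtp; auto.
  - intros j. apply (clim_mult eventually (fun n => jtp_coef p n j) (fun _ => theta_term s (- x) j)).
    2: { apply clim_const, eventually_filter. }
    replace (/ phi) with (phi * / phi * / phi) by (field; auto).
    assert (K : forall k : Z, clim eventually (fun n => inv_poch p (Z.of_nat n + k)) (/ phi)).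
    { intros k. apply (clim_ext _ (fun n => / qpoch_n p p (Z.to_nat (Z.of_nat n + k)))).
      - exists (Z.to_nat (Z.abs k)). intros n Hn. unfold inv_poch.
        destruct (Z_lt_dec _ 0); [lia | reflexivity].
      - apply (clim_subseq (fun n => / qpoch_n p p n)); auto.
        intros m. exists (m + Z.to_nat (Z.abs k))%nat. intros n Hn. lia. }
    apply clim_mult; [apply eventually_filter | apply clim_mult; [apply eventually_filter | | apply K] | apply K].
    apply (clim_subseq (qpoch_n p p)); auto. intros m. exists m. intros; lia.
  - apply has_sum_scal. apply has_sum_theta; auto. }
rewrite H. field. auto.
Qed.

Lemma zpow_m1_sq n : zpow (- (1)) n * zpow (- (1)) n = 1.
Proof.
assert (H : - (1) <> 0) by (intros E; apply C1_nz; replace (RtoC 1) with (- - (1)) by ring; rewrite E; ring).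
rewrite <- zpow_mult_l by auto. replace (- (1) * - (1)) with (RtoC 1) by ring.
destruct n; simpl; rewrite ?Cpow_1_l; try reflexivity. field.
Qed.

(** The product is a double series over (m, n). Setting m = k + l and n = k - l, or n = k - l + 1,
    according to the parity of m + n, turns the quadratic exponent into a sum of one in k and one in
    l, so each parity class factors. The odd class carries the sign -1 and the factor x / y. *)
Lemma theta_sum_addition (s x y : C) : s <> 0 -> x <> 0 -> y <> 0 -> (Cmod s < 1)%R ->
  let A z := theta_sum (s * s) (z * z) in
  let B z := theta_sum (s * s) (s * s * (z * z)) in
  theta_sum s (- (x * y)) * theta_sum s (- (x / y)) = A x * B y - x / y * (B x * A y).
Proof.
intros Hs Hx Hy Hs1 A B.
assert (Hs2 : (Cmod (s * s) < 1)%R).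
{ rewrite Cmod_mult. assert (Q := Cmod_ge_0 s). nra. }
assert (Hm : - (1) <> 0) by (intros E; apply C1_nz; replace (RtoC 1) with (- - (1)) by ring; rewrite E; ring).
assert (Exy : - (x * y) = - (1) * x * y) by ring.
assert (Exy' : - (x / y) = - (1) * x * / y) by (field; auto).
assert (N1 : - (1) * x * y <> 0) by nz.
assert (N2 : - (1) * x * / y <> 0) by nz.
rewrite Exy, Exy'.
pose (g := fun w : (Z * Z) + (Z * Z) => match w with
  | inl (k, l) => (k + l, k - l)%Z | inr (k, l) => (k + l, k - l + 1)%Z end).
pose (h := fun mn : Z * Z => let (m, n) := mn in
  if Z.even (m + n) then inl ((m + n) / 2, (m - n) / 2)%Z
  else inr ((m + n - 1) / 2, (m - n + 1) / 2)%Z : (Z * Z) + (Z * Z)).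
apply (has_sum_unique (fun w => theta_term s (- (1) * x * y) (fst (g w)) *
   theta_term s (- (1) * x * / y) (snd (g w)))).
- apply (has_sum_reindex g h (fun mn => theta_term s (- (1) * x * y) (fst mn) *
   theta_term s (- (1) * x * / y) (snd mn))).
  + intros [m n]. unfold h. destruct (Z.even (m + n)) eqn:E.
    * apply Z.even_spec in E. destruct E as [k E]. rewrite E.
      replace (m - n)%Z with (2 * (m - k))%Z by lia.
      rewrite !(Z.mul_comm 2), !Z.div_mul by lia. simpl. f_equal; lia.
    * assert (O : Z.odd (m + n) = true) by (rewrite <- Z.negb_even, E; reflexivity).
      apply Z.odd_spec in O. destruct O as [k O].
      replace (m + n - 1)%Z with (2 * k)%Z by lia.
      replace (m - n + 1)%Z with (2 * (m - k))%Z by lia.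
      rewrite !(Z.mul_comm 2), !Z.div_mul by lia. simpl. f_equal; lia.
  + intros [[k l]|[k l]]; unfold h, g.
    * replace (k + l + (k - l))%Z with (2 * k)%Z by ring.
      rewrite Z.even_mul. simpl Z.even. simpl orb. cbv iota.
      replace (k + l - (k - l))%Z with (2 * l)%Z by ring.
      now rewrite !(Z.mul_comm 2), !Z.div_mul by lia.
    * replace (k + l + (k - l + 1))%Z with (1 + 2 * k)%Z by ring.
      rewrite Z.even_add_mul_2. simpl Z.even. cbv iota.
      replace (1 + 2 * k - 1)%Z with (2 * k)%Z by ring.
      replace (k + l - (k - l + 1) + 1)%Z with (2 * l)%Z by ring.
      now rewrite !(Z.mul_comm 2), !Z.div_mul by lia.
  + apply (has_sum_prod (theta_term s (- (1) * x * y)) (theta_term s (- (1) * x * / y)));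
      try apply summable_theta_term; try apply has_sum_theta; auto.
- assert (Zx : x * x <> 0) by nz. assert (Zy : y * y <> 0) by nz.
  assert (Zs : s * s <> 0) by nz.
  assert (Zsx : s * s * (x * x) <> 0) by nz. assert (Zsy : s * s * (y * y) <> 0) by nz.
  replace (A x * B y - x / y * (B x * A y)) with (A x * B y + (- (x / y)) * (B x * A y)) by ring.
  apply has_sum_sum.
  + eapply has_sum_ext; [|apply (has_sum_prod (theta_term (s * s) (x * x)) (theta_term (s * s) (s * s * (y * y))));
      try apply summable_theta_term; try apply has_sum_theta; auto].
    intros [k l]. simpl. unfold theta_term.
    rewrite !zpow_mult_l, zpow_inv by nz.
    assert (Es : zpow s ((k + l) * (k + l) - (k + l)) * zpow s ((k - l) * (k - l) - (k - l)) =
      zpow s (k * k - k) * zpow s (k * k - k) * (zpow s l * zpow s l) * (zpow s (l * l - l) * zpow s (l * l - l))).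
    { rewrite <- !zpow_add by auto. f_equal. ring. }
    assert (Ex : zpow x (k + l) * zpow x (k - l) = zpow x k * zpow x k).
    { rewrite <- !zpow_add by auto. f_equal. ring. }
    assert (Ey : zpow y (k + l) * zpow y (- (k - l)) = zpow y l * zpow y l).
    { rewrite <- !zpow_add by auto. f_equal. ring. }
    assert (Em : zpow (- (1)) (k + l) * zpow (- (1)) (k - l) = 1).
    { rewrite <- zpow_add by auto. replace (k + l + (k - l))%Z with (k + k)%Z by ring.
      rewrite zpow_add by auto. apply zpow_m1_sq. }
    transitivity (zpow (- (1)) (k + l) * zpow (- (1)) (k - l) * (zpow x (k + l) * zpow x (k - l)) *
      (zpow y (k + l) * zpow y (- (k - l))) *
      (zpow s ((k + l) * (k + l) - (k + l)) * zpow s ((k - l) * (k - l) - (k - l)))); [|ring].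
    rewrite Em, Ex, Ey, Es. ring.
  + eapply has_sum_ext; [|apply has_sum_scal, (has_sum_prod (theta_term (s * s) (s * s * (x * x))) (theta_term (s * s) (y * y)));
      try apply summable_theta_term; try apply has_sum_theta; auto].
    intros [k l]. simpl. unfold theta_term.
    rewrite !zpow_mult_l, zpow_inv by nz.
    assert (Es : zpow s ((k + l) * (k + l) - (k + l)) * zpow s ((k - l + 1) * (k - l + 1) - (k - l + 1)) =
      zpow s (k * k - k) * zpow s (k * k - k) * (zpow s k * zpow s k) * (zpow s (l * l - l) * zpow s (l * l - l))).
    { rewrite <- !zpow_add by auto. f_equal. ring. }
    assert (Ex : zpow x (k + l) * zpow x (k - l + 1) = zpow x k * zpow x k * x).
    { rewrite <- !zpow_add, <- zpow_succ by auto. f_equal. ring. }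
    assert (Ey : zpow y (k + l) * zpow y (- (k - l + 1)) * y = zpow y l * zpow y l).
    { rewrite <- !zpow_add, <- zpow_succ by auto. f_equal. ring. }
    assert (Em : zpow (- (1)) (k + l) * zpow (- (1)) (k - l + 1) = - (1)).
    { rewrite <- zpow_add by auto. replace (k + l + (k - l + 1))%Z with (k + k + 1)%Z by ring.
      rewrite zpow_succ, zpow_add, zpow_m1_sq by auto. ring. }
    transitivity (zpow (- (1)) (k + l) * zpow (- (1)) (k - l + 1) * (zpow x (k + l) * zpow x (k - l + 1)) *
      (zpow y (k + l) * zpow y (- (k - l + 1)) * y / y) *
      (zpow s ((k + l) * (k + l) - (k + l)) * zpow s ((k - l + 1) * (k - l + 1) - (k - l + 1)))); [|field; auto].
    rewrite Em, Ex, Ey, Es. field; auto.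
Qed.


(** * Theta functions *)

Lemma theta_inv (x p : C) : x <> 0 -> p <> 0 -> theta (p / x) p = theta x p.
Proof.
intros Hx Hp. unfold theta. replace (p / (p / x)) with x by (field; auto). ring.
Qed.

Lemma theta_shift (x p : C) : x <> 0 -> p <> 0 -> (Cmod p < 1)%R -> theta (p * x) p = - (theta x p / x).
Proof.
intros Hx Hp Hp1. unfold theta. replace (p / (p * x)) with (/ x) by (field; auto).
rewrite (qpoch_step x p Hp1), (qpoch_step (/ x) p Hp1).
replace (/ x * p) with (p / x) by (field; auto). replace (x * p) with (p * x) by ring.
field; auto.
Qed.

(** Split the factors 1 - x^2 p^k by the parity of k. Each is a difference of squares, since x^2
    p^(2i) = (x p^i)^2 and x^2 p^(2i+1) = (s x p^i)^2. *)
Lemma qpoch_square (x s : C) : (Cmod (s * s) < 1)%R ->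
  qpoch (x * x) (s * s) =
  qpoch x (s * s) * qpoch (- x) (s * s) * (qpoch (s * x) (s * s) * qpoch (- (s * x)) (s * s)).
Proof.
intros Hp. set (p := s * s) in *.
apply (clim_unique eventually (fun n => qpoch_n (x * x) p (2 * n))).
- apply (clim_subseq (qpoch_n (x * x) p)); [|now apply qpoch_lim]. intros m. exists m. intros; lia.
- apply (clim_ext _ (fun n => qpoch_n x p n * qpoch_n (- x) p n * (qpoch_n (s * x) p n * qpoch_n (- (s * x)) p n))).
  + apply filter_forall. intros n. unfold qpoch_n. induction n; [simpl; ring|].
    replace (2 * S n)%nat with (S (S (2 * n))) by lia.
    change (partial_prod (qfactor (x * x) p) (S (S (2 * n)))) with
      (partial_prod (qfactor (x * x) p) (2 * n) * qfactor (x * x) p (2 * n) * qfactor (x * x) p (S (2 * n))).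
    rewrite <- IHn. simpl partial_prod. unfold qfactor.
    replace (p ^ S (2 * n)) with (p * (p ^ n * p ^ n)) by
      (rewrite <- Cpow_add_r; rewrite Cpow_S; do 2 f_equal; lia).
    replace (p ^ (2 * n)) with (p ^ n * p ^ n) by (rewrite <- Cpow_add_r; f_equal; lia).
    generalize (p ^ n); intros P.
    generalize (partial_prod (fun k => 1 - x * p ^ k) n); intros P1.
    generalize (partial_prod (fun k => 1 - - x * p ^ k) n); intros P2.
    generalize (partial_prod (fun k => 1 - s * x * p ^ k) n); intros P3.
    generalize (partial_prod (fun k => 1 - - (s * x) * p ^ k) n); intros P4.
    unfold p. ring.
  + repeat (apply clim_mult; [apply eventually_filter | |]); now apply qpoch_lim.
Qed.

Lemma theta_duplication (x s : C) : x <> 0 -> s <> 0 -> (Cmod (s * s) < 1)%R ->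
  theta (x * x) (s * s) =
  theta x (s * s) * theta (- x) (s * s) * theta (s * x) (s * s) * theta (- (s * x)) (s * s).
Proof.
intros Hx Hs Hp. unfold theta.
replace (s * s / (x * x)) with ((s / x) * (s / x)) by (field; auto).
rewrite !qpoch_square by auto.
replace (s * s / (s * x)) with (s / x) by (field; auto).
replace (s * s / - x) with (- (s * s / x)) by (field; auto).
replace (s * s / - (s * x)) with (- (s / x)) by (field; auto).
replace (s * (s / x)) with (s * s / x) by (field; auto). ring.
Qed.

Lemma Copp_nz (x : C) : x <> 0 -> - x <> 0.
Proof. intros H E. apply H. replace x with (- - x) by ring. rewrite E. ring. Qed.

(** [qpoch_square] at x = s, divided by (p;p), is Euler's identity (-p;p)(s;p)(-s;p) = 1. The
    product of thetas is twice its square; the 2 is the factor 1 - (-1) of (-1;p). *)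
Lemma theta_half_periods (s : C) : s <> 0 -> (Cmod (s * s) < 1)%R ->
  theta (- (1)) (s * s) * theta s (s * s) * theta (- s) (s * s) = 2.
Proof.
intros Hs Hp. set (p := s * s) in *.
assert (Hphi : qpoch p p <> 0) by now apply qpoch_nz_small.
assert (E : qpoch (- p) p * qpoch s p * qpoch (- s) p = 1).
{ assert (H := qpoch_square s s Hp). fold p in H.
  replace (qpoch (- p) p * qpoch s p * qpoch (- s) p) with
    (qpoch s p * qpoch (- s) p * (qpoch p p * qpoch (- p) p) / qpoch p p) by (field; auto).
  rewrite <- H. field; auto. }
unfold theta.
replace (p / - (1)) with (- p) by (field; apply Copp_nz, C1_nz).
replace (p / s) with s by (unfold p; field; auto).
replace (p / - s) with (- s) by (unfold p; field; auto).
rewrite (qpoch_step (- (1)) p Hp). replace (- (1) * p) with (- p) by ring.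
transitivity (2 * (qpoch (- p) p * qpoch s p * qpoch (- s) p) * (qpoch (- p) p * qpoch s p * qpoch (- s) p)).
- ring.
- rewrite E. ring.
Qed.

(** * Determinantal form of theta products and differences of wp values *)

Section Pluecker.
Variables s : C.
Hypotheses (Hs : s <> 0) (Hs1 : (Cmod s < 1)%R).
Let p := s * s.

Let Hp0 : p <> 0.
Proof. unfold p; nz. Qed.
Let Hp : (Cmod p < 1)%R.
Proof. unfold p. rewrite Cmod_mult. assert (Q := Cmod_ge_0 s). nra. Qed.

Definition theta_det (x y : C) : C := theta (x * y) p * theta (x / y) p / x.

Lemma theta_det_bilinear : exists a b : C -> C, forall x y : C, x <> 0 -> y <> 0 ->
  theta_det x y = a x * b y - b x * a y.
Proof.
set (phi := qpoch p p). assert (Hphi : phi <> 0) by now apply qpoch_nz_small.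
exists (fun z => theta_sum (s * s) (z * z) / (z * phi)), (fun z => theta_sum (s * s) (s * s * (z * z)) / phi).
intros x y Hx Hy. assert (H := theta_sum_addition s x y Hs Hx Hy Hs1). cbv zeta in H.
rewrite !jacobi_triple_product in H by nz. fold p phi in H. fold p.
unfold theta_det.
transitivity ((theta (x * y) p * phi * (theta (x / y) p * phi)) / (x * phi * phi)); [field; auto|].
rewrite H. fold p. field; auto.
Qed.

(* Weierstrass' three-term identity. *)
Lemma theta_det_pluecker (x y z t : C) : x <> 0 -> y <> 0 -> z <> 0 -> t <> 0 ->
  theta_det x y * theta_det z t - theta_det x z * theta_det y t + theta_det x t * theta_det y z = 0.
Proof.
intros. destruct theta_det_bilinear as [a [b H']]. rewrite !H' by auto. ring.
Qed.

(* theta_diff x y plays the role of wp(x) - wp(y), up to a common factor. *)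
Definition theta_diff (x y : C) : C := y * theta (x * y) p * theta (x / y) p / (theta x p ^ 2 * theta y p ^ 2).

(** [theta_diff x y] is det(x, y) / (det(x, 1) det(y, 1)) for [theta_det], that is, a difference of
    slopes relative to the origin 1 of the group. Additivity is Weierstrass' identity with t = 1. *)
Lemma theta_diff_chasles (x y z : C) : x <> 0 -> y <> 0 -> z <> 0 ->
  theta x p <> 0 -> theta y p <> 0 -> theta z p <> 0 ->
  theta_diff x z = theta_diff x y + theta_diff y z.
Proof.
intros Hx Hy Hz Tx Ty Tz.
assert (E : forall x y : C, x <> 0 -> y <> 0 -> theta x p <> 0 -> theta y p <> 0 ->
  theta_diff x y = theta_det x y / (theta_det x 1 * theta_det y 1)).
{ intros a b Ha Hb Ta Tb. unfold theta_diff, theta_det. rewrite !Cmult_1_r.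
  replace (a / 1) with a by field. replace (b / 1) with b by field. field; auto. }
assert (N : forall x : C, x <> 0 -> theta x p <> 0 -> theta_det x 1 <> 0).
{ intros a Ha Ta. unfold theta_det. rewrite Cmult_1_r. replace (a / 1) with a by field. nz. }
rewrite !E by auto.
assert (H := theta_det_pluecker x y z 1 Hx Hy Hz C1_nz).
assert (Nx := N x Hx Tx). assert (Ny := N y Hy Ty). assert (Nz := N z Hz Tz).
assert (H' : theta_det x z * theta_det y 1 = theta_det x y * theta_det z 1 + theta_det x 1 * theta_det y z).
{ transitivity (theta_det x z * theta_det y 1 + (theta_det x y * theta_det z 1
    - theta_det x z * theta_det y 1 + theta_det x 1 * theta_det y z)); [rewrite H; ring | ring]. }
transitivity (theta_det x z * theta_det y 1 / (theta_det x 1 * theta_det y 1 * theta_det z 1)).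
- field; auto.
- rewrite H'. field; auto.
Qed.

Let T1 := theta (- (1)) p.
Let T2 := theta s p.
Let T3 := theta (- s) p.

Lemma half_period_prod : T1 * T2 * T3 = 2.
Proof. now apply theta_half_periods. Qed.

Lemma half_period_nz : T1 <> 0 /\ T2 <> 0 /\ T3 <> 0.
Proof.
assert (H := half_period_prod). assert (E2 : (2 : C) <> 0) by (intros E; apply RtoC_inj in E; lra).
repeat split; intros E; apply E2; rewrite <- H, E; ring.
Qed.

(** At a half-period y the points x y and x / y differ by a period, so the two theta factors merge
    into a square: this is the classical fact that wp - e_i is a square. *)
Lemma theta_diff_half (x : C) : x <> 0 ->
  theta_diff x (- (1)) = - (theta (- x) p ^ 2 / (theta x p ^ 2 * T1 ^ 2)) /\
  theta_diff x s = - (x * theta (s * x) p ^ 2 / (theta x p ^ 2 * T2 ^ 2)) /\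
  theta_diff x (- s) = - (x * theta (- (s * x)) p ^ 2 / (theta x p ^ 2 * T3 ^ 2)).
Proof.
intros Hx.
assert (Sh : forall y : C, y <> 0 -> theta y p = - (y * theta (p * y) p)).
{ intros y Hy. rewrite theta_shift by auto. field; auto. }
unfold theta_diff. fold T1 T2 T3. repeat split.
- replace (x * - (1)) with (- x) by ring. replace (x / - (1)) with (- x) by (field; apply Copp_nz, C1_nz).
  unfold Cdiv. ring.
- rewrite (Sh (x / s)) by nz. replace (p * (x / s)) with (s * x) by (unfold p; field; auto).
  replace (x * s) with (s * x) by ring. unfold Cdiv.
  transitivity (- (x * (s * / s) * theta (s * x) p ^ 2 * / (theta x p ^ 2 * T2 ^ 2))); [ring|].
  rewrite Cinv_r by auto. ring.
- replace (x / - s) with (- (x / s)) by (field; auto).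
  rewrite (Sh (- (x / s))) by (apply Copp_nz; nz).
  replace (p * - (x / s)) with (- (s * x)) by (unfold p; field; auto).
  replace (x * - s) with (- (s * x)) by ring. unfold Cdiv.
  transitivity (- (x * (s * / s) * theta (- (s * x)) p ^ 2 * / (theta x p ^ 2 * T3 ^ 2))); [ring|].
  rewrite Cinv_r by auto. ring.
Qed.

(** The counterpart of wp'^2 = 4 (wp - e_1)(wp - e_2)(wp - e_3) with wp' = -sigma(2z) / sigma(z)^4.
    The constant 4 enters as (T1 T2 T3)^2, after which [theta_duplication] cancels everything. *)
Lemma theta_diff_half_prod (x : C) : x <> 0 -> theta x p <> 0 ->
  theta_diff x (- (1)) * theta_diff x s * theta_diff x (- s)
  = - (x ^ 2 * theta (x * x) p ^ 2 / (4 * theta x p ^ 8)).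
Proof.
intros Hx Tx. destruct (theta_diff_half x Hx) as [-> [-> ->]].
destruct half_period_nz as [N1 [N2 N3]].
assert (E2 : (2 : C) <> 0) by (intros E; apply RtoC_inj in E; lra).
replace (4 : C) with ((T1 * T2 * T3) ^ 2) by (rewrite half_period_prod, <- RtoC_pow; f_equal; ring).
unfold p. rewrite theta_duplication by auto. fold p. field; auto.
Qed.

(** The product formula Delta = p (p;p)^24; the 24th power is absent because [theta] omits the
    factor (p;p). As before, 16 is written as (T1 T2 T3)^4. *)
Lemma theta_diff_discriminant :
  16 * (theta_diff (- (1)) s * theta_diff s (- s) * theta_diff (- (1)) (- s)) ^ 2 = p.
Proof.
destruct half_period_nz as [N1 [N2 N3]].
assert (Nm : - (1) <> 0) by apply Copp_nz, C1_nz.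
destruct (theta_diff_half (- (1)) Nm) as [_ [-> ->]].
destruct (theta_diff_half s Hs) as [_ [_ ->]].
replace (s * - (1)) with (- s) by ring. replace (- - s) with s by ring.
replace (- (s * s)) with (p * - (1)) by (unfold p; ring).
rewrite theta_shift by auto. fold T1 T2 T3.
replace (16 : C) with ((T1 * T2 * T3) ^ 4) by (rewrite half_period_prod, <- RtoC_pow; f_equal; ring).
unfold p. field; auto.
Qed.

End Pluecker.

(** * Points of order 7 *)

Lemma Cmod_pow_lt1 (q : C) n : (Cmod q < 1)%R -> (Cmod (q ^ S n) < 1)%R.
Proof. intros H. rewrite Cpow_S. now apply Cmod_mul_pow_lt1. Qed.

(** Written with z^(7-k) instead of z^7 / z^k so that it is analytic on the whole unit disc, 0
    included; the expansion at the cusp is read off at z = 0. *)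
Definition theta7 (k : nat) (z : C) : C := qpoch (z ^ k) (z ^ 7) * qpoch (z ^ (7 - k)) (z ^ 7).

Lemma theta7_theta (q : C) k : q <> 0 -> (k <= 7)%nat -> theta7 k q = theta (q ^ k) (q ^ 7).
Proof.
intros Hq Hk. unfold theta7, theta. do 2 f_equal.
replace (q ^ 7) with (q ^ k * q ^ (7 - k)) by (rewrite <- Cpow_add_r; f_equal; lia).
field. nz.
Qed.

Lemma theta7_nz (q : C) k : (Cmod q < 1)%R -> (0 < k < 7)%nat -> theta7 k q <> 0.
Proof.
intros Hq1 [Hk Hk']. unfold theta7.
destruct k as [|k]; [lia|]. replace (7 - S k)%nat with (S (5 - k)) by lia.
apply Cmult_neq_0; apply qpoch_nz_small; now apply Cmod_pow_lt1.
Qed.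

(** Reflection x -> q^7 / x identifies the thetas at q^4, q^5, q^6 with those at q^3, q^2, q. Sums,
    differences and doubles of the three points thus only produce U, V and W. *)
Lemma theta7_relations (q s : C) : q <> 0 -> (Cmod q < 1)%R -> s * s = q ^ 7 ->
  let U := theta7 3 q in let V := theta7 2 q in let W := theta7 1 q in
  let X := U ^ 3 * W in let Y := q * W ^ 3 * V in
  U * V ^ 3 = X + Y /\
  (U * V * W) ^ 4 * (X * Y * (X + Y)) = q * (X ^ 3 - 5 * X ^ 2 * Y - 8 * X * Y ^ 2 - Y ^ 3).
Proof.
intros Hq Hq1 Hsq.
assert (Hs : s <> 0).
{ intros E. rewrite E in Hsq. apply (Cpow_nz q 7); auto. rewrite <- Hsq. ring. }
assert (Hss : (Cmod (s * s) < 1)%R) by (rewrite Hsq; now apply Cmod_pow_lt1).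
assert (Hs1 : (Cmod s < 1)%R).
{ rewrite Cmod_mult in Hss. assert (Q := Cmod_ge_0 s). nra. }
assert (NU : theta7 3 q <> 0) by (apply theta7_nz; auto; lia).
assert (NV : theta7 2 q <> 0) by (apply theta7_nz; auto; lia).
assert (NW : theta7 1 q <> 0) by (apply theta7_nz; auto; lia).
assert (TW : theta q (s * s) = theta7 1 q) by (rewrite Hsq, theta7_theta, Cpow_1_r by (auto; lia); reflexivity).
assert (TV : theta (q ^ 2) (s * s) = theta7 2 q) by (rewrite Hsq, theta7_theta by (auto; lia); reflexivity).
assert (TU : theta (q ^ 3) (s * s) = theta7 3 q) by (rewrite Hsq, theta7_theta by (auto; lia); reflexivity).
assert (TU' : theta (q ^ 4) (s * s) = theta7 3 q).
{ rewrite <- TU, <- theta_inv by (auto; nz). f_equal. rewrite Hsq. field; auto. }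
assert (TV' : theta (q ^ 5) (s * s) = theta7 2 q).
{ rewrite <- TV, <- theta_inv by (auto; nz). f_equal. rewrite Hsq. field; auto. }
assert (TW' : theta (q ^ 6) (s * s) = theta7 1 q).
{ rewrite <- TW, <- theta_inv by (auto; nz). f_equal. rewrite Hsq. field; auto. }
destruct (half_period_nz s Hs Hs1) as [N1 [N2 N3]].
assert (Nm : - (1) <> 0) by apply Copp_nz, C1_nz.
assert (Ns : - s <> 0) by now apply Copp_nz.
pose (d := theta_diff s).
assert (Ch : forall x y z : C, x <> 0 -> y <> 0 -> z <> 0 -> theta x (s * s) <> 0 ->
  theta y (s * s) <> 0 -> theta z (s * s) <> 0 -> d x y = d x z - d y z).
{ intros x y z Hx Hy Hz Tx Ty Tz. unfold d. rewrite (theta_diff_chasles s Hs Hs1 x y z); auto. ring. }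
assert (Zm : d (- (1)) (- (1)) = 0).
{ assert (E := theta_diff_chasles s Hs Hs1 (- (1)) (- (1)) (- (1)) Nm Nm Nm N1 N1 N1). fold d in E.
  replace (d (- (1)) (- (1))) with (d (- (1)) (- (1)) + d (- (1)) (- (1)) - d (- (1)) (- (1))) by ring.
  rewrite <- E. ring. }
assert (F : forall x : C, x <> 0 -> theta x (s * s) <> 0 ->
  (d x (- (1)) - d (- (1)) (- (1))) * (d x (- (1)) - d s (- (1))) * (d x (- (1)) - d (- s) (- (1)))
  = - (x ^ 2 * theta (x * x) (s * s) ^ 2 / (4 * theta x (s * s) ^ 8))).
{ intros x Hx Tx. rewrite <- !Ch by auto. now apply theta_diff_half_prod. }
(* Only differences of wp values are available. The half-period -1 serves as common reference point,
   and [Ch] removes it again from every hypothesis. *)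
apply (level7_relation q (theta7 3 q) (theta7 2 q) (theta7 1 q)
  (d q (- (1))) (d (q ^ 2) (- (1))) (d (q ^ 3) (- (1)))
  (d (- (1)) (- (1))) (d s (- (1))) (d (- s) (- (1)))); auto.
- rewrite <- Ch by (rewrite ?TW, ?TV, ?TU; auto; nz). unfold d, theta_diff.
  replace (q ^ 2 * q) with (q ^ 3) by ring. replace (q ^ 2 / q) with q by (field; auto).
  rewrite TW, TV, TU. field; auto.
- rewrite <- Ch by (rewrite ?TW, ?TV, ?TU; auto; nz). unfold d, theta_diff.
  replace (q ^ 3 * q ^ 2) with (q ^ 5) by ring. replace (q ^ 3 / q ^ 2) with q by (field; auto).
  rewrite TW, TV', TV, TU. field; auto.
- rewrite <- Ch by (rewrite ?TW, ?TV, ?TU; auto; nz). unfold d, theta_diff.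
  replace (q ^ 3 * q) with (q ^ 4) by ring. replace (q ^ 3 / q) with (q ^ 2) by (field; auto).
  rewrite TW, TU', TV, TU. field; auto.
- rewrite F by (rewrite ?TW; auto). replace (q * q) with (q ^ 2) by ring. now rewrite TV, TW.
- rewrite F by (rewrite ?TV; auto; nz). replace (q ^ 2 * q ^ 2) with (q ^ 4) by ring. rewrite TU', TV.
  replace ((q ^ 2) ^ 2) with (q ^ 4) by ring. reflexivity.
- rewrite F by (rewrite ?TU; auto; nz). replace (q ^ 3 * q ^ 3) with (q ^ 6) by ring. rewrite TW', TU.
  replace ((q ^ 3) ^ 2) with (q ^ 6) by ring. reflexivity.
- rewrite <- !Ch by auto. rewrite <- Hsq. now apply theta_diff_discriminant.
Qed.

Lemma qpoch_split7 (q : C) : (Cmod q < 1)%R ->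
  qpoch q q = theta7 3 q * theta7 2 q * theta7 1 q * qpoch (q ^ 7) (q ^ 7).
Proof.
intros Hq. assert (Hp : (Cmod (q ^ 7) < 1)%R) by now apply Cmod_pow_lt1.
assert (L := fun k => qpoch_lim (q ^ k) (q ^ 7) Hp).
unfold theta7. simpl (7 - _)%nat.
apply (clim_unique eventually (fun n => qpoch_n q q (7 * n))).
- apply (clim_subseq (qpoch_n q q)); [|now apply qpoch_lim]. intros m. exists m. intros; lia.
- pose (f := fun k n => qpoch_n (q ^ k) (q ^ 7) n).
  apply (clim_ext _ (fun n => f 3%nat n * f 4%nat n * (f 2%nat n * f 5%nat n) * (f 1%nat n * f 6%nat n) * f 7%nat n)).
  + apply filter_forall. intros n. unfold f, qpoch_n. induction n; [simpl; ring|].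
    replace (7 * S n)%nat with (S (S (S (S (S (S (S (7 * n)))))))) by lia.
    cbn [partial_prod]. rewrite <- IHn. unfold qfactor.
    rewrite !Cpow_S, !Cpow_mult_r. cbn [Cpow].
    generalize ((q * (q * (q * (q * (q * (q * (q * 1))))))) ^ n). intros P. ring.
  + repeat (apply clim_mult; [apply eventually_filter | |]); apply L.
Qed.

(** * Limits of polynomials on a disc *)

Definition peval (l : list C) (z : C) : C := fold_right (fun a s => a + z * s) 0 l.
Definition pnorm (r : R) (l : list C) : R := fold_right (fun a s => (Cmod a + r * s)%R) 0%R l.

Fixpoint padd (l m : list C) : list C :=
  match l, m with
  | nil, _ => m
  | _, nil => l
  | a :: l', b :: m' => (a + b) :: padd l' m'
  end.

Fixpoint pmul (l m : list C) : list C :=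
  match l with
  | nil => nil
  | a :: l' => padd (map (Cmult a) m) ((0 : C) :: pmul l' m)
  end.

(* Synthetic division by X - z0. *)
Fixpoint pdiv (z0 : C) (l : list C) : list C :=
  match l with
  | nil => nil
  | a :: l' => padd l' (map (Cmult z0) (pdiv z0 l'))
  end.

Lemma peval_add l m z : peval (padd l m) z = peval l z + peval m z.
Proof.
revert m; induction l as [|a l IH]; intros [|b m]; simpl; try ring.
fold (peval (padd l m) z). rewrite IH. unfold peval. ring.
Qed.

Lemma peval_scal c l z : peval (map (Cmult c) l) z = c * peval l z.
Proof. induction l; simpl; [ring|]. fold (peval (map (Cmult c) l) z). rewrite IHl. unfold peval. ring. Qed.

Lemma peval_mul l m z : peval (pmul l m) z = peval l z * peval m z.
Proof.
induction l; simpl; [ring|]. rewrite peval_add, peval_scal. simpl.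
fold (peval (pmul l m) z). rewrite IHl. unfold peval. ring.
Qed.

Lemma peval_div z0 l z : peval l z - peval l z0 = (z - z0) * peval (pdiv z0 l) z.
Proof.
induction l; simpl; [ring|]. rewrite peval_add, peval_scal.
fold (peval l z) (peval l z0).
transitivity ((z - z0) * peval l z + z0 * (peval l z - peval l z0)); [ring|]. rewrite IHl. ring.
Qed.

Section Norm.
Variable r : R.
Hypothesis Hr : (0 <= r)%R.

Lemma pnorm_ge0 l : (0 <= pnorm r l)%R.
Proof.
induction l; simpl; [lra|]. assert (Q := Cmod_ge_0 a).
fold (pnorm r l). assert (0 <= r * pnorm r l)%R by now apply Rmult_le_pos. lra.
Qed.

Lemma pnorm_add l m : (pnorm r (padd l m) <= pnorm r l + pnorm r m)%R.
Proof.
revert m; induction l as [|a l IH]; intros [|b m]; simpl; try lra.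
fold (pnorm r (padd l m)) (pnorm r l) (pnorm r m).
assert (Q := Cmod_triangle a b). assert (Q' := Rmult_le_compat_l r _ _ Hr (IH m)). lra.
Qed.

Lemma pnorm_scal c l : pnorm r (map (Cmult c) l) = (Cmod c * pnorm r l)%R.
Proof.
induction l; simpl; [ring|]. fold (pnorm r (map (Cmult c) l)) (pnorm r l).
rewrite IHl, Cmod_mult. ring.
Qed.

Lemma pnorm_mul l m : (pnorm r (pmul l m) <= pnorm r l * pnorm r m)%R.
Proof.
induction l; simpl; [lra|]. eapply Rle_trans; [apply pnorm_add|].
rewrite pnorm_scal. simpl. rewrite Cmod_0. fold (pnorm r (pmul l m)) (pnorm r l).
assert (Q := Rmult_le_compat_l r _ _ Hr IHl). lra.
Qed.

(** By induction: the quotient of a + X l has norm at most |l| + |z0| |l / (X - z0)|, and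
    multiplying by r - |z0| leaves at most r |l|. *)
Lemma pnorm_div z0 l : (Cmod z0 < r)%R -> (pnorm r (pdiv z0 l) <= pnorm r l / (r - Cmod z0))%R.
Proof.
intros H0. apply Rle_div_r; [lra|].
induction l; simpl; [lra|]. fold (pnorm r l).
assert (Q := pnorm_add l (map (Cmult z0) (pdiv z0 l))). rewrite pnorm_scal in Q.
assert (P := Cmod_ge_0 z0). assert (P' := Cmod_ge_0 a).
assert (Q' := Rmult_le_compat_l _ _ _ P IHl).
apply (Rmult_le_compat_r (r - Cmod z0)) in Q; [|lra]. lra.
Qed.

Lemma peval_bound l z : (Cmod z <= r)%R -> (Cmod (peval l z) <= pnorm r l)%R.
Proof.
intros Hz. induction l; simpl; [rewrite Cmod_0; lra|].
fold (peval l z) (pnorm r l).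
eapply Rle_trans; [apply Cmod_triangle|]. rewrite Cmod_mult.
assert (Q := Rmult_le_compat _ _ _ _ (Cmod_ge_0 z) (Cmod_ge_0 (peval l z)) Hz IHl). lra.
Qed.
End Norm.

(* Limits of polynomials bounded in the weighted l^1 norm: stable under products
   and, unlike sup-norm limits, under division by (z - z0) for elementary reasons. *)
Definition analytic_le (r M : R) (f : C -> C) : Prop :=
  exists P : nat -> list C, (forall n, pnorm r (P n) <= M)%R /\
    forall z, (Cmod z <= r)%R -> clim eventually (fun n => peval (P n) z) (f z).

Definition analytic (r : R) (f : C -> C) : Prop := exists M, analytic_le r M f.

Section Analytic.
Variable r : R.
Hypothesis Hr : (0 < r)%R.

Lemma analytic_const c : analytic r (fun _ => c).
Proof.
exists (Cmod c + r * 0)%R, (fun _ => c :: nil). split; [intros; simpl; lra|].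
intros z _. simpl. replace (c + z * 0) with c by ring. apply clim_const, eventually_filter.
Qed.

Lemma analytic_id : analytic r (fun z => z).
Proof.
exists r, (fun _ => (0 : C) :: (1 : C) :: nil). split.
{ intros; simpl. rewrite Cmod_0, Cmod_1. lra. }
intros z _. simpl. replace (0 + z * (1 + z * 0)) with z by ring. apply clim_const, eventually_filter.
Qed.

Lemma analytic_mult f g : analytic r f -> analytic r g -> analytic r (fun z => f z * g z).
Proof.
intros [M [P [HP Hf]]] [N [Q [HQ Hg]]]. exists (M * N)%R, (fun n => pmul (P n) (Q n)). split.
- intros n. eapply Rle_trans; [apply pnorm_mul; lra|].
  apply Rmult_le_compat; auto; apply pnorm_ge0; lra.
- intros z Hz. apply (clim_ext _ (fun n => peval (P n) z * peval (Q n) z)).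
  + apply filter_forall. intros n. now rewrite peval_mul.
  + apply clim_mult; auto. apply eventually_filter.
Qed.

Lemma analytic_plus f g : analytic r f -> analytic r g -> analytic r (fun z => f z + g z).
Proof.
intros [M [P [HP Hf]]] [N [Q [HQ Hg]]]. exists (M + N)%R, (fun n => padd (P n) (Q n)). split.
- intros n. eapply Rle_trans; [apply pnorm_add; lra|]. now apply Rplus_le_compat.
- intros z Hz. apply (clim_ext _ (fun n => peval (P n) z + peval (Q n) z)).
  + apply filter_forall. intros n. now rewrite peval_add.
  + apply clim_plus; auto. apply eventually_filter.
Qed.

Lemma analytic_pow f n : analytic r f -> analytic r (fun z => f z ^ n).
Proof.
intros H. induction n; simpl; [apply analytic_const | now apply analytic_mult].
Qed.

Lemma analytic_le_bound M f z : analytic_le r M f -> (Cmod z <= r)%R -> (Cmod (f z) <= M)%R.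
Proof.
intros [P [HP Hf]] Hz. apply (clim_le eventually (fun n => peval (P n) z)); auto.
apply filter_forall. intros n. eapply Rle_trans; [apply (peval_bound r); auto; lra | auto].
Qed.

(** The quotients by synthetic division converge to the difference quotient away from z0. The point
    z0 itself needs an argument, and the limit there becomes the value of g. *)
Lemma analytic_le_div M f z0 : (Cmod z0 < r)%R -> analytic_le r M f ->
  exists g, analytic_le r (M / (r - Cmod z0)) g /\
    forall z, (Cmod z <= r)%R -> f z - f z0 = (z - z0) * g z.
Proof.
intros H0 [P [HP Hf]].
set (Q := fun n => pdiv z0 (P n)).
assert (HQ : forall n, (pnorm r (Q n) <= M / (r - Cmod z0))%R).
{ intros n. eapply Rle_trans; [apply pnorm_div; auto; lra|].
  apply Rmult_le_compat_r; [left; apply Rinv_0_lt_compat; lra | auto]. }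
assert (Lz : forall z, (Cmod z <= r)%R -> z <> z0 ->
  clim eventually (fun n => peval (Q n) z) ((f z - f z0) / (z - z0))).
{ intros z Hz N. assert (N' : z - z0 <> 0) by now apply Cminus_eq_contra.
  apply (clim_ext _ (fun n => (peval (P n) z - peval (P n) z0) * / (z - z0))).
  - apply filter_forall. intros n. rewrite peval_div. unfold Q. field. auto.
  - apply clim_mult; [apply eventually_filter | | apply clim_const, eventually_filter].
    apply clim_minus; [apply eventually_filter | auto | apply Hf; lra]. }
set (K := (M / (r - Cmod z0) / (r - Cmod z0))%R).
assert (HK : (0 <= K)%R).
{ unfold K. apply Rle_div_r; [lra|]. rewrite Rmult_0_l.
  eapply Rle_trans; [apply (pnorm_ge0 r ltac:(lra) (Q O)) | apply HQ]. }
(* Dividing a second time bounds the variation of all quotients at z0 by one constant [K], whence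
   their values at z0 form a Cauchy sequence by comparison with a nearby point. *)
assert (Lip : forall n z, (Cmod z <= r)%R ->
  (Cmod (peval (Q n) z - peval (Q n) z0) <= Cmod (z - z0) * K)%R).
{ intros n z Hz. rewrite peval_div, Cmod_mult. apply Rmult_le_compat_l; [apply Cmod_ge_0|].
  eapply Rle_trans; [apply (peval_bound r); auto; lra|].
  eapply Rle_trans; [apply pnorm_div; auto; lra|].
  unfold K. apply Rmult_le_compat_r; [left; apply Rinv_0_lt_compat; lra | auto]. }
assert (L0 : exists l, clim eventually (fun n => peval (Q n) z0) l).
{ apply clim_cauchy; [apply eventually_filter|]. intros eps He.
  (* The first bound keeps z0 + t in the disc, the second gives t K < eps / 4; two variations and
     two convergence errors add up to less than eps. *)
  set (t := Rmin (r - Cmod z0) (eps / (4 * (K + 1)))).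
  assert (Ht : (0 < t)%R) by (unfold t; apply Rmin_pos; [lra | apply Rdiv_lt_0_compat; lra]).
  assert (Ht1 : (t <= r - Cmod z0)%R) by apply Rmin_l.
  assert (Ht2 : (t * K < eps / 4)%R).
  { assert (H : (t <= eps / (4 * (K + 1)))%R) by apply Rmin_r.
    apply Rle_div_r in H; [|lra]. lra. }
  set (z := z0 + RtoC t).
  assert (Ez : z - z0 = RtoC t) by (unfold z; ring).
  assert (Mt : Cmod (RtoC t) = t) by (rewrite Cmod_R; apply Rabs_pos_eq; lra).
  assert (Hz : (Cmod z <= r)%R).
  { unfold z. eapply Rle_trans; [apply Cmod_triangle|]. rewrite Mt. lra. }
  assert (Nz : z <> z0).
  { intros E. assert (t = 0)%R; [|lra]. apply RtoC_inj. rewrite <- Ez, E. ring. }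
  exists (fun n => (Cmod (peval (Q n) z - (f z - f z0) / (z - z0)) < eps / 4)%R). split.
  - apply Lz; auto. lra.
  - intros m n Hm Hn.
    assert (A1 := Lip m z Hz). assert (A2 := Lip n z Hz). rewrite Ez, Mt in A1, A2.
    set (l := (f z - f z0) / (z - z0)) in *.
    assert (B1 := Cmod_sub_triangle (peval (Q m) z0) (peval (Q m) z) (peval (Q n) z0)).
    assert (B2 := Cmod_sub_triangle (peval (Q m) z) l (peval (Q n) z0)).
    assert (B3 := Cmod_sub_triangle l (peval (Q n) z) (peval (Q n) z0)).
    rewrite (Cmod_sub_sym (peval (Q m) z0) (peval (Q m) z)) in B1.
    rewrite (Cmod_sub_sym l (peval (Q n) z)) in B3. lra. }
destruct L0 as [l Hl].
exists (fun z => if dec z z0 then l else (f z - f z0) / (z - z0)). split.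
- exists Q. split; [exact HQ|]. intros z Hz. destruct (dec z z0) as [->|N]; auto.
- intros z Hz. destruct (dec z z0) as [->|N]; [ring|].
  field. now apply Cminus_eq_contra.
Qed.

(** Either finitely many divisions by z - z0 reach a cofactor that is nonzero at z0, and hence
    nearby, or the division never stops. In the latter case |f(z)| <= M (|z - z0| / rho)^m for all
    m, which forces f = 0 within rho / 2. *)
Lemma analytic_zero_dichotomy f z0 : analytic r f -> (Cmod z0 < r)%R ->
  (exists d, (0 < d)%R /\ forall z, (Cmod (z - z0) < d)%R -> f z = 0) \/
  (exists d, (0 < d)%R /\ forall z, z <> z0 -> (Cmod (z - z0) < d)%R -> f z <> 0).
Proof.
intros [M Hf] H0. set (rho := (r - Cmod z0)%R). assert (Hrho : (0 < rho)%R) by (unfold rho; lra).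
assert (Near : forall z, (Cmod (z - z0) < rho)%R -> (Cmod z <= r)%R).
{ intros z Hz. assert (Q := Cmod_sub_ge z z0). unfold rho in Hz. lra. }
destruct (classic (exists m g N, analytic_le r N g /\ g z0 <> 0 /\
  forall z, (Cmod z <= r)%R -> f z = (z - z0) ^ m * g z)) as [[m [g [N [Hg [Hg0 E]]]]]|H].
- right. destruct (analytic_le_div N g z0 H0 Hg) as [k [Hk Ek]].
  set (B := (N / (r - Cmod z0))%R) in Hk.
  assert (HB : (0 <= B)%R).
  { eapply Rle_trans; [apply Cmod_ge_0 | apply (analytic_le_bound B k z0 Hk); lra]. }
  assert (Pg := proj1 (Cmod_gt_0 _) Hg0).
  exists (Rmin rho (Cmod (g z0) / (B + 1))). split.
  { apply Rmin_pos; auto. apply Rdiv_lt_0_compat; lra. }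
  intros z Nz Hz.
  assert (Hz1 : (Cmod (z - z0) < rho)%R) by (eapply Rlt_le_trans; [exact Hz | apply Rmin_l]).
  assert (Hz2 : (Cmod (z - z0) < Cmod (g z0) / (B + 1))%R) by (eapply Rlt_le_trans; [exact Hz | apply Rmin_r]).
  rewrite E by auto. apply Cmult_neq_0; [apply Cpow_nz; now apply Cminus_eq_contra|].
  intros Gz. assert (D := Ek z (Near z Hz1)). rewrite Gz in D.
  assert (D' : Cmod (g z0) = (Cmod (z - z0) * Cmod (k z))%R).
  { rewrite <- Cmod_mult, <- D, <- Cmod_opp. f_equal. ring. }
  assert (Bk := analytic_le_bound B k z Hk (Near z Hz1)).
  apply Rlt_div_r in Hz2; [|lra].
  assert (Q := Cmod_ge_0 (z - z0)).
  assert (Cmod (z - z0) * Cmod (k z) <= Cmod (z - z0) * B)%R by now apply Rmult_le_compat_l. nra.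
- left. assert (K : forall m, exists g, analytic_le r (M / rho ^ m) g /\
    forall z, (Cmod z <= r)%R -> f z = (z - z0) ^ m * g z).
  { induction m as [|m [g [Hg E]]].
    - exists f. split; [|intros; simpl; ring]. simpl. now replace (M / 1)%R with M by field.
    - assert (Z : g z0 = 0).
      { destruct (dec (g z0) 0) as [|N]; auto. exfalso. apply H. now exists m, g, (M / rho ^ m)%R. }
      destruct (analytic_le_div _ g z0 H0 Hg) as [k [Hk Ek]]. exists k. split.
      + replace (M / rho ^ S m)%R with (M / rho ^ m / (r - Cmod z0))%R; [exact Hk|].
        fold rho. simpl. field. split; try apply pow_nonzero; lra.
      + intros z Hz. rewrite E by auto. assert (D := Ek z Hz). rewrite Z in D.
        replace (g z) with (g z - 0) by ring. rewrite D. simpl. ring. }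
  exists (rho / 2)%R. split; [lra|]. intros z Hz.
  apply Cmod_eq_0. apply Rle_antisym; [|apply Cmod_ge_0].
  apply Rle_plus_epsilon. intros e He. rewrite Rplus_0_l.
  assert (HM : (0 <= M)%R).
  { eapply Rle_trans; [apply Cmod_ge_0 | apply (analytic_le_bound M f z0 Hf); lra]. }
  destruct (pow_lt_1_zero (1/2) ltac:(rewrite Rabs_pos_eq; lra) (e / (M + 1))) as [m Hm].
  { apply Rdiv_lt_0_compat; lra. }
  specialize (Hm m (Nat.le_refl m)). rewrite Rabs_pos_eq in Hm by (apply pow_le; lra).
  destruct (K m) as [g [Hg E]]. assert (Hz' : (Cmod z <= r)%R) by (apply Near; lra).
  rewrite E, Cmod_mult, Cmod_pow by auto.
  assert (Bg := analytic_le_bound _ g z Hg Hz').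
  assert (Pr : (0 < rho ^ m)%R) by now apply pow_lt.
  apply Rle_trans with ((rho / 2) ^ m * (M / rho ^ m))%R.
  + apply Rmult_le_compat; try apply Cmod_ge_0; auto.
    * apply pow_le, Cmod_ge_0.
    * apply pow_incr. split; [apply Cmod_ge_0 | lra].
  + replace (rho / 2)%R with (rho * (1 / 2))%R by field. rewrite Rpow_mult_distr.
    replace (rho ^ m * (1 / 2) ^ m * (M / rho ^ m))%R with ((1 / 2) ^ m * M)%R by (field; lra).
    apply Rlt_div_r in Hm; [|lra]. assert (0 <= (1/2)^m)%R by (apply pow_le; lra). lra.
Qed.
End Analytic.

Fixpoint neg_monomial (n : nat) : list C := match n with O => (- (1) : C) :: nil | S m => (0 : C) :: neg_monomial m end.

(** The partial products are themselves the approximating polynomials. The norm is submultiplicative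
    and each factor has norm at most 1 + r^(a + b k), so the exponential bound used for [qpoch_n]
    applies again. *)
Lemma analytic_qpoch r a b : (0 < r < 1)%R -> (0 < b)%nat -> analytic r (fun z => qpoch (z ^ a) (z ^ b)).
Proof.
intros Hr Hb.
pose (F := fun k => padd ((1 : C) :: nil) (neg_monomial (a + b * k))).
pose (P := fix P n := match n with O => (1 : C) :: nil | S m => pmul (P m) (F m) end).
assert (Em : forall n z, peval (neg_monomial n) z = - z ^ n).
{ induction n; intros z; simpl; [ring|]. fold (peval (neg_monomial n) z). rewrite IHn. ring. }
assert (Nm : forall n, pnorm r (neg_monomial n) = (r ^ n)%R).
{ induction n; simpl; [rewrite Cmod_opp, Cmod_1; ring|]. fold (pnorm r (neg_monomial n)).
  rewrite IHn, Cmod_0. ring. }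
assert (Hb1 : (r ^ b < 1)%R) by (apply pow_lt_1_compat; [lra | lia]).
assert (Hb0 : (0 < r ^ b)%R) by (apply pow_lt; lra).
assert (Ha0 : (0 < r ^ a)%R) by (apply pow_lt; lra).
set (geo := fun n => (r ^ a * ((1 - (r ^ b) ^ n) / (1 - r ^ b)))%R).
exists (exp (r ^ a / (1 - r ^ b))), P. split.
- intros n. apply Rle_trans with (exp (geo n)).
  + induction n; simpl.
    * rewrite Cmod_1. unfold geo. simpl. replace (r ^ a * ((1 - 1) / (1 - r ^ b)))%R with 0%R by (field; lra).
      rewrite exp_0. lra.
    * eapply Rle_trans; [apply pnorm_mul; lra|].
      replace (geo (S n)) with (geo n + r ^ (a + b * n))%R.
      2:{ unfold geo. rewrite pow_add, pow_mult. simpl. field. lra. }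
      rewrite exp_plus. apply Rmult_le_compat; try (apply pnorm_ge0; lra); auto.
      eapply Rle_trans; [apply pnorm_add; lra|]. rewrite Nm. simpl. rewrite Cmod_1.
      eapply Rle_trans; [|apply exp_ineq1_le]. lra.
  + assert (Q : (geo n <= r ^ a / (1 - r ^ b))%R).
    { unfold geo. replace (r ^ a / (1 - r ^ b))%R with (r ^ a * (1 / (1 - r ^ b)))%R by (field; lra).
      apply Rmult_le_compat_l; [lra|]. apply Rmult_le_compat_r; [left; apply Rinv_0_lt_compat; lra|].
      assert (0 < (r ^ b) ^ n)%R by now apply pow_lt. lra. }
    destruct Q as [Q| ->]; [left; now apply exp_increasing | lra].
- intros z Hz. apply (clim_ext _ (qpoch_n (z ^ a) (z ^ b))).
  + apply filter_forall. intros n. induction n; simpl; [unfold qpoch_n; simpl; ring|].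
    rewrite peval_mul, <- IHn. unfold qpoch_n; simpl. f_equal. unfold F.
    rewrite peval_add, Em. unfold qfactor. rewrite Cpow_add_r, Cpow_mult_r. simpl. ring.
  + apply qpoch_lim. rewrite Cmod_pow. apply Rle_lt_trans with (r ^ b)%R; auto.
    apply pow_incr. split; [apply Cmod_ge_0 | auto].
Qed.

(** * Complex differentiability *)

Definition cnear (z : C) (P : C -> Prop) : Prop :=
  exists d, (0 < d)%R /\ forall y, (Cmod (y - z) < d)%R -> P y.

Global Instance cnear_filter z : ProperFilter (cnear z).
Proof.
split.
- intros P [d [Hd H]]. exists z. apply H. replace (z - z) with (RtoC 0) by ring. now rewrite Cmod_0.
- split.
  + exists 1%R. split; [lra | trivial].
  + intros P Q [d [Hd H]] [e [He K]]. exists (Rmin d e). split; [now apply Rmin_pos|].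
    intros y Hy. split; [apply H | apply K]; eapply Rlt_le_trans; try exact Hy; [apply Rmin_l | apply Rmin_r].
  + intros P Q I [d [Hd H]]. exists d. auto.
Qed.

Lemma cnear_at z P : cnear z P -> P z.
Proof.
intros [d [Hd H]]. apply H. replace (z - z) with (RtoC 0) by ring. now rewrite Cmod_0.
Qed.

Lemma cnear_cnear z P : cnear z P -> cnear z (fun y => cnear y P).
Proof.
intros [d [Hd H]]. exists (d / 2)%R. split; [lra|]. intros y Hy. exists (d / 2)%R. split; [lra|].
intros x Hx. apply H. assert (Q := Cmod_sub_triangle x y z). lra.
Qed.

Definition ccont (f : C -> C) (z : C) : Prop := clim (cnear z) f (f z).

Lemma clim_nz {T} (F : (T -> Prop) -> Prop) {HF : ProperFilter F} (f : T -> C) (l : C) :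
  l <> 0 -> clim F f l -> F (fun t => f t <> 0).
Proof.
intros Hl H. assert (P := proj1 (Cmod_gt_0 l) Hl). generalize (H _ P). apply filter_imp.
intros t Ht E. rewrite E in Ht. replace (0 - l) with (- l) in Ht by ring. rewrite Cmod_opp in Ht. lra.
Qed.

Lemma clim_id z : clim (cnear z) (fun y => y) z.
Proof. intros e He. now exists e. Qed.

(* Caratheodory's form of differentiability. *)
Definition cdiff (f : C -> C) (z : C) : Prop :=
  exists (g : C -> C) (l : C), clim (cnear z) g l /\ cnear z (fun y => f y - f z = (y - z) * g y).

Lemma cdiff_ccont f z : cdiff f z -> ccont f z.
Proof.
intros [g [l [Hg E]]]. unfold ccont.
apply (clim_ext _ (fun y => f z + (y - z) * g y)).
- revert E. apply filter_imp. intros y <-. ring.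
- assert (Z : f z + (z - z) * l = f z) by ring.
  apply (eq_ind _ (clim (cnear z) (fun y => f z + (y - z) * g y))) with (2 := Z).
  apply clim_plus; [apply cnear_filter | apply clim_const, cnear_filter |].
  apply clim_mult; [apply cnear_filter | | exact Hg].
  apply clim_minus; [apply cnear_filter | apply clim_id | apply clim_const, cnear_filter].
Qed.

Lemma cdiff_const c z : cdiff (fun _ => c) z.
Proof.
exists (fun _ => 0), 0. split; [apply clim_const, cnear_filter|].
apply filter_forall. intros y. ring.
Qed.

Lemma cdiff_id z : cdiff (fun y => y) z.
Proof.
exists (fun _ => 1), 1. split; [apply clim_const, cnear_filter|].
apply filter_forall. intros y. ring.
Qed.

Lemma cdiff_mult f g z : cdiff f z -> cdiff g z -> cdiff (fun y => f y * g y) z.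
Proof.
intros Df Dg. assert (Cg := cdiff_ccont g z Dg).
destruct Df as [f' [l [Hf Ef]]]. destruct Dg as [g' [m [Hg Eg]]].
exists (fun y => f' y * g y + f z * g' y), (l * g z + f z * m). split.
- apply clim_plus; [apply cnear_filter | |]; (apply clim_mult; [apply cnear_filter | |]); auto.
  apply clim_const, cnear_filter.
- generalize (filter_and (F := cnear z) _ _ Ef Eg). apply filter_imp. intros y [E1 E2].
  transitivity ((f y - f z) * g y + f z * (g y - g z)); [ring|]. rewrite E1, E2. ring.
Qed.

Lemma cdiff_inv (f : C -> C) (z : C) : f z <> 0 -> cdiff f z -> cdiff (fun y => / f y) z.
Proof.
intros Hz Df. assert (Cf := cdiff_ccont f z Df).
destruct Df as [f' [l [Hf Ef]]].
exists (fun y => - (f' y * (/ f y * / f z))), (- (l * (/ f z * / f z))). split.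
- apply clim_opp; [apply cnear_filter|]. apply clim_mult; [apply cnear_filter | exact Hf |].
  apply clim_mult; [apply cnear_filter | apply clim_inv; auto; apply cnear_filter | apply clim_const, cnear_filter].
- generalize (filter_and (F := cnear z) _ _ Ef (clim_nz _ _ _ Hz Cf)). apply filter_imp.
  intros y [E N]. transitivity (- ((f y - f z) / (f y * f z))); [field; auto|].
  rewrite E. field. auto.
Qed.

Lemma cdiff_comp f g z : cdiff g z -> cdiff f (g z) -> cdiff (fun y => f (g y)) z.
Proof.
intros Dg [f' [l [Hf Ef]]]. assert (Cg := cdiff_ccont g z Dg).
destruct Dg as [g' [m [Hg Eg]]].
assert (Pull : forall P, cnear (g z) P -> cnear z (fun y => P (g y))).
{ intros P [d [Hd HP]]. generalize (Cg d Hd). apply filter_imp. auto. }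
exists (fun y => g' y * f' (g y)), (m * l). split.
- apply clim_mult; [apply cnear_filter | exact Hg |]. intros e He. apply (Pull _ (Hf e He)).
- generalize (filter_and (F := cnear z) _ _ Eg (Pull _ Ef)). apply filter_imp.
  intros y [E1 E2]. rewrite E2, E1. ring.
Qed.

Lemma cdiff_analytic r f z : analytic r f -> (Cmod z < r)%R -> cdiff f z.
Proof.
intros [M Hf] Hz. assert (Hr : (0 < r)%R) by (assert (Q := Cmod_ge_0 z); lra).
destruct (analytic_le_div r Hr M f z Hz Hf) as [g [Hg Eg]].
destruct (analytic_le_div r Hr _ g z Hz Hg) as [k [Hk Ek]].
set (B := (M / (r - Cmod z) / (r - Cmod z))%R) in Hk.
assert (N : cnear z (fun y => (Cmod y <= r)%R)).
{ exists (r - Cmod z)%R. split; [lra|]. intros y Hy. assert (Q := Cmod_sub_ge y z). lra. }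
exists g, (g z). split.
- intros e He.
  assert (HB : (0 <= B)%R).
  { eapply Rle_trans; [apply Cmod_ge_0 | apply (analytic_le_bound r B k z Hk); lra]. }
  assert (S : cnear z (fun y => (Cmod (y - z) < e / (B + 1))%R)).
  { exists (e / (B + 1))%R. split; auto. apply Rdiv_lt_0_compat; lra. }
  generalize (filter_and (F := cnear z) _ _ N S). apply filter_imp. intros y [H1 H2].
  rewrite Ek, Cmod_mult by auto. apply Rlt_div_r in H2; [|lra].
  assert (Bk := analytic_le_bound r B k y Hk H1). assert (Q := Cmod_ge_0 (y - z)).
  assert (Cmod (y - z) * Cmod (k y) <= Cmod (y - z) * B)%R by now apply Rmult_le_compat_l. nra.
- revert N. apply filter_imp. auto.
Qed.

Lemma cdiff_ex_derive f z : cdiff f z -> ex_derive (K:=C_AbsRing) (V:=C_NormedModule) f z.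
Proof.
intros [g [l [Hg Eg]]]. exists l. split; [apply is_linear_scal_l|].
intros x Hx eps. apply (is_filter_lim_locally_unique (V := AbsRing_NormedModule C_AbsRing)) in Hx. subst x.
assert (K := filter_and (F := cnear z) _ _ Eg (Hg eps (cond_pos eps))).
destruct K as [d [Hd K]]. exists (mkposreal d Hd). intros y Hy.
change (Cmod (y - z) < d)%R in Hy. destruct (K y Hy) as [E1 E2].
change (Cmod ((f y - f z) - (y - z) * l) <= eps * Cmod (y - z))%R.
rewrite E1. replace ((y - z) * g y - (y - z) * l) with ((y - z) * (g y - l)) by ring.
rewrite Cmod_mult, Rmult_comm. apply Rmult_le_compat_r; [apply Cmod_ge_0 | lra].
Qed.

Lemma ex_derive_ccont f z : ex_derive (K:=C_AbsRing) (V:=C_NormedModule) f z -> ccont f z.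
Proof.
intros H. apply ex_derive_continuous in H. intros e He.
assert (Hs : (0 < sqrt 2)%R) by (apply sqrt_lt_R0; lra).
assert (He' : (0 < e / sqrt 2)%R) by now apply Rdiv_lt_0_compat.
destruct (proj1 (filterlim_locally _ _) H (mkposreal _ He')) as [d Hd].
exists d. split; [apply cond_pos|]. intros y Hy.
assert (B := Hd y Hy). apply C_NormedModule_mixin_compat2 in B. simpl in B.
replace (sqrt 2 * (e / sqrt 2))%R with e in B by (field; lra). exact B.
Qed.

Lemma Cexp_derive_0 : exists g, clim (cnear 0) g 1 /\ forall z : C, Cexp z - 1 = z * g z.
Proof.
assert (Lin : forall (f : R -> R) l, derivable_pt_lim f 0 l -> forall e, (0 < e)%R ->
  exists d, (0 < d)%R /\ forall x, (Rabs x < d)%R -> (Rabs (f x - f 0 - l * x) <= e * Rabs x)%R).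
{ intros f l H e He. destruct (H e He) as [d Hd]. exists d. split; [apply cond_pos|].
  intros x Hx. destruct (Req_dec x 0) as [->|N].
  - rewrite Rabs_R0. replace (f 0 - f 0 - l * 0)%R with 0%R by ring. rewrite Rabs_R0. lra.
  - specialize (Hd x N Hx). rewrite Rplus_0_l in Hd.
    replace (f x - f 0 - l * x)%R with (((f x - f 0) / x - l) * x)%R by (field; auto).
    rewrite Rabs_mult. apply Rmult_le_compat_r; [apply Rabs_pos | lra]. }
exists (fun z : C => if dec z (RtoC 0) then RtoC 1 else (Cexp z - 1) / z). split.
2:{ intros z. destruct (dec z (RtoC 0)) as [->|N]; [|field; auto].
    unfold Cexp; simpl. rewrite exp_0, cos_0, sin_0. unfold Cminus, Cplus, Copp, Cmult, RtoC; simpl. f_equal; ring. }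
intros e He.
(* The two coordinates contribute errors of at most 4 and 5 times e' |z|, and 9 < 16. The bound e'
   <= 1 keeps the auxiliary factor 1 + x + E below 3. *)
set (e' := Rmin 1 (e / 16)). assert (He' : (0 < e')%R) by (apply Rmin_pos; lra).
assert (e1 : (e' <= 1)%R) by apply Rmin_l. assert (e2 : (e' <= e / 16)%R) by apply Rmin_r.
destruct (Lin exp _ (derivable_pt_lim_exp 0) e' He') as [d1 [P1 H1]].
destruct (Lin cos _ (derivable_pt_lim_cos 0) e' He') as [d2 [P2 H2]].
destruct (Lin sin _ (derivable_pt_lim_sin 0) e' He') as [d3 [P3 H3]].
exists (Rmin (Rmin d1 d2) (Rmin d3 e')). split; [apply Rmin_pos; apply Rmin_pos; assumption|].
intros z Hz. replace (z - 0) with z in Hz by ring.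
assert (Z1 : (Cmod z < d1)%R) by (eapply Rlt_le_trans; [exact Hz|]; eapply Rle_trans; [apply Rmin_l|]; apply Rmin_l).
assert (Z2 : (Cmod z < d2)%R) by (eapply Rlt_le_trans; [exact Hz|]; eapply Rle_trans; [apply Rmin_l|]; apply Rmin_r).
assert (Z3 : (Cmod z < d3)%R) by (eapply Rlt_le_trans; [exact Hz|]; eapply Rle_trans; [apply Rmin_r|]; apply Rmin_l).
assert (Z4 : (Cmod z < e')%R) by (eapply Rlt_le_trans; [exact Hz|]; eapply Rle_trans; [apply Rmin_r|]; apply Rmin_r).
destruct (dec z (RtoC 0)) as [->|N].
{ replace (1 - 1) with (RtoC 0) by ring. now rewrite Cmod_0. }
replace ((Cexp z - 1) / z - 1) with ((Cexp z - 1 - z) / z) by (field; auto).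
assert (Pz := proj1 (Cmod_gt_0 z) N).
rewrite Cmod_div by auto. apply Rlt_div_l; [exact Pz|].
eapply Rle_lt_trans; [apply Cmod_le_Re_Im|].
assert (X := re_le_Cmod z). assert (Y := im_le_Cmod z).
destruct z as [x y]. simpl in X, Y. unfold Cexp. simpl fst. simpl snd.
change (Rabs (exp x * cos y - 1 - x) + Rabs (exp x * sin y - 0 - y) < e * Cmod (x, y))%R.
specialize (H1 x ltac:(lra)). specialize (H2 y ltac:(lra)). specialize (H3 y ltac:(lra)).
rewrite exp_0 in H1. rewrite cos_0, sin_0 in H2. rewrite sin_0, cos_0 in H3.
set (m := Cmod (x, y)) in *.
set (E := (exp x - 1 - 1 * x)%R) in *. set (K := (cos y - 1 - - 0 * y)%R) in *. set (S := (sin y - 0 - 1 * y)%R) in *.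
assert (Ex : exp x = (1 + x + E)%R) by (unfold E; ring).
assert (Ey : cos y = (1 + K)%R) by (unfold K; ring).
assert (Es : sin y = (y + S)%R) by (unfold S; ring).
rewrite Ex, Ey, Es.
replace ((1 + x + E) * (1 + K) - 1 - x)%R with (E + (1 + x + E) * K)%R by ring.
replace ((1 + x + E) * (y + S) - 0 - y)%R with ((x + E) * y + (1 + x + E) * S)%R by ring.
assert (Q1 : (Rabs E <= e' * m)%R) by nra.
assert (Q2 : (Rabs K <= e' * m)%R) by nra.
assert (Q3 : (Rabs S <= e' * m)%R) by nra.
assert (Q4 : (Rabs (1 + x + E) <= 3)%R).
{ eapply Rle_trans; [apply Rabs_triang|]. assert (U := Rabs_triang 1 x). rewrite Rabs_R1 in U. nra. }
assert (Q5 : (Rabs (x + E) <= 2 * e')%R).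
{ eapply Rle_trans; [apply Rabs_triang|]. nra. }
assert (A1 : (Rabs (E + (1 + x + E) * K) <= 4 * (e' * m))%R).
{ eapply Rle_trans; [apply Rabs_triang|]. rewrite Rabs_mult.
  assert (Rabs (1 + x + E) * Rabs K <= 3 * (e' * m))%R by (apply Rmult_le_compat; auto; apply Rabs_pos). lra. }
assert (A2 : (Rabs ((x + E) * y + (1 + x + E) * S) <= 5 * (e' * m))%R).
{ eapply Rle_trans; [apply Rabs_triang|]. rewrite !Rabs_mult.
  assert (Rabs (1 + x + E) * Rabs S <= 3 * (e' * m))%R by (apply Rmult_le_compat; auto; apply Rabs_pos).
  assert (Rabs (x + E) * Rabs y <= (2 * e') * m)%R by (apply Rmult_le_compat; auto; apply Rabs_pos). lra. }
assert (e' * m <= e / 16 * m)%R by (apply Rmult_le_compat_r; lra).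
assert (0 < e * m)%R by now apply Rmult_lt_0_compat. lra.
Qed.

Lemma Cexp_plus x y : Cexp (x + y) = Cexp x * Cexp y.
Proof.
destruct x as [a b], y as [c d]. unfold Cexp, Cmult, Cplus; simpl.
rewrite exp_plus, cos_plus, sin_plus. f_equal; ring.
Qed.

Lemma cdiff_Cexp z : cdiff Cexp z.
Proof.
destruct Cexp_derive_0 as [g [Hg Eg]].
exists (fun y => Cexp z * g (y - z)), (Cexp z * 1). split.
- apply clim_mult; [apply cnear_filter | apply clim_const, cnear_filter |].
  intros e He. destruct (Hg e He) as [d [Hd H]]. exists d. split; auto.
  intros y Hy. apply H. now replace (y - z - 0) with (y - z) by ring.
- apply filter_forall. intros y. replace y with (z + (y - z)) at 1 by ring. rewrite Cexp_plus.
  transitivity (Cexp z * (Cexp (y - z) - 1)); [ring|]. rewrite Eg. ring.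
Qed.

(** * Connectedness of the unit interval *)

Lemma unit_interval_connected (P : R -> Prop) : P 0%R ->
  (forall t, (0 <= t <= 1)%R -> exists d, (0 < d)%R /\
    forall u, (0 <= u <= 1)%R -> (Rabs (u - t) < d)%R -> (P u <-> P t)) -> P 1%R.
Proof.
intros P0 H.
set (A := fun t => (0 <= t <= 1)%R /\ forall u, (0 <= u <= t)%R -> P u).
assert (A0 : A 0%R).
{ split; [lra|]. intros u Hu. replace u with 0%R by lra. exact P0. }
destruct (completeness A) as [s [S1 S2]].
- exists 1%R. intros t [Ht _]. lra.
- now exists 0%R.
- assert (Hs : (0 <= s <= 1)%R) by (split; [now apply S1 | apply S2; intros t [Ht _]; lra]).
  destruct (H s Hs) as [d [Hd K]].
  assert (T : exists t, A t /\ (s - d < t <= s)%R).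
  { destruct (classic (exists t, A t /\ (s - d < t)%R)) as [[t [At Ht]]|N].
    - exists t. exact (conj At (conj Ht (S1 t At))).
    - exfalso. assert (s <= s - d)%R; [|lra]. apply S2. intros t At. apply Rnot_lt_le.
      intros Ht. apply N. now exists t. }
  destruct T as [t [[At1 At2] Ht]].
  assert (Ps : P s).
  { apply (proj1 (K t At1 ltac:(apply Rabs_def1; lra))), At2. lra. }
  set (s' := Rmin 1 (s + d / 2)).
  assert (As' : A s').
  { assert (s' <= s + d / 2)%R by apply Rmin_r. assert (s' <= 1)%R by apply Rmin_l.
    assert (0 <= s')%R by (apply Rmin_glb; lra).
    split; [lra|]. intros u Hu. destruct (Rle_dec u t) as [L|L]; [apply At2; lra|].
    apply (proj2 (K u ltac:(lra) ltac:(apply Rabs_def1; lra))). exact Ps. }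
  assert (L := S1 s' As'). unfold s' in *.
  destruct (Rle_dec 1 (s + d / 2)) as [L1|L1].
  + rewrite Rmin_left in As' by auto. apply As'. lra.
  + rewrite Rmin_right in L by lra. lra.
Qed.

(** * Uniqueness of the cube root *)

Lemma in_H_near (tau y : C) : (Cmod (y - tau) < Im tau)%R -> in_H y.
Proof.
intros H. unfold in_H. assert (Q := im_le_Cmod (y - tau)).
replace (Im (y - tau)) with (Im y - Im tau)%R in Q by reflexivity.
apply Rabs_le_between in Q. lra.
Qed.

Lemma segment_bound (a b : C) (t d : R) : (0 <= t <= 1)%R -> (Cmod a < d)%R -> (Cmod b < d)%R ->
  (Cmod (a + t * (b - a)) < d)%R.
Proof.
intros Ht Ha Hb. replace (a + t * (b - a)) with (RtoC (1 - t) * a + t * b) by (rewrite RtoC_minus; ring).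
eapply Rle_lt_trans; [apply Cmod_triangle|]. rewrite !Cmod_mult, !Cmod_R, !Rabs_pos_eq by lra.
assert (M : (Rmax (Cmod a) (Cmod b) < d)%R) by now apply Rmax_lub_lt.
assert (A := Rmult_le_compat_l (1 - t) _ _ ltac:(lra) (Rmax_l (Cmod a) (Cmod b))).
assert (B := Rmult_le_compat_l t _ _ ltac:(lra) (Rmax_r (Cmod a) (Cmod b))). lra.
Qed.

(* If the segment from a to b meets 0, then b is a negative multiple of a. *)
Lemma segment_detour (a b : C) : a <> 0 -> b <> 0 ->
  (forall t : R, (0 <= t <= 1)%R -> a + t * (b - a) <> 0) \/
  ((forall t : R, (0 <= t <= 1)%R -> a + t * (Defs.Ci * a - a) <> 0) /\
   (forall t : R, (0 <= t <= 1)%R -> Defs.Ci * a + t * (b - Defs.Ci * a) <> 0)).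
Proof.
intros Ha Hb.
destruct (classic (exists t : R, (0 <= t <= 1)%R /\ a + t * (b - a) = 0)) as [[t [Ht E]]|N].
2:{ left. intros t Ht E. apply N. now exists t. }
right.
assert (NI : forall x y : R, RtoC x + RtoC y * Defs.Ci = 0 -> x = 0%R /\ y = 0%R).
{ intros x y H. unfold Defs.Ci, RtoC, Cplus, Cmult in H. simpl in H. injection H. intros; lra. }
assert (T0 : t <> 0%R).
{ intros ->. apply Ha. rewrite <- E. ring. }
assert (T0' : RtoC t <> 0) by (intros H; apply T0; now apply RtoC_inj).
(* Here b is a non-positive real multiple of a, so each leg through [Ci * a] runs between two
   perpendicular directions and meets 0 only if an end point is 0. *)
assert (Eb : b = - (RtoC ((1 - t) / t) * a)).
{ rewrite RtoC_div, RtoC_minus by auto.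
  replace b with ((a + t * (b - a) - (1 - t) * a) / t) by (field; auto). rewrite E. field; auto. }
split; intros r Hr H.
- apply Ha. apply Cmod_eq_0.
  destruct (Req_dec (Cmod a) 0) as [|Na]; auto. exfalso.
  replace (a + r * (Defs.Ci * a - a)) with (a * (RtoC (1 - r) + RtoC r * Defs.Ci)) in H by (rewrite RtoC_minus; ring).
  assert (H' : RtoC (1 - r) + RtoC r * Defs.Ci = 0).
  { replace (RtoC (1 - r) + RtoC r * Defs.Ci) with (a * (RtoC (1 - r) + RtoC r * Defs.Ci) / a) by (field; auto).
    rewrite H. field; auto. }
  apply NI in H'. lra.
- rewrite Eb in H.
  replace (Defs.Ci * a + r * (- (RtoC ((1 - t) / t) * a) - Defs.Ci * a)) with
    (a * (RtoC (- (r * ((1 - t) / t))) + RtoC (1 - r) * Defs.Ci)) in H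
    by (rewrite RtoC_opp, RtoC_mult, !RtoC_minus; ring).
  assert (H' : RtoC (- (r * ((1 - t) / t))) + RtoC (1 - r) * Defs.Ci = 0).
  { set (w := RtoC _ + _) in *. replace w with (a * w / a) by (field; auto). rewrite H. field; auto. }
  apply NI in H'. destruct H' as [H1 H2].
  assert (r = 1)%R by lra. subst r.
  apply Hb. rewrite Eb. replace ((1 - t) / t)%R with 0%R by lra. ring.
Qed.

Section Uniqueness.
Variables c c0 : C -> C.
Hypothesis Hc : forall tau, in_H tau -> ccont c tau.
Hypothesis Hc0 : forall tau, in_H tau -> ccont c0 tau.
Hypothesis Hcube : forall tau, in_H tau -> c tau ^ 3 = c0 tau ^ 3.
Hypothesis Hiso : forall tau, in_H tau ->
  (exists d, (0 < d)%R /\ forall y, (Cmod (y - tau) < d)%R -> c0 y = 0) \/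
  (exists d, (0 < d)%R /\ forall y, y <> tau -> (Cmod (y - tau) < d)%R -> c0 y <> 0).

Lemma near_in_H tau : in_H tau -> cnear tau in_H.
Proof. intros H. exists (Im tau). split; [exact H | apply in_H_near]. Qed.

(** Factor c^3 - c0^3 as (c - c0)(c^2 + c c0 + c0^2). Where the roots agree and are nonzero the
    second factor is 3 c0^2, hence nonzero nearby; where they differ the first stays nonzero. *)
Lemma roots_locally_constant tau : in_H tau -> c0 tau <> 0 ->
  cnear tau (fun y => c y = c0 y <-> c tau = c0 tau).
Proof.
intros Ht N. destruct (dec (c tau) (c0 tau)) as [E|E].
- assert (L : clim (cnear tau) (fun y => c y ^ 2 + c y * c0 y + c0 y ^ 2) (c tau ^ 2 + c tau * c0 tau + c0 tau ^ 2)).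
  { assert (A := Hc tau Ht). assert (B := Hc0 tau Ht). simpl.
    repeat first [apply clim_plus; [apply cnear_filter| |] | apply clim_mult; [apply cnear_filter| |]];
    auto; apply clim_const, cnear_filter. }
  apply clim_nz in L; [|apply cnear_filter|].
  + generalize (filter_and (F := cnear tau) _ _ L (near_in_H tau Ht)). apply filter_imp.
    intros y [Ny Hy]. split; [auto|]. intros _.
    assert (K := Hcube y Hy).
    replace (c y) with ((c y ^ 3 - c0 y ^ 3) / (c y ^ 2 + c y * c0 y + c0 y ^ 2) + c0 y) by (field; auto).
    rewrite K. field. auto.
  + rewrite E. replace (c0 tau ^ 2 + c0 tau * c0 tau + c0 tau ^ 2) with (3 * c0 tau ^ 2) by ring.
    apply Cmult_neq_0; [intros H; apply RtoC_inj in H; lra | now apply Cpow_nz].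
- assert (L : clim (cnear tau) (fun y => c y - c0 y) (c tau - c0 tau)).
  { apply clim_minus; [apply cnear_filter | now apply Hc | now apply Hc0]. }
  apply clim_nz in L; [|apply cnear_filter | now apply Cminus_eq_contra].
  revert L. apply filter_imp. intros y Ny. split; [|tauto]. intros H. exfalso. apply Ny. rewrite H. ring.
Qed.

Lemma roots_agree_segment (a b : C) :
  (forall t : R, (0 <= t <= 1)%R -> in_H (a + t * (b - a)) /\ c0 (a + t * (b - a)) <> 0) ->
  c a = c0 a -> c b = c0 b.
Proof.
intros H Ea. pose (g := fun t : R => a + t * (b - a)).
replace b with (g 1%R) by (unfold g; ring).
apply (unit_interval_connected (fun t => c (g t) = c0 (g t))).
- replace (g 0%R) with a by (unfold g; ring). exact Ea.
- intros t Ht. destruct (H t Ht) as [H1 H2].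
  destruct (roots_locally_constant _ H1 H2) as [d [Hd K]].
  assert (P := Cmod_ge_0 (b - a)).
  exists (d / (Cmod (b - a) + 1))%R. split; [apply Rdiv_lt_0_compat; lra|].
  intros u Hu Hut. apply K.
  replace (g u - (a + t * (b - a))) with (RtoC (u - t) * (b - a)) by (unfold g; rewrite RtoC_minus; ring).
  rewrite Cmod_mult, Cmod_R. apply Rlt_div_r in Hut; [|lra]. assert (Q := Rabs_pos (u - t)). nra.
Qed.

(** Agreement at the point alone would not do: at a zero of [c0] any two cube roots agree, so
    pointwise agreement need not be an open condition. *)
Definition agree_near (tau : C) : Prop := cnear tau (fun y => c y = c0 y).

Lemma agree_near_closed tau : in_H tau ->
  (forall d, (0 < d)%R -> exists y, (Cmod (y - tau) < d)%R /\ agree_near y) -> agree_near tau.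
Proof.
intros Ht Hcl. destruct (Hiso tau Ht) as [Z|[d0 [Hd0 N]]].
- unfold agree_near. generalize (filter_and (F := cnear tau) (fun y => c0 y = 0) in_H Z (near_in_H tau Ht)). apply filter_imp.
  intros y [Zy Hy]. assert (K := Hcube y Hy). rewrite Zy in K |- *.
  destruct (dec (c y) 0) as [|Ny]; auto. exfalso.
  apply (Cpow_nz _ 3 Ny). rewrite K. ring.
- set (d := Rmin d0 (Im tau)). assert (Hd : (0 < d)%R) by now apply Rmin_pos.
  assert (Hd1 : (d <= d0)%R) by apply Rmin_l. assert (Hd2 : (d <= Im tau)%R) by apply Rmin_r.
  (* An offset a <> 0 at which the roots agree; if y is tau itself, a small real step stays inside
     the disc of agreement. *)
  assert (St : exists a : C, a <> 0 /\ (Cmod a < d)%R /\ c (tau + a) = c0 (tau + a)).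
  { destruct (Hcl d Hd) as [y [Hy [e [He K]]]].
    destruct (dec y tau) as [->|Ny].
    - set (t := Rmin (d / 2) (e / 2)). assert (Ht0 : (0 < t)%R) by (apply Rmin_pos; lra).
      assert (T1 : (t <= d / 2)%R) by apply Rmin_l. assert (T2 : (t <= e / 2)%R) by apply Rmin_r.
      assert (M : Cmod t = t) by (rewrite Cmod_R; apply Rabs_pos_eq; lra).
      exists (RtoC t). split; [intros E; apply RtoC_inj in E; lra|]. split; [rewrite M; lra|].
      apply K. replace (tau + t - tau) with (RtoC t) by ring. rewrite M. lra.
    - exists (y - tau). split; [now apply Cminus_eq_contra|]. split; [exact Hy|].
      replace (tau + (y - tau)) with y by ring. apply (cnear_at y). now exists e. }
  destruct St as [a [Na [Ha Ea]]].
  assert (Seg : forall x z : C, (Cmod x < d)%R -> (Cmod z < d)%R ->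
    (forall t : R, (0 <= t <= 1)%R -> x + t * (z - x) <> 0) ->
    c (tau + x) = c0 (tau + x) -> c (tau + z) = c0 (tau + z)).
  { intros x z Hx Hz Nxz. apply roots_agree_segment. intros t T.
    assert (B := segment_bound x z t d T Hx Hz).
    set (y := tau + x + t * (tau + z - (tau + x))).
    assert (Ey : y - tau = x + t * (z - x)) by (unfold y; ring).
    split.
    - apply (in_H_near tau). rewrite Ey. lra.
    - apply N.
      + intros E. apply (Nxz t T). rewrite <- Ey, E. ring.
      + rewrite Ey. lra. }
  assert (All : forall b : C, b <> 0 -> (Cmod b < d)%R -> c (tau + b) = c0 (tau + b)).
  { intros b Nb Hb. destruct (segment_detour a b Na Nb) as [S|[S1 S2]].
    - now apply (Seg a b).
    - assert (Hm : (Cmod (Defs.Ci * a) < d)%R).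
      { rewrite Cmod_mult. change Defs.Ci with Coquelicot.Complex.Ci. rewrite Cmod_Ci. lra. }
      apply (Seg (Defs.Ci * a) b); auto. now apply (Seg a (Defs.Ci * a)). }
  exists d. split; [exact Hd|]. intros y Hy.
  destruct (dec y tau) as [->|Ny].
  (* The segments avoid the centre, where [c0] may vanish; agreement there follows by continuity
     along tau + t. *)
  + destruct (dec (c tau) (c0 tau)) as [|E]; auto. exfalso.
    assert (L : clim (cnear tau) (fun y => c y - c0 y) (c tau - c0 tau)).
    { apply clim_minus; [apply cnear_filter | now apply Hc | now apply Hc0]. }
    apply clim_nz in L; [|apply cnear_filter | now apply Cminus_eq_contra].
    destruct L as [e [He K]].
    set (t := Rmin (d / 2) (e / 2)). assert (Ht0 : (0 < t)%R) by (apply Rmin_pos; lra).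
    assert (T1 : (t <= d / 2)%R) by apply Rmin_l. assert (T2 : (t <= e / 2)%R) by apply Rmin_r.
    assert (M : Cmod t = t) by (rewrite Cmod_R; apply Rabs_pos_eq; lra).
    apply (K (tau + t)).
    * replace (tau + t - tau) with (RtoC t) by ring. rewrite M. lra.
    * rewrite All; [ring | intros X; apply RtoC_inj in X; lra | rewrite M; lra].
  + replace y with (tau + (y - tau)) by ring. apply All; auto. now apply Cminus_eq_contra.
Qed.

Lemma roots_agree (M : R) : (forall tau, (M < Im tau)%R -> c tau = c0 tau) ->
  forall tau, in_H tau -> c tau = c0 tau.
Proof.
intros Htop tau Ht. apply (cnear_at tau).
(* The vertical path starts at height Im tau + |M| + 1, so that the whole unit disc around its start
   lies above M. *)
set (L := (Rabs M + 1)%R). assert (HL : (0 < L)%R) by (unfold L; assert (Q := Rabs_pos M); lra).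
pose (g := fun t : R => tau + RtoC (L * (1 - t)) * Defs.Ci).
assert (Ig : forall t, Im (g t) = (Im tau + L * (1 - t))%R).
{ intros t. unfold g. simpl. unfold Im. ring. }
assert (Hg : forall t, (0 <= t <= 1)%R -> in_H (g t)).
{ intros t T. unfold in_H in *. rewrite Ig. nra. }
assert (E1 : g 1%R = tau).
{ unfold g. replace (L * (1 - 1))%R with 0%R by ring. ring. }
rewrite <- E1. apply (unit_interval_connected (fun t => agree_near (g t))).
- exists 1%R. split; [lra|]. intros y Hy. apply Htop.
  assert (Q := im_le_Cmod (y - g 0%R)).
  replace (Im (y - g 0%R)) with (Im y - Im (g 0%R))%R in Q by reflexivity.
  rewrite Ig in Q. apply Rabs_le_between in Q. unfold L in Q. unfold in_H in Ht.
  assert (Q' := Rle_abs M). lra.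
- intros t T.
  assert (K : forall P, cnear (g t) P -> exists d, (0 < d)%R /\ forall u, (Rabs (u - t) < d)%R -> P (g u)).
  { intros P [d [Hd H]]. exists (d / L)%R. split; [now apply Rdiv_lt_0_compat|].
    intros u Hu. apply H. replace (g u - g t) with (RtoC (L * (t - u)) * Defs.Ci).
    - rewrite Cmod_mult, Cmod_R. change Defs.Ci with Coquelicot.Complex.Ci. rewrite Cmod_Ci, Rmult_1_r, Rabs_mult.
      rewrite (Rabs_pos_eq L), Rabs_minus_sym by lra. apply Rlt_div_r in Hu; lra.
    - unfold g. rewrite !RtoC_mult, !RtoC_minus. ring. }
  destruct (classic (agree_near (g t))) as [G|G].
  + destruct (K _ (cnear_cnear _ _ G)) as [d [Hd H]]. exists d. split; auto.
    intros u _ Hu. split; auto. intros _. now apply H.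
  + assert (G' : cnear (g t) (fun y => ~ agree_near y)).
    { destruct (classic (cnear (g t) (fun y => ~ agree_near y))) as [|W]; auto. exfalso.
      apply G. apply agree_near_closed; auto. intros d Hd.
      destruct (classic (exists y, (Cmod (y - g t) < d)%R /\ agree_near y)) as [|V]; auto. exfalso.
      apply W. exists d. split; auto. intros y Hy Gy. apply V. now exists y. }
    destruct (K _ G') as [d [Hd H]]. exists d. split; auto.
    intros u _ Hu. split; [|tauto]. intros X. exfalso. now apply (H u Hu).
Qed.
End Uniqueness.

(** * The explicit cube root *)

Lemma Cexp_0 : Cexp 0 = 1.
Proof. unfold Cexp, RtoC; simpl. rewrite exp_0, cos_0, sin_0. f_equal; ring. Qed.

Lemma qpow_add a b tau : qpow (a + b) tau = qpow a tau * qpow b tau.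
Proof.
unfold qpow. rewrite <- Cexp_plus. f_equal.
replace (2 * PI * (a + b))%R with (2 * PI * a + 2 * PI * b)%R by ring. rewrite RtoC_plus. ring.
Qed.

Lemma qpow_0 tau : qpow 0 tau = 1.
Proof. unfold qpow. rewrite Rmult_0_r, Cmult_0_l. apply Cexp_0. Qed.

Lemma qpow_opp_r a tau : qpow a tau * qpow (- a) tau = 1.
Proof. rewrite <- qpow_add, Rplus_opp_r. apply qpow_0. Qed.

Lemma qpow_nz a tau : qpow a tau <> 0.
Proof. intros E. apply C1_nz. rewrite <- (qpow_opp_r a tau), E. ring. Qed.

Lemma qpow_opp a tau : qpow (- a) tau = / qpow a tau.
Proof.
assert (N := qpow_nz a tau). transitivity (qpow a tau * qpow (- a) tau / qpow a tau); [field; auto|].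
rewrite qpow_opp_r. field; auto.
Qed.

Lemma qpow_pow a tau n : qpow (a * INR n) tau = qpow a tau ^ n.
Proof.
induction n; [simpl; rewrite Rmult_0_r; apply qpow_0|].
rewrite S_INR, Rmult_plus_distr_l, Rmult_1_r, qpow_add, IHn, Cpow_S. ring.
Qed.

Lemma qpow_nat n tau : qpow (INR n) tau = q tau ^ n.
Proof. unfold q. rewrite <- qpow_pow. f_equal. ring. Qed.

(** 168 is the least common multiple of the denominators 56, 24 and 3, so all fractional powers of q
    become natural powers of one number. *)
Lemma qpow_168 (n : nat) a tau : (a * 168 = INR n)%R -> qpow a tau = qpow (1 / 168) tau ^ n.
Proof. intros H. rewrite <- qpow_pow. f_equal. lra. Qed.

Lemma qpow_mul7 a tau : qpow a (Cmult (RtoC 7) tau) = qpow (7 * a) tau.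
Proof.
unfold qpow. f_equal. replace (2 * PI * (7 * a))%R with (7 * (2 * PI * a))%R by ring.
rewrite (RtoC_mult 7). ring.
Qed.

Lemma q_mul7 tau : q (Cmult (RtoC 7) tau) = q tau ^ 7.
Proof. unfold q. rewrite qpow_mul7, <- qpow_pow. f_equal. simpl. ring. Qed.

Lemma Cmod_Cexp z : Cmod (Cexp z) = exp (Re z).
Proof.
destruct z as [a b]. unfold Cexp, Cmod; simpl fst; simpl snd.
assert (H := sin2_cos2 b). unfold Rsqr in H.
replace ((exp a * cos b) ^ 2 + (exp a * sin b) ^ 2)%R with (Rsqr (exp a)).
- apply sqrt_Rsqr. left. apply exp_pos.
- unfold Rsqr. transitivity (exp a * exp a * (sin b * sin b + cos b * cos b))%R; [rewrite H|]; ring.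
Qed.

Lemma Cmod_qpow a tau : Cmod (qpow a tau) = exp (- (2 * PI * a * Im tau)).
Proof. unfold qpow. rewrite Cmod_Cexp. f_equal. destruct tau as [x y]. simpl. ring. Qed.

Lemma Cmod_q_lt1 tau : in_H tau -> (Cmod (q tau) < 1)%R.
Proof.
intros H. unfold q. rewrite Cmod_qpow. apply Rlt_le_trans with (exp 0); [|rewrite exp_0; lra].
apply exp_increasing. assert (P := Rmult_lt_0_compat _ _ PI_RGT_0 H). lra.
Qed.

Lemma cdiff_qpow a tau : cdiff (qpow a) tau.
Proof.
apply (cdiff_comp Cexp (fun z => RtoC (2 * PI * a) * (Defs.Ci * z))); [|apply cdiff_Cexp].
repeat apply cdiff_mult; try apply cdiff_const. apply cdiff_id.
Qed.

(** Pulls isolated zeros in the variable q back to isolated zeros in tau. It holds because (exp z -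
    1) / z tends to 1 at 0. *)
Lemma q_locally_injective tau : cnear tau (fun y => q y = q tau -> y = tau).
Proof.
destruct Cexp_derive_0 as [g [Hg Eg]].
destruct (clim_nz _ _ _ C1_nz Hg) as [d [Hd N]].
assert (P := PI_RGT_0).
exists (d / (2 * PI))%R. split; [apply Rdiv_lt_0_compat; lra|].
intros y Hy E.
set (k := RtoC (2 * PI * 1) * Defs.Ci).
assert (Mk : Cmod k = (2 * PI)%R).
{ unfold k. rewrite Cmod_mult, Cmod_R. change Defs.Ci with Coquelicot.Complex.Ci. rewrite Cmod_Ci, Rabs_pos_eq; lra. }
assert (Nk : k <> 0) by (apply Cmod_gt_0; lra).
assert (X : Cexp (k * (y - tau)) = 1).
{ assert (Q : Cexp (k * (y - tau)) * q tau = q y).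
  { unfold q, qpow. rewrite <- Cexp_plus. f_equal. unfold k. ring. }
  assert (Nq : q tau <> 0) by apply qpow_nz.
  replace (Cexp (k * (y - tau))) with (Cexp (k * (y - tau)) * q tau / q tau) by (field; auto).
  rewrite Q, E. field; auto. }
assert (Y := Eg (k * (y - tau))). rewrite X in Y.
destruct (dec y tau) as [|Ny]; auto. exfalso.
assert (Ny' := Cminus_eq_contra _ _ Ny).
apply (Cmult_neq_0 (k * (y - tau)) (g (k * (y - tau)))).
- nz.
- apply N. replace (k * (y - tau) - 0) with (k * (y - tau)) by ring.
  rewrite Cmod_mult, Mk. apply Rlt_div_r in Hy; lra.
- rewrite <- Y. ring.
Qed.

Lemma inf_prod_triple (f g k : nat -> C) a b e :
  clim eventually (partial_prod f) a -> clim eventually (partial_prod g) b ->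
  clim eventually (partial_prod k) e -> inf_prod (fun n => f n * g n * k n) = a * b * e.
Proof.
intros Ha Hb He. apply inf_prod_eq.
apply (clim_ext _ (fun n => partial_prod f n * partial_prod g n * partial_prod k n)).
- apply filter_forall. intros n. now rewrite !partial_prod_mult.
- repeat (apply clim_mult; [apply eventually_filter | |]); auto.
Qed.

Definition phi7 (tau : C) : C := qpoch (q tau ^ 7) (q tau ^ 7).

Lemma one_minus_q_lim tau k : in_H tau ->
  clim eventually (partial_prod (fun n => one_minus_q tau (7 * n + k))) (qpoch (q tau ^ k) (q tau ^ 7)).
Proof.
intros Ht. apply (clim_ext _ (qpoch_n (q tau ^ k) (q tau ^ 7))).
- apply filter_forall. intros n. apply partial_prod_ext. intros i.
  unfold qfactor, one_minus_q. rewrite qpow_nat, <- Cpow_mult_r, <- Cpow_add_r. do 2 f_equal. lia.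
- apply qpoch_lim. apply Cmod_pow_lt1. now apply Cmod_q_lt1.
Qed.

Lemma u_eq tau : in_H tau -> u tau = qpow (1 / 56) tau * (theta7 3 (q tau) * phi7 tau).
Proof. intros Ht. unfold u. f_equal. apply inf_prod_triple; now apply one_minus_q_lim. Qed.

Lemma v_eq tau : in_H tau -> v tau = qpow (9 / 56) tau * (theta7 2 (q tau) * phi7 tau).
Proof. intros Ht. unfold v. f_equal. apply inf_prod_triple; now apply one_minus_q_lim. Qed.

Lemma w_eq tau : in_H tau -> w tau = qpow (25 / 56) tau * (theta7 1 (q tau) * phi7 tau).
Proof. intros Ht. unfold w. f_equal. apply inf_prod_triple; now apply one_minus_q_lim. Qed.

Lemma eta_eq tau : in_H tau -> eta tau = qpow (1 / 24) tau * qpoch (q tau) (q tau).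
Proof.
intros Ht. unfold eta. f_equal. apply inf_prod_eq.
apply (clim_ext _ (qpoch_n (q tau) (q tau))).
- apply filter_forall. intros n. apply partial_prod_ext. intros i.
  unfold qfactor, one_minus_q. now rewrite qpow_nat.
- apply qpoch_lim. now apply Cmod_q_lt1.
Qed.

(** This is X^2 + Y^2 + (U V^3)^2, equal to 2 (X^2 + XY + Y^2) by Klein's quartic; hence the 2 in
    [klein_den]. The symmetric form is the numerator of u^4/v^2 + w^4/u^2 + v^4/w^2 itself. *)
Definition klein_num (z : C) : C :=
  theta7 3 z ^ 6 * theta7 1 z ^ 2 + z ^ 2 * (theta7 1 z ^ 6 * theta7 2 z ^ 2) + theta7 3 z ^ 2 * theta7 2 z ^ 6.

Definition klein_den (z : C) : C := 2 * (theta7 3 z * theta7 2 z * theta7 1 z) ^ 4.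

Definition cube_root (tau : C) : C := qpow (- (1 / 3)) tau * (klein_num (q tau) * / klein_den (q tau)).

Lemma Cnz2 : (2 : C) <> 0.
Proof. intros E; apply RtoC_inj in E; lra. Qed.

Lemma klein_den_nz z : (Cmod z < 1)%R -> klein_den z <> 0.
Proof.
intros Hz. unfold klein_den. apply Cmult_neq_0; [apply Cnz2|].
nz; apply theta7_nz; auto; lia.
Qed.

Lemma analytic_theta7 r k : (0 < r < 1)%R -> analytic r (theta7 k).
Proof.
intros Hr. unfold theta7.
apply (analytic_mult r (proj1 Hr) (fun z => qpoch (z ^ k) (z ^ 7)) (fun z => qpoch (z ^ (7 - k)) (z ^ 7)));
  apply analytic_qpoch; auto; lia.
Qed.

Lemma analytic_klein_num r : (0 < r < 1)%R -> analytic r klein_num.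
Proof.
intros Hr. assert (R := proj1 Hr). assert (T := fun k => analytic_theta7 r k Hr).
assert (TP := fun k n => analytic_pow r R _ n (T k)).
unfold klein_num.
apply (analytic_plus r R (fun z => _ + _)); [apply (analytic_plus r R (fun z => _ * _))|].
- apply (analytic_mult r R (fun z => _ ^ _)); apply TP.
- apply (analytic_mult r R (fun z => _ ^ _)); [apply analytic_pow, analytic_id; auto|].
  apply (analytic_mult r R (fun z => _ ^ _)); apply TP.
- apply (analytic_mult r R (fun z => _ ^ _)); apply TP.
Qed.

Lemma analytic_klein_den r : (0 < r < 1)%R -> analytic r klein_den.
Proof.
intros Hr. assert (R := proj1 Hr). assert (T := fun k => analytic_theta7 r k Hr).
unfold klein_den. apply (analytic_mult r R (fun z => 2)); [now apply analytic_const|].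
apply (analytic_pow r R (fun z => _ * _ * _)).
apply (analytic_mult r R (fun z => _ * _)); [apply (analytic_mult r R)|]; apply T.
Qed.

Lemma cdiff_klein z : (Cmod z < 1)%R -> cdiff (fun y => klein_num y * / klein_den y) z.
Proof.
intros Hz. set (r := ((1 + Cmod z) / 2)%R). assert (Q := Cmod_ge_0 z).
assert (Hr : (0 < r < 1)%R) by (unfold r; lra). assert (Hzr : (Cmod z < r)%R) by (unfold r; lra).
apply cdiff_mult; [apply (cdiff_analytic r); auto; now apply analytic_klein_num|].
apply cdiff_inv; [now apply klein_den_nz|]. apply (cdiff_analytic r); auto. now apply analytic_klein_den.
Qed.

Lemma cdiff_cube_root tau : in_H tau -> cdiff cube_root tau.
Proof.
intros Ht. apply cdiff_mult; [apply cdiff_qpow|].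
apply (cdiff_comp (fun y => klein_num y * / klein_den y) q); [apply cdiff_qpow|].
apply cdiff_klein. now apply Cmod_q_lt1.
Qed.

Lemma cube_root_zeros tau : in_H tau ->
  (exists d, (0 < d)%R /\ forall y, (Cmod (y - tau) < d)%R -> cube_root y = 0) \/
  (exists d, (0 < d)%R /\ forall y, y <> tau -> (Cmod (y - tau) < d)%R -> cube_root y <> 0).
Proof.
intros Ht. assert (Hz := Cmod_q_lt1 tau Ht).
set (r := ((1 + Cmod (q tau)) / 2)%R). assert (Q := Cmod_ge_0 (q tau)).
assert (Hr : (0 < r < 1)%R) by (unfold r; lra). assert (Hzr : (Cmod (q tau) < r)%R) by (unfold r; lra).
assert (Cq : ccont q tau) by apply cdiff_ccont, cdiff_qpow.
destruct (analytic_zero_dichotomy r (proj1 Hr) klein_num (q tau) (analytic_klein_num r Hr) Hzr)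
  as [[d [Hd Z]]|[d [Hd N]]].
- left. generalize (Cq d Hd). apply (filter_imp (F := cnear tau)). intros y Hy.
  unfold cube_root. rewrite Z by auto. ring.
- right. destruct (filter_and (F := cnear tau) _ _ (Cq d Hd)
    (filter_and (F := cnear tau) _ _ (near_in_H tau Ht) (q_locally_injective tau))) as [e [He K]].
  exists e. split; auto. intros y Ny Hy. destruct (K y Hy) as [K1 [K2 K3]].
  unfold cube_root. apply Cmult_neq_0; [apply qpow_nz|]. apply Cmult_neq_0.
  + apply N; auto.
  + apply Cinv_nz, klein_den_nz. now apply Cmod_q_lt1.
Qed.

(** The leading coefficient at the cusp: every theta factor is 1 at z = 0, and of the three summands
    of [klein_num] the middle one vanishes with z^2. *)
Lemma klein_at_0 : klein_num 0 * / klein_den 0 = 1.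
Proof.
assert (E : qpoch 0 0 = 1).
{ apply inf_prod_eq. apply (clim_ext _ (fun _ => 1)); [|apply clim_const, eventually_filter].
  apply filter_forall. intros n. induction n; simpl; [reflexivity|]. rewrite <- IHn. unfold qfactor. ring. }
assert (T : forall k, (0 < k < 7)%nat -> theta7 k 0 = 1).
{ intros k Hk. unfold theta7.
  assert (Z : forall n, (0 < n)%nat -> (0 : C) ^ n = 0) by (intros [|n] Hn; [lia | simpl; ring]).
  rewrite !Z by lia. rewrite E. ring. }
unfold klein_num, klein_den. rewrite !T by lia. field.
Qed.

Lemma cube_root_expansion : exists K M : R, forall tau, (M < Im tau)%R ->
  (Cmod (cube_root tau * qpow (1 / 3) tau - 1) <= K * Cmod (q tau))%R.
Proof.
destruct (cdiff_klein 0 ltac:(rewrite Cmod_0; lra)) as [g [l [Hg Eg]]].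
rewrite klein_at_0 in Eg.
destruct (filter_and (F := cnear 0) _ _ Eg (Hg 1%R Rlt_0_1)) as [d [Hd K]].
(* Above height 1/d one has |q| < d because exp(2 pi Im tau) > Im tau; in that disc the difference
   quotient is within 1 of its limit [l]. *)
exists (Cmod l + 1)%R, (/ d)%R. intros tau Ht.
assert (Pd := Rinv_0_lt_compat d Hd).
assert (Hq : (Cmod (q tau) < d)%R).
{ unfold q. rewrite Cmod_qpow, exp_Ropp.
  rewrite <- (Rinv_inv d). apply Rinv_lt_contravar; [apply Rmult_lt_0_compat; [auto | apply exp_pos]|].
  assert (P := PI2_1). assert (X := exp_ineq1_le (2 * PI * 1 * Im tau)). nra. }
destruct (K (q tau)) as [K1 K2].
{ now replace (q tau - 0) with (q tau) by ring. }
unfold cube_root.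
replace (qpow (- (1 / 3)) tau * (klein_num (q tau) * / klein_den (q tau)) * qpow (1 / 3) tau) with
  (klein_num (q tau) * / klein_den (q tau) * (qpow (1 / 3) tau * qpow (- (1 / 3)) tau)) by ring.
rewrite qpow_opp_r, Cmult_1_r, K1. replace (q tau - 0) with (q tau) by ring.
rewrite Cmod_mult, Rmult_comm. apply Rmult_le_compat_r; [apply Cmod_ge_0|].
assert (X := Cmod_sub_ge (g (q tau)) l). lra.
Qed.

Lemma theta7_q_nz tau k : in_H tau -> (0 < k < 7)%nat -> theta7 k (q tau) <> 0.
Proof. intros Ht Hk. apply theta7_nz; auto. now apply Cmod_q_lt1. Qed.

Lemma phi7_nz tau : in_H tau -> phi7 tau <> 0.
Proof. intros Ht. apply qpoch_nz_small; apply Cmod_pow_lt1; now apply Cmod_q_lt1. Qed.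

Lemma theta7_q_relations tau : in_H tau ->
  let U := theta7 3 (q tau) in let V := theta7 2 (q tau) in let W := theta7 1 (q tau) in
  let X := U ^ 3 * W in let Y := q tau * W ^ 3 * V in
  U * V ^ 3 = X + Y /\
  (U * V * W) ^ 4 * (X * Y * (X + Y)) = q tau * (X ^ 3 - 5 * X ^ 2 * Y - 8 * X * Y ^ 2 - Y ^ 3).
Proof.
intros Ht. apply (theta7_relations (q tau) (qpow (7 / 2) tau)).
- apply qpow_nz.
- now apply Cmod_q_lt1.
- rewrite <- qpow_add, <- qpow_nat. f_equal. simpl. lra.
Qed.

Lemma eta_theta7 tau : in_H tau ->
  eta tau = qpow (1 / 24) tau * (theta7 3 (q tau) * theta7 2 (q tau) * theta7 1 (q tau) * phi7 tau) /\
  eta (Cmult (RtoC 7) tau) = qpow (7 / 24) tau * phi7 tau.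
Proof.
intros Ht. split.
- rewrite eta_eq, qpoch_split7 by (auto; now apply Cmod_q_lt1). reflexivity.
- rewrite eta_eq.
  + rewrite q_mul7, qpow_mul7. unfold phi7. do 2 f_equal. lra.
  + unfold in_H in *. simpl. unfold Im in *. simpl. lra.
Qed.

Lemma cube_root_cubed tau : in_H tau -> cube_root tau ^ 3 = j7star tau.
Proof.
intros Ht. destruct (theta7_q_relations tau Ht) as [Klein Rel].
destruct (eta_theta7 tau Ht) as [E1 E7].
assert (NU := theta7_q_nz tau 3 Ht ltac:(lia)). assert (NV := theta7_q_nz tau 2 Ht ltac:(lia)).
assert (NW := theta7_q_nz tau 1 Ht ltac:(lia)). assert (Nphi := phi7_nz tau Ht).
unfold j7star, cube_root, klein_num, klein_den. cbv zeta. rewrite E1, E7.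
rewrite qpow_opp. set (g := qpow (1 / 168) tau).
rewrite (qpow_168 7 (1 / 24)), (qpow_168 49 (7 / 24)), (qpow_168 56 (1 / 3)) by (simpl; lra). fold g.
assert (Eq : q tau = g ^ 168) by (apply qpow_168; simpl; lra).
assert (Ng : g <> 0) by apply qpow_nz.
assert (Nq : q tau <> 0) by apply qpow_nz.
set (U := theta7 3 (q tau)) in *. set (V := theta7 2 (q tau)) in *. set (W := theta7 1 (q tau)) in *.
set (h := (U * V * W) ^ 4 / q tau).
set (X := U ^ 3 * W) in *. set (Y := q tau * W ^ 3 * V) in *.
assert (Nh : h <> 0) by (unfold h; nz).
assert (Eh : (g ^ 7 * (U * V * W * phi7 tau) / (g ^ 49 * phi7 tau)) ^ 4 = h).
{ unfold h. rewrite Eq. field. auto. }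
rewrite Cpow_inv by (unfold Cdiv; nz). rewrite Eh.
assert (EP : X ^ 3 - 5 * X ^ 2 * Y - 8 * X * Y ^ 2 - Y ^ 3 = h * (X * Y * (X + Y))).
{ replace (X ^ 3 - 5 * X ^ 2 * Y - 8 * X * Y ^ 2 - Y ^ 3) with
    (q tau * (X ^ 3 - 5 * X ^ 2 * Y - 8 * X * Y ^ 2 - Y ^ 3) / q tau) by (field; auto).
  rewrite <- Rel. unfold h. field; auto. }
assert (ES : X * Y * (X + Y) = q tau ^ 2 * h).
{ rewrite <- Klein. unfold X, Y, h. field; auto. }
assert (EQ : U ^ 6 * W ^ 2 + q tau ^ 2 * (W ^ 6 * V ^ 2) + U ^ 2 * V ^ 6 = 2 * (X ^ 2 + X * Y + Y ^ 2)).
{ transitivity (X ^ 2 + Y ^ 2 + (U * V ^ 3) ^ 2); [unfold X, Y; ring|]. rewrite Klein. ring. }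
rewrite EQ. replace ((U * V * W) ^ 4) with (q tau * h) by (unfold h; field; auto).
transitivity ((X ^ 2 + X * Y + Y ^ 2) ^ 3 / (q tau ^ 4 * h ^ 3)).
{ generalize Nh (X ^ 2 + X * Y + Y ^ 2). generalize h. intros h' Nh' Q.
  rewrite Eq. field. split; auto. }
(* With P the cubic form and N = X Y (X + Y), the identity (X^2 + XY + Y^2)^3 = P^2 + 13 P N + 49
   N^2 is the origin of 13 and 49: since P = h N, dividing by h N^2 = q^4 h^3 gives h + 13 +
   49/h. *)
replace ((X ^ 2 + X * Y + Y ^ 2) ^ 3) with
  ((X ^ 3 - 5 * X ^ 2 * Y - 8 * X * Y ^ 2 - Y ^ 3) ^ 2
   + 13 * (X ^ 3 - 5 * X ^ 2 * Y - 8 * X * Y ^ 2 - Y ^ 3) * (X * Y * (X + Y))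
   + 49 * (X * Y * (X + Y)) ^ 2) by ring.
rewrite EP, ES. field. auto.
Qed.

(** Near 1 the cofactor A^2 + AB + B^2 of A - B in A^3 - B^3 differs from 3 by less than 3, so it
    cannot vanish. *)
Lemma cubes_near_1 (A B : C) : A ^ 3 = B ^ 3 ->
  (Cmod (A - 1) < 1 / 4)%R -> (Cmod (B - 1) < 1 / 4)%R -> A = B.
Proof.
intros E HA HB.
set (a := A - 1) in *. set (b := B - 1) in *.
set (s := A ^ 2 + A * B + B ^ 2).
assert (Es : s - 3 = 3 * a + 3 * b + (a * a + a * b + b * b)) by (unfold s, a, b; ring).
assert (N : s <> 0).
{ intros Z. rewrite Z in Es.
  assert (M : Cmod (0 - 3) = 3%R) by (replace (0 - 3) with (RtoC (-3)) by (rewrite <- RtoC_minus; f_equal; ring);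
    rewrite Cmod_R, Rabs_left; lra).
  rewrite Es in M.
  assert (T1 := Cmod_triangle (3 * a + 3 * b) (a * a + a * b + b * b)).
  assert (T2 := Cmod_triangle (3 * a) (3 * b)).
  assert (T3 := Cmod_triangle (a * a + a * b) (b * b)).
  assert (T4 := Cmod_triangle (a * a) (a * b)).
  rewrite !Cmod_mult in T2. rewrite !Cmod_mult in T3. rewrite !Cmod_mult in T4.
  rewrite Cmod_R, Rabs_pos_eq in T2 by lra.
  assert (Pa := Cmod_ge_0 a). assert (Pb := Cmod_ge_0 b). nra. }
replace A with ((A ^ 3 - B ^ 3) / s + B) by (unfold s in *; field; auto).
rewrite E. field. auto.
Qed.

(** Here [x] is the constant of an expansion, about whose sign nothing is known. The estimate uses
    only |q| Im tau <= 1. *)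
Lemma Cmod_q_small (tau : C) (x : R) : (4 * Rabs x + 1 < Im tau)%R -> (x * Cmod (q tau) < 1 / 4)%R.
Proof.
intros H. assert (P := Rabs_pos x). assert (Q := Rle_abs x).
assert (X := exp_ineq1_le (2 * PI * 1 * Im tau)). assert (P2 := PI2_1).
assert (Hq : (Cmod (q tau) * Im tau <= 1)%R).
{ unfold q. rewrite Cmod_qpow, exp_Ropp.
  assert (E := exp_pos (2 * PI * 1 * Im tau)).
  apply Rmult_le_reg_l with (exp (2 * PI * 1 * Im tau)); [exact E|].
  rewrite <- Rmult_assoc, Rinv_r, Rmult_1_l, Rmult_1_r by lra.
  assert (1 * Im tau <= PI * Im tau)%R by (apply Rmult_le_compat_r; lra). lra. }
assert (G := Cmod_ge_0 (q tau)).
assert (x * Cmod (q tau) <= Rabs x * Cmod (q tau))%R by now apply Rmult_le_compat_r.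
destruct (Rle_lt_dec (1 / 4) (Rabs x * Cmod (q tau))) as [L|L]; [|lra].
exfalso. assert (Cmod (q tau) * (4 * Rabs x + 1) < Cmod (q tau) * Im tau \/ Cmod (q tau) = 0)%R.
{ destruct G as [G|G]; [left; now apply Rmult_lt_compat_l | right; auto]. }
destruct H1 as [H1|H1]; [|rewrite H1 in L; lra]. lra.
Qed.

Lemma cube_root_is_j7star_cube_root : is_j7star_cube_root cube_root.
Proof.
split; [|split].
- intros tau Ht. apply cdiff_ex_derive. now apply cdiff_cube_root.
- apply cube_root_cubed.
- apply cube_root_expansion.
Qed.

Lemma j7star_cube_root_unique c tau : is_j7star_cube_root c -> in_H tau -> c tau = cube_root tau.
Proof.
intros [Hd [Hcube [K [M Hexp]]]] Ht.
destruct cube_root_expansion as [K0 [M0 Hexp0]].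
assert (E3 : forall tau, in_H tau -> c tau ^ 3 = cube_root tau ^ 3).
{ intros y Hy. rewrite cube_root_cubed by auto. now apply Hcube. }
(* Adding its absolute value to the maximum gives a number that is at least 0 and at least the
   maximum, so this one height exceeds M, M0 and both thresholds of [Cmod_q_small]. *)
apply (roots_agree c cube_root) with (M := (Rmax M M0 + Rabs (Rmax M M0) + (4 * Rabs K + 1) + (4 * Rabs K0 + 1))%R); auto.
- intros y Hy. apply ex_derive_ccont. now apply Hd.
- intros y Hy. apply cdiff_ccont. now apply cdiff_cube_root.
- apply cube_root_zeros.
- intros y Hy.
  assert (L1 := Rmax_l M M0). assert (L2 := Rmax_r M M0). assert (L3 := Rle_abs (- Rmax M M0)).
  rewrite Rabs_Ropp in L3. assert (L4 := Rabs_pos (Rmax M M0)). assert (L5 := Rabs_pos K). assert (L6 := Rabs_pos K0).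
  assert (Hy0 : in_H y) by (unfold in_H; lra).
  assert (N := qpow_nz (1 / 3) y).
  assert (Eq : c y * qpow (1 / 3) y = cube_root y * qpow (1 / 3) y).
  { apply cubes_near_1.
    - rewrite !Cpow_mult_l. now rewrite E3.
    - eapply Rle_lt_trans; [apply Hexp; lra|]. apply Cmod_q_small. lra.
    - eapply Rle_lt_trans; [apply Hexp0|]. 2: apply Cmod_q_small. all: lra. }
  replace (c y) with (c y * qpow (1 / 3) y / qpow (1 / 3) y) by (field; auto).
  rewrite Eq. field; auto.
Qed.

Theorem theorem8 :
  (exists c : C -> C, is_j7star_cube_root c) /\
  (forall c : C -> C, is_j7star_cube_root c ->
   forall tau : C, in_H tau ->
     Cplus (Cplus (Cdiv (Cpow (u tau) 4) (Cpow (v tau) 2))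
                  (Cdiv (Cpow (w tau) 4) (Cpow (u tau) 2)))
           (Cdiv (Cpow (v tau) 4) (Cpow (w tau) 2))
     = Cmult (Cmult (RtoC 2) (Cpow (eta tau) 2)) (c tau)
   /\
     Cplus (Cplus (Cdiv (Cpow (v tau) 2) (Cpow (u tau) 4))
                  (Cdiv (Cpow (u tau) 2) (Cpow (w tau) 4)))
           (Cdiv (Cpow (w tau) 2) (Cpow (v tau) 4))
     = Cmult (Cdiv (Cpow (eta tau) 2) (Cpow (eta (Cmult (RtoC 7) tau)) 4))
             (Cpow (c tau) 2)).
Proof.
split; [exists cube_root; apply cube_root_is_j7star_cube_root|].
intros c Hc tau Ht. rewrite (j7star_cube_root_unique c tau Hc Ht).
destruct (theta7_q_relations tau Ht) as [Klein _].
destruct (eta_theta7 tau Ht) as [E1 E7].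
assert (NU := theta7_q_nz tau 3 Ht ltac:(lia)). assert (NV := theta7_q_nz tau 2 Ht ltac:(lia)).
assert (NW := theta7_q_nz tau 1 Ht ltac:(lia)). assert (Nphi := phi7_nz tau Ht).
rewrite E1, E7, u_eq, v_eq, w_eq by exact Ht.
unfold cube_root, klein_num, klein_den. rewrite qpow_opp.
rewrite (qpow_168 7 (1 / 24)), (qpow_168 49 (7 / 24)), (qpow_168 56 (1 / 3)),
  (qpow_168 3 (1 / 56)), (qpow_168 27 (9 / 56)), (qpow_168 75 (25 / 56)) by (simpl; lra).
assert (Eq : q tau = qpow (1 / 168) tau ^ 168) by (apply qpow_168; simpl; lra).
assert (Ng := qpow_nz (1 / 168) tau).
revert Klein. set (U := theta7 3 (q tau)) in *. set (V := theta7 2 (q tau)) in *. set (W := theta7 1 (q tau)) in *.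
rewrite Eq. set (g := qpow (1 / 168) tau) in *. set (phi := phi7 tau) in *.
clearbody U V W g phi. clear - NU NV NW Nphi Ng. intros Klein.
split.
(* By the form of [klein_num] this is an identity of rational functions in independent g, U, V, W
   and phi. *)
- field. repeat split; auto.
- set (X := U ^ 3 * W) in *. set (Y := g ^ 168 * W ^ 3 * V) in *.
  assert (NX : X <> 0) by (unfold X; nz). assert (NY : Y <> 0) by (unfold Y; nz).
  assert (NXY : X + Y <> 0) by (rewrite <- Klein; nz).
  replace (U ^ 6 * W ^ 2 + (g ^ 168) ^ 2 * (W ^ 6 * V ^ 2) + U ^ 2 * V ^ 6) with (2 * (X ^ 2 + X * Y + Y ^ 2)).
  2:{ transitivity (X ^ 2 + Y ^ 2 + (U * V ^ 3) ^ 2); [rewrite Klein; ring | unfold X, Y; ring]. }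
  (* The three reciprocals are proportional to 1/X^2, 1/Y^2 and 1/(U V^3)^2. Klein's quartic turns
     the last into 1/(X + Y)^2, and the sum is then the perfect square of (X^2 + XY + Y^2) / (X Y (X
     + Y)). *)
  transitivity (g ^ 42 * (U * V * W) ^ 2 / phi ^ 2 * (/ X ^ 2 + / Y ^ 2 + / (U * V ^ 3) ^ 2)).
  { unfold X, Y. field. auto. }
  transitivity (g ^ 42 * (U * V * W) ^ 2 / phi ^ 2 * ((X ^ 2 + X * Y + Y ^ 2) ^ 2 / (X * Y * (U * V ^ 3)) ^ 2)).
  { f_equal. rewrite Klein. field. auto. }
  generalize (X ^ 2 + X * Y + Y ^ 2). intros Q. unfold X, Y. field. auto.
Qed.
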